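(* Let $H=(V,E,w)$, $\mathcal{L}$, $x_1$, $\Pi$ and $\gamma_2=\min\{\mathcal{D}(x):0\neq x\perp x_1\}$ be as in the context, let $\eta\ge 0$, let $(B_t)_{t\ge 0}$ be a standard $n$-dimensional Brownian motion (independent coordinates indexed by $V$), and let $(X_t)_{t\ge0}$ be the Itô process in $\mathbb{R}^V$ with initial value $X_0$ satisfying $dX_t=-\mathcal{L}X_t\,dt+\sqrt{\eta}\,dB_t$. Then for each $t\ge 0$, the random variable $\|\Pi X_t\|_2$ is stochastically dominated by $\|\widehat{X}_t\|_2$, where $\widehat{X}_t$ has the distribution of $e^{-\gamma_2 t}\Pi X_0+\sqrt{\frac{\eta}{2\gamma_2}(1-e^{-2\gamma_2 t})}\cdot N(0,1)^V$, and $N(0,1)^V$ denotes the standard $n$-dimensional Gaussian distribution with independent coordinates.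
   Context: $H=(V,E,w)$: $V$ finite, $n=|V|\ge 2$, every hyperedge $e\in E$ is a nonempty subset of $V$, edge weights $w_e\ge 0$. Vertex weights $w_v=\sum_{e\ni v}w_e$, assumed $>0$; $w(X)=\sum_{v\in X}w_v$. $W=\mathrm{diag}(w_v)$, $\mathbf{1}$ the all-ones vector, $x_1=W^{1/2}\mathbf{1}$, $\Pi$ the orthogonal projection (standard inner product) onto the orthogonal complement of $x_1$. Normalized discrepancy ratio: $\mathcal{D}(x)=\frac{\sum_{e\in E}w_e\max_{u,v\in e}(x_u/\sqrt{w_u}-x_v/\sqrt{w_v})^2}{\sum_u x_u^2}$ for $x\ne0$. Laplacian. For $f\in\mathbb{R}^V$ and $e\in E$ let $S_e(f)=\{u\in e: f_u=\max_{v\in e}f_v\}$, $I_e(f)=\{u\in e: f_u=\min_{v\in e}f_v\}$, $c_e=w_e(\max_{v\in e}f_v-\min_{v\in e}f_v)$, $c(F)=\sum_{e\in F}c_e$. Define $r=r(f)$: partition $V$ into classes of equal $f$-value; for each class $U$ start with $E_U=\{e:(I_e(f)\cup S_e(f))\cap U\ne\emptyset\}$; for nonempty $X\subseteq U$ let $I_X=\{e\in E_U:I_e(f)\subseteq X\}$, $S_X=\{e\in E_U:S_e(f)\cap X\ne\emptyset\}$, $\delta(X)=(c(I_X)-c(S_X))/w(X)$; pick nonempty $P\subseteq U$ maximizing $\delta$, set $r_u=\delta(P)$ for $u\in P$, and repeat with $U\setminus P$ and edge set $E_U\setminus(I_P\cup S_P)$ until all of $U$ is assigned (the result is independent of the choice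 of maximizers). Set $\mathcal{L}_wf=-r(f)$ and normalized Laplacian $\mathcal{L}x=W^{1/2}\mathcal{L}_w(W^{-1/2}x)$.
   Formalization: After the first stage, ''I_e(f) ⊆ X'' is read as I_e(f) ⊆ X together with the vertices of the class already assigned, since literally r depends on the choice of maximizers; when γ_2 = 0 the undefined variance η/(2γ_2)(1−e^{−2γ_2 t}) is read as its limit ηt. *)

(* Defs.v *)
From HB Require Import structures.
From mathcomp Require Import all_boot all_order all_algebra.
From mathcomp Require Import all_classical all_reals all_analysis.
Set Implicit Arguments.
Unset Strict Implicit.
Unset Printing Implicit Defensive.
Import Order.TTheory GRing.Theory Num.Theory.
Import numFieldNormedType.Exports.
Local Open Scope classical_set_scope.
Local Open Scope ring_scope.

(* Vectors of R^V are functions V -> R. *)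

Definition vdot (R : realType) (V : finType) (x y : V -> R) : R :=
  \sum_v x v * y v.

Definition vnorm (R : realType) (V : finType) (x : V -> R) : R :=
  Num.sqrt (vdot x x).

(* Weighted hypergraphs H = (V, E, w): E is the set of hyperedges, and only
   the values w e for e in E matter. *)

Section Hypergraph.
Context (R : realType) (V : finType) (E : {set {set V}}) (w : {set V} -> R).

Definition vweight (v : V) : R := \sum_(e in E | v \in e) w e.

Record weighted_hypergraph : Prop := WeightedHypergraph {
  two_vertices : (1 < #|V|)%N;
  edge_nonempty : forall e, e \in E -> e != finset.set0;
  edge_weight_ge0 : forall e, e \in E -> 0 <= w e;
  vweight_gt0 : forall v, 0 < vweight v }.

Definition set_weight (X : {set V}) : R := \sum_(v in X) vweight v.

(* W^{1/2} 1 *)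
Definition x1 : V -> R := fun v => Num.sqrt (vweight v).

Definition proj_x1 (x : V -> R) : V -> R :=
  fun v => x v - vdot x x1 / vdot x1 x1 * x1 v.

(* All the terms of the iterated maximum are nonnegative, so that its default
   value 0 is harmless. *)
Definition discrepancy (x : V -> R) : R :=
  (\sum_(e in E) w e *
     \big[Num.max/0]_(u in e) \big[Num.max/0]_(v in e)
        (x u / Num.sqrt (vweight u) - x v / Num.sqrt (vweight v)) ^+ 2)
  / \sum_u x u ^+ 2.

(* The infimum is a minimum: the discrepancy ratio is continuous and
   scale-invariant on x <> 0, and some x <> 0 is orthogonal to x1 as soon as
   V has two elements. *)
Definition gamma2 : R :=
  inf [set discrepancy x | x in [set x | x <> (fun=> 0) /\ vdot x x1 = 0]].

(* sup and inf of a nonempty finite set of reals: maximum and minimum *)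
Definition edge_max (f : V -> R) (e : {set V}) : R := sup (f @` [set` e]).
Definition edge_min (f : V -> R) (e : {set V}) : R := inf (f @` [set` e]).

Definition Smax (f : V -> R) (e : {set V}) : {set V} :=
  [set u in e | f u == edge_max f e]%SET.
Definition Imin (f : V -> R) (e : {set V}) : {set V} :=
  [set u in e | f u == edge_min f e]%SET.

Definition edges_cost (f : V -> R) (F : {set {set V}}) : R :=
  \sum_(e in F) w e * (edge_max f e - edge_min f e).

(* One stage of the procedure inside a class of equal f-value. A is the set of
   vertices of the class that already have a rate (empty at the first stage),
   F the current edge set, X a subset of the remaining vertices. At later
   stages the condition "I_e(f) is included in X" is understood relatively to
   the remaining vertices, i.e. I_e(f) is included in A :|: X: an edge whose
   minimizers lie partly in A is not lost, its last minimizers receive its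
   flow. Without this the rates would depend on the choice of the maximizers,
   and W r(f) would not sum to 0. *)
Definition IX (f : V -> R) (A : {set V}) (F : {set {set V}}) (X : {set V}) :
    {set {set V}} :=
  [set e in F | Imin f e \subset A :|: X]%SET.
Definition SX (f : V -> R) (F : {set {set V}}) (X : {set V}) : {set {set V}} :=
  [set e in F | Smax f e :&: X != finset.set0]%SET.

Definition density (f : V -> R) (A : {set V}) (F : {set {set V}})
    (X : {set V}) : R :=
  (edges_cost f (IX f A F X) - edges_cost f (SX f F X)) / set_weight X.

(* U is the set of remaining vertices of the class. A stage assigns at least
   one vertex as long as U is nonempty, so #|V| stages are enough. *)
Fixpoint rate_rec (f : V -> R) (k : nat) (A U : {set V}) (F : {set {set V}}) :
    V -> R :=
  if k is k'.+1 then
    let P := [arg max_(X > U | (X != finset.set0) && (X \subset U))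
                density f A F X]%O in
    fun v => if v \in P then density f A F P
             else rate_rec f k' (A :|: P)%SET (U :\: P)%SET
                    (F :\: (IX f A F P :|: SX f F P))%SET v
  else fun=> 0.

Definition level_class (f : V -> R) (v : V) : {set V} :=
  [set u | f u == f v]%SET.

Definition class_edges (f : V -> R) (U : {set V}) : {set {set V}} :=
  [set e in E | (Imin f e :|: Smax f e) :&: U != finset.set0]%SET.

Definition rate (f : V -> R) : V -> R :=
  fun v => let U := level_class f v in
    rate_rec f #|V| finset.set0 U (class_edges f U) v.

Definition laplacian_w (f : V -> R) : V -> R := fun v => - rate f v.

(* W^{1/2} L_w (W^{-1/2} x) *)
Definition laplacian (x : V -> R) : V -> R :=
  fun v => Num.sqrt (vweight v) *
           laplacian_w (fun u => x u / Num.sqrt (vweight u)) v.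

End Hypergraph.

Section Probability.
Context (R : realType).

Definition mutually_independent (d : measure_display) (Omega : measurableType d)
    (P : probability Omega R) (I : finType) (G : I -> set (set Omega)) : Prop :=
  forall (J : {set I}) (A : I -> set Omega), (forall i, i \in J -> G i (A i)) ->
    P (\bigcap_(i in [set` J]) A i) = (\prod_(i in J) P (A i))%E.

Context (V : finType).

(* product sigma-algebra of R^V *)
Definition vborel : set (set (V -> R)) :=
  <<s [set A | exists (v : V) (C : set R),
         measurable C /\ A = [set x | C (x v)]] >>.

Definition random_vector (d : measure_display) (Omega : measurableType d)
    (Y : Omega -> V -> R) : Prop :=
  forall v, measurable_fun setT (fun omega => Y omega v).

Definition same_law (d d' : measure_display)
    (Omega : measurableType d) (Omega' : measurableType d')
    (P : probability Omega R) (P' : probability Omega' R)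
    (Y : Omega -> V -> R) (Y' : Omega' -> V -> R) : Prop :=
  forall A, vborel A -> P (Y @^-1` A) = P' (Y' @^-1` A).

(* The coordinates of xi are N(0, s^2) variables, independent of each other
   and of G; s is assumed to be nonzero. *)
Definition indep_gaussian_vector (d : measure_display)
    (Omega : measurableType d) (P : probability Omega R)
    (G : set (set Omega)) (s : R) (xi : Omega -> V -> R) : Prop :=
  [/\ random_vector xi,
      forall v C, measurable C ->
        P ((fun omega => xi omega v) @^-1` C) = normal_prob 0 s C &
      mutually_independent P (fun o : option V =>
        if o is Some v
        then preimage_set_system setT (fun omega => xi omega v) measurable
        else G)].

(* Processes are indexed by R, and only times t >= 0 matter. *)

Record filtration (d : measure_display) (Omega : measurableType d)
    (F : R -> set (set Omega)) : Prop := Filtration {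
  filtration_sigma : forall t, 0 <= t -> sigma_algebra setT (F t);
  filtration_measurable : forall t, 0 <= t -> F t `<=` measurable;
  filtration_mono : forall s t, 0 <= s -> s <= t -> F s `<=` F t }.

Definition adapted (d : measure_display) (Omega : measurableType d)
    (F : R -> set (set Omega)) (X : R -> Omega -> V -> R) : Prop :=
  forall t, 0 <= t -> forall v (C : set R), measurable C ->
    F t ((fun omega => X t omega v) @^-1` C).

Definition continuous_path (x : R -> V -> R) : Prop :=
  forall v, {within `[0, +oo[%classic, continuous (fun t => x t v)}.

Record brownian_motion (d : measure_display) (Omega : measurableType d)
    (P : probability Omega R) (F : R -> set (set Omega))
    (B : R -> Omega -> V -> R) : Prop := BrownianMotion {
  brownian_adapted : adapted F B;
  brownian_start : {ae P, forall omega, B 0 omega = (fun=> 0)};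
  brownian_continuous :
    {ae P, forall omega, continuous_path (fun t => B t omega)};
  brownian_increment : forall s t, 0 <= s -> s < t ->
    indep_gaussian_vector P (F s) (Num.sqrt (t - s))
      (fun omega v => B t omega v - B s omega v) }.

(* dX_t = - b(X_t) dt + c dB_t in integral form: as c is a constant and
   B_0 = 0, the stochastic integral of c over [0, t] is c B_t. *)
Record ito_process (d : measure_display) (Omega : measurableType d)
    (P : probability Omega R) (F : R -> set (set Omega))
    (B : R -> Omega -> V -> R) (b : (V -> R) -> V -> R) (c : R)
    (X : R -> Omega -> V -> R) : Prop := ItoProcess {
  ito_adapted : adapted F X;
  ito_continuous : {ae P, forall omega, continuous_path (fun t => X t omega)};
  ito_integrable : {ae P, forall omega, forall t, 0 <= t -> forall v,
    (@lebesgue_measure R).-integrable `[0, t]%classic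
      (fun s => (b (X s omega) v)%:E)};
  ito_equation : {ae P, forall omega, forall t, 0 <= t -> forall v,
    X t omega v = X 0 omega v
      - (\int[@lebesgue_measure R]_(s in `[0, t]%classic) b (X s omega) v)
      + c * B t omega v} }.

(* eta / (2 g) (1 - e^{-2 g t}), extended by continuity at g = 0, a case which
   occurs for disconnected hypergraphs *)
Definition ou_variance (g eta t : R) : R :=
  if g == 0 then eta * t else eta / (2 * g) * (1 - expR (- (2 * g * t))).

Definition stochastically_dominated (d d' : measure_display)
    (Omega : measurableType d) (Omega' : measurableType d')
    (P : probability Omega R) (P' : probability Omega' R)
    (Y : Omega -> R) (Y' : Omega' -> R) : Prop :=
  forall a : R, (P [set omega | (a <= Y omega)%R] <=
                 P' [set omega | (a <= Y' omega)%R])%E.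

End Probability.

(* Main.v *)
Require Import Defs.
From HB Require Import structures.
From mathcomp Require Import all_boot all_order all_algebra.
From mathcomp Require Import all_classical all_reals all_analysis.
From mathcomp Require Import measurable_realfun.
From mathcomp Require Import ring lra.
Import Order.TTheory GRing.Theory Num.Theory.
Import numFieldNormedType.Exports.
Local Open Scope classical_set_scope.
Local Open Scope ring_scope.

(* No stochastic calculus is used.  The Laplacian satisfies
   <L x, Pi x> >= gamma_2 |Pi x|^2, and X - sqrt(eta) B is absolutely continuous
   with derivative - L X; hence, path by path, for a fine enough mesh h,
     |Pi X_{s+h}|^2 <= e^{-2 gamma_2 h} |Pi X_s + sqrt(eta) (B_{s+h} - B_s)|^2 + h eps.
   Let Phi be nondecreasing with values in [0, 1].  By rotation invariance the
   mean of Phi (|y + sigma G|^2), G a standard Gaussian vector, depends on |y|^2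
   only; as a function of |y|^2 it is nondecreasing and (2 sigma^2)^{-1}-Lipschitz.
   Starting from the regularisation of an indicator function by a small Gaussian
   sigma G, one can therefore apply the inequality above step by step backwards
   from t to 0, each increment of B being absorbed by convolution into the
   Gaussian, at a total cost t eps / (2 sigma^2).  The variance obtained is a
   Riemann sum of that of the Ornstein-Uhlenbeck process, and mesh, eps and sigma
   are finally sent to 0. *)

(** * Rotation invariance of the Gaussian measure *)

(** The mesh for which the inequality holds depends on the path, whereas the backward recursion
    needs it surely and with adapted terms. The sampled chain is therefore killed, i.e. set to 0, at
    its first violation: it stays adapted, the inequality then holds for every [omega] because its
    right-hand side is nonnegative, and the probability of killing tends to 0 with the mesh.
    Lipschitz dependence on |y|^2, rather than on |y|, uses that there are at least two coordinates:
    an increase e of |y|^2 is realised by a mean sqrt e on an axis orthogonal to y, where the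
    first-order effect cancels by symmetry and only e / (2 sigma^2) remains. The increments of B
    enter the inequality unprojected, since projecting z = Pi X_s + sqrt(eta) (B_{s+h} - B_s) only
    decreases its norm; so the comparison Gaussian has n independent coordinates although Pi X_t
    lives in n - 1 dimensions. In the limit eps has to be small compared with sigma^2, because the
    cost t eps / (2 sigma^2) must vanish; the mesh is chosen after both. *)

Section lebesgue_invariance.
Context {R : realType}.
Local Notation mu := (@lebesgue_measure R).
Local Open Scope ereal_scope.

Lemma lebesgue_measure_translation (a : R) (A : set R) : measurable A ->
  pushforward mu (fun x : measurableTypeR R => (x + a)%R : measurableTypeR R) A = mu A.
Proof.
move=> mA; apply/esym.
have mf : measurable_fun [set: measurableTypeR R]
    (fun x : measurableTypeR R => (x + a)%R : measurableTypeR R).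
  exact: measurable_funD.
pose f' : {mfun measurableTypeR R >-> measurableTypeR R} := HB.pack
  (fun x : measurableTypeR R => (x + a)%R : measurableTypeR R)
   (isMeasurableFun.Build _ _ _ _ _ mf).
apply: (@lebesgue_measure_unique _ (pushforward mu f')) => //= _ [[b c]] _ <-.
rewrite /pushforward.
have -> : (fun x : R => (x + a)%R) @^-1` `]b, c] = `](b - a)%R, (c - a)%R]%classic.
  by apply/seteqP; split => x /=; rewrite !in_itv/= ltrBlDr lerBrDr.
rewrite !lebesgue_measure_itv/= !lte_fin ltrD2r.
by case: ifP => // _; rewrite -!EFinB; congr EFin; ring.
Qed.

Lemma ge0_integral_translation (a : R) (f : R -> \bar R) :
  measurable_fun setT f -> (forall x, 0 <= f x) ->
  \int[mu]_x f (x + a)%R = \int[mu]_x f x.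
Proof.
move=> mf f0.
have mt : measurable_fun [set: measurableTypeR R]
    (fun x : measurableTypeR R => (x + a)%R : measurableTypeR R).
  exact: measurable_funD.
have := @ge0_integral_pushforward _ _ _ _ R _ mt mu setT f measurableT mf (fun x _ => f0 x).
rewrite preimage_setT => <-.
by apply: eq_measure_integral => /= A mA _; rewrite lebesgue_measure_translation.
Qed.

Lemma ge0_integral_reflection (f : R -> \bar R) :
  measurable_fun setT f -> (forall x, 0 <= f x) ->
  \int[mu]_x f (- x)%R = \int[mu]_x f x.
Proof.
move=> mf f0.
have mt : measurable_fun [set: measurableTypeR R]
    (fun x : measurableTypeR R => (- x)%R : measurableTypeR R).
  exact: oppr_measurable.
have := @ge0_integral_pushforward _ _ _ _ R _ mt mu setT f measurableT mf (fun x _ => f0 x).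
rewrite preimage_setT => <-.
by apply: eq_measure_integral => /= A mA _; rewrite lebesgue_measureN.
Qed.

End lebesgue_invariance.

Section gaussian.
Context {R : realType}.
Local Notation mu := (@lebesgue_measure R).
Local Notation nu := (@normal_prob R 0 1).
Local Notation phi := (@normal_pdf R 0 1).
Local Open Scope ereal_scope.

(** The Radon-Nikodym derivative of [nu] agrees almost everywhere with [phi], since both have the
    same integral over every measurable set. *)
Lemma ge0_integral_normal_prob (f : R -> \bar R) :
  measurable_fun setT f -> (forall x, 0 <= f x) ->
  \int[nu]_x f x = \int[mu]_x (f x * (phi x)%:E).
Proof.
move=> mf f0; have nu_mu := @normal_prob_dominates R 0 1.
rewrite -(Radon_Nikodym_SigmaFinite.change_of_variables nu_mu)//.
apply: ae_eq_integral => //.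
- apply: emeasurable_funM => //; apply: (measurable_int mu).
  exact: Radon_Nikodym_SigmaFinite.f_integrable.
- apply: emeasurable_funM => //; apply/measurable_EFinP.
  exact: measurable_normal_pdf.
- apply: ae_eqe_mul2l.
  apply: integral_ae_eq => //.
  + exact: Radon_Nikodym_SigmaFinite.f_integrable.
  + by apply/measurable_EFinP; exact: measurable_normal_pdf.
  + by move=> A _ mA; rewrite -Radon_Nikodym_SigmaFinite.f_integral.
Qed.

End gaussian.

Section gaussian_rotation.
Context {R : realType}.
Local Notation mu := (@lebesgue_measure R).
Local Notation nu := (@normal_prob R 0 1).
Local Notation phi := (@normal_pdf R 0 1).
Local Open Scope ereal_scope.

Lemma measurable_linear2 (a b c d : R) :
  measurable_fun [set: R * R]
    (fun z : R * R => (a * z.1 + b * z.2, c * z.1 + d * z.2)%R).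
Proof.
by apply/measurable_fun_pair => /=; apply: measurable_funD; apply: measurable_funM.
Qed.

Lemma ge0_integral_shear2 (a : R) (F : R * R -> \bar R) :
  measurable_fun setT F -> (forall z, 0 <= F z) ->
  \int[mu]_x \int[mu]_y F (x, y + a * x)%R = \int[mu]_x \int[mu]_y F (x, y).
Proof.
move=> mF F0; apply: eq_integral => x _.
apply: (@ge0_integral_translation R _ (fun y => F (x, y))) => //.
by apply: measurableT_comp => //; exact: measurable_pair1.
Qed.

Lemma ge0_integral_shear1 (a : R) (F : R * R -> \bar R) :
  measurable_fun setT F -> (forall z, 0 <= F z) ->
  \int[mu]_x \int[mu]_y F (x + a * y, y)%R = \int[mu]_x \int[mu]_y F (x, y).
Proof.
move=> mF F0.
pose G (z : R * R) := F (z.1 + a * z.2, z.2)%R.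
have mG : measurable_fun setT G.
  apply: measurableT_comp => //; apply/measurable_fun_pair => //=.
  by apply: measurable_funD => //; apply: measurable_funM.
have G0 z : 0 <= G z by exact: F0.
transitivity (\int[mu]_y \int[mu]_x G (x, y)).
  exact: (@fubini_tonelli _ _ _ _ _ mu mu G mG G0).
transitivity (\int[mu]_y \int[mu]_x F (x, y)); last first.
  exact/esym/(@fubini_tonelli _ _ _ _ _ mu mu F mF F0).
apply: eq_integral => y _.
rewrite /G/=; apply: (@ge0_integral_translation R (a * y)%R (fun x => F (x, y))) => //.
by apply: measurableT_comp => //; exact: measurable_pair2.
Qed.

Lemma ge0_integral_rotation_lebesgue (c s : R) (F : R * R -> \bar R) :
  (c ^+ 2 + s ^+ 2 = 1)%R -> c != (- 1)%R ->
  measurable_fun setT F -> (forall z, 0 <= F z) ->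
  \int[mu]_x \int[mu]_y F (c * x + - s * y, s * x + c * y)%R =
  \int[mu]_x \int[mu]_y F (x, y).
Proof.
move=> cs1 cN1 mF F0.
have c1 : (1 + c != 0)%R by rewrite addrC -subr_eq0 opprK in cN1 *.
(* [t] is the tangent of the half angle: a rotation is a product of three shears with coefficients
   [- t], [s], [- t], and each shear is a translation in one variable when the other is fixed. The
   half turn [c = -1] has no such factorisation. *)
pose t := (s / (1 + c))%R.
have tc : (t * (1 + c) = s)%R by rewrite /t divfK.
have ts : (t * s = 1 - c)%R.
  by apply: (mulIf c1); rewrite mulrAC tc -expr2; lra.
pose F1 (z : R * R) := F (z.1 + - t * z.2, z.2)%R.
pose F2 (z : R * R) := F1 (z.1, z.2 + s * z.1)%R.
have mF1 : measurable_fun setT F1.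
  apply: measurableT_comp => //; apply/measurable_fun_pair => //=.
  by apply: measurable_funD => //; apply: measurable_funM.
have mF2 : measurable_fun setT F2.
  apply: measurableT_comp => //; apply/measurable_fun_pair => //=.
  by apply: measurable_funD => //; apply: measurable_funM.
have F10 z : 0 <= F1 z by exact: F0.
have F20 z : 0 <= F2 z by exact: F0.
transitivity (\int[mu]_x \int[mu]_y F2 (x + - t * y, y)%R).
  apply: eq_integral => x _; apply: eq_integral => y _.
  rewrite /F2 /F1 /=; congr (F (_, _)).
    transitivity ((1 - t * s) * x - t * (1 + (1 - t * s)) * y)%R; last by ring.
    by rewrite ts -{1}tc; ring.
  transitivity (s * x + (1 - t * s) * y)%R; last by ring.
  by rewrite ts; ring.
transitivity (\int[mu]_x \int[mu]_y F2 (x, y)).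
  exact: (@ge0_integral_shear1 (- t) F2 mF2 F20).
transitivity (\int[mu]_x \int[mu]_y F1 (x, y)).
  exact: (@ge0_integral_shear2 s F1 mF1 F10).
exact: (@ge0_integral_shear1 (- t) F mF F0).
Qed.

Lemma normal_pdfM (x y : R) : (phi x * phi y = normal_peak 1 ^+ 2 * expR (- (x ^+ 2 + y ^+ 2) / 2))%R.
Proof.
rewrite !normal_pdfE ?oner_eq0// /normal_fun !subr0 expr1n.
rewrite mulrACA -expr2 -expRD; congr (_ * expR _)%R.
by rewrite -mulrDl opprD.
Qed.

Lemma measurable_comp_pair1 (F : R * R -> \bar R) (x : R) :
  measurable_fun setT F -> measurable_fun setT (fun y => F (x, y)).
Proof. by move=> mF; apply: measurableT_comp => //; exact: measurable_pair1. Qed.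

Lemma ge0_integral_normal_prob2 (F : R * R -> \bar R) :
  measurable_fun setT F -> (forall z, 0 <= F z) ->
  \int[nu]_x \int[nu]_y F (x, y) =
  \int[mu]_x \int[mu]_y (F (x, y) * (phi x * phi y)%:E).
Proof.
move=> mF F0.
rewrite (@ge0_integral_normal_prob R (fun x => \int[nu]_y F (x, y))); first last.
- by move=> x; exact: integral_ge0.
- exact: (@measurable_fun_fubini_tonelli_F _ _ _ _ R nu F).
apply: eq_integral => x _.
rewrite (@ge0_integral_normal_prob R (fun y => F (x, y)))//; last first.
  exact: measurable_comp_pair1.
rewrite -ge0_integralZr//; first last.
- by rewrite lee_fin normal_pdf_ge0.
- by move=> y _; rewrite mule_ge0// lee_fin normal_pdf_ge0.
- apply: emeasurable_funM; first exact: measurable_comp_pair1.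
  by apply/measurable_EFinP; exact: measurable_normal_pdf.
by apply: eq_integral => y _; rewrite -muleA -EFinM [(phi y * _)%R]mulrC.
Qed.

Lemma ge0_integral_rotation (c s : R) (F : R * R -> \bar R) :
  (c ^+ 2 + s ^+ 2 = 1)%R ->
  measurable_fun setT F -> (forall z, 0 <= F z) ->
  \int[nu]_x \int[nu]_y F (c * x + - s * y, s * x + c * y)%R =
  \int[nu]_x \int[nu]_y F (x, y).
Proof.
have main (c' s' : R) (G : R * R -> \bar R) : (c' ^+ 2 + s' ^+ 2 = 1)%R ->
  c' != (- 1)%R -> measurable_fun setT G -> (forall z, 0 <= G z) ->
  \int[nu]_x \int[nu]_y G (c' * x + - s' * y, s' * x + c' * y)%R =
  \int[nu]_x \int[nu]_y G (x, y).
  move=> cs1 cN1 mG G0.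
  pose H (z : R * R) := G (c' * z.1 + - s' * z.2, s' * z.1 + c' * z.2)%R.
  have mH : measurable_fun setT H.
    by apply: measurableT_comp => //; exact: measurable_linear2.
  have H0 z : 0 <= H z by exact: G0.
  pose K (z : R * R) := G z * (phi z.1 * phi z.2)%:E.
  have mK : measurable_fun setT K.
    apply: emeasurable_funM => //; apply/measurable_EFinP/measurable_funM => //.
      by apply: measurableT_comp => //; exact: measurable_normal_pdf.
    by apply: measurableT_comp => //; exact: measurable_normal_pdf.
  have K0 z : 0 <= K z by rewrite mule_ge0// lee_fin mulr_ge0// normal_pdf_ge0.
  apply: (eq_trans (ge0_integral_normal_prob2 H mH H0)).
  apply/esym; apply: (eq_trans (ge0_integral_normal_prob2 G mG G0)); apply/esym.
  apply: (eq_trans _ (ge0_integral_rotation_lebesgue c' s' K cs1 cN1 mK K0)).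
  apply: eq_integral => x _; apply: eq_integral => y _ /=.
  have E : (x ^+ 2 + y ^+ 2 =
    (c' * x + - s' * y) ^+ 2 + (s' * x + c' * y) ^+ 2)%R.
    by rewrite -[LHS]mul1r -cs1; ring.
  by rewrite /H /K !normal_pdfM/= E.
move=> cs1 mF F0; have [cN1|] := eqVneq c (- 1)%R; last first.
  by move=> cN1; exact: (main c s F cs1 cN1 mF F0).
have s0 : s = 0%R by move: cs1; rewrite cN1; nra.
(* The half turn is obtained as two quarter turns. *)
have quarter : (0 ^+ 2 + 1 ^+ 2 = 1 :> R)%R by ring.
have N10 : (0 != - 1 :> R)%R by rewrite eq_sym oppr_eq0 oner_eq0.
pose H (z : R * R) := F (0 * z.1 + - 1 * z.2, 1 * z.1 + 0 * z.2)%R.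
have mH : measurable_fun setT H.
  by apply: measurableT_comp => //; exact: measurable_linear2.
have H0 z : 0 <= H z by exact: F0.
apply: (eq_trans _ (main 0%R 1%R F quarter N10 mF F0)).
apply: (eq_trans _ (main 0%R 1%R H quarter N10 mH H0)).
rewrite /H /=.
apply: eq_integral => x _; apply: eq_integral => y _ /=.
by congr (F (_, _)); rewrite cN1 s0; ring.
Qed.

End gaussian_rotation.

(** * Gaussian averages of functions of the squared norm *)

Section gsq.
Context {R : realType}.
Local Notation mu := (@lebesgue_measure R).
Local Notation nu := (@normal_prob R 0 1).
Local Notation phi := (@normal_pdf R 0 1).
Local Open Scope ereal_scope.
Implicit Types (s x y r rho : R) (Phi : R -> \bar R).

(** Averages out one coordinate of mean [x] and standard deviation [s]; [rho] carries the sum of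
    squares of the coordinates already treated, so that the result is again a function of a partial
    squared norm and [gsq] can be iterated. *)
Definition gsq s x Phi rho : \bar R :=
  \int[nu]_g Phi (rho + (x + s * g) ^+ 2)%R.

Lemma gsq_ge0 s x Phi rho : (forall t, 0 <= Phi t) -> 0 <= gsq s x Phi rho.
Proof. by move=> Phi0; exact: integral_ge0. Qed.

Lemma measurable_gsq_param d (T : measurableType d) s (z rho : T -> R)
    (Psi : T -> R -> \bar R) :
  measurable_fun setT z -> measurable_fun setT rho ->
  measurable_fun setT (fun p : T * R => Psi p.1 p.2) ->
  (forall t u, 0 <= Psi t u) ->
  measurable_fun setT (fun t => gsq s (z t) (Psi t) (rho t)).
Proof.
move=> mz mrho mPsi Psi0.
pose f (p : T * R) := Psi p.1 (rho p.1 + (z p.1 + s * p.2) ^+ 2)%R.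
have mf : measurable_fun setT f.
  apply: (@measurableT_comp _ _ _ _ _ _ (fun p : T * R => Psi p.1 p.2) _
    (fun p : T * R => (p.1, rho p.1 + (z p.1 + s * p.2) ^+ 2)%R)) => //.
  apply/measurable_fun_pair => //=; apply: measurable_funD.
    exact: measurableT_comp.
  apply: measurable_funX; apply: measurable_funD; first exact: measurableT_comp.
  exact: measurable_funM.
exact: (@measurable_fun_fubini_tonelli_F _ _ _ _ R nu f mf (fun=> Psi0 _ _)).
Qed.

Lemma measurable_gsq s x Phi : measurable_fun setT Phi ->
  (forall t, 0 <= Phi t) -> measurable_fun setT (gsq s x Phi).
Proof.
move=> mPhi Phi0.
apply: (@measurable_gsq_param _ R s (fun=> x) id (fun=> Phi)) => //.
exact: measurableT_comp.
Qed.

(** The rotation taking the mean (r, 0) to (c r, n r) preserves the two-dimensional Gaussian and the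
    sum of squares. *)
Lemma gsq_rotation s r (c n : R) Phi rho : (c ^+ 2 + n ^+ 2 = 1)%R ->
  measurable_fun setT Phi -> (forall t, 0 <= Phi t) ->
  gsq s (c * r) (gsq s (n * r) Phi) rho = gsq s r (gsq s 0 Phi) rho.
Proof.
move=> cn mPhi Phi0.
pose F (z : R * R) :=
  Phi (rho + (c * r + s * z.1) ^+ 2 + (n * r + s * z.2) ^+ 2)%R.
have mF : measurable_fun setT F.
  apply: measurableT_comp => //; apply: measurable_funD.
    apply: measurable_funD => //; apply: measurable_funX.
    by apply: measurable_funD => //; exact: measurable_funM.
  apply: measurable_funX.
  by apply: measurable_funD => //; exact: measurable_funM.
have F0 z : 0 <= F z by exact: Phi0.
apply: (eq_trans (esym (ge0_integral_rotation c n F cn mF F0))).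
rewrite /gsq; apply: eq_integral => a _; apply: eq_integral => b _.
rewrite /F /=; congr Phi.
transitivity (rho + ((r + s * a) ^+ 2 + (s * b) ^+ 2) * (c ^+ 2 + n ^+ 2))%R.
  by ring.
by rewrite cn; ring.
Qed.

Lemma gsq_comp s x y Phi rho :
  measurable_fun setT Phi -> (forall t, 0 <= Phi t) ->
  gsq s x (gsq s y Phi) rho =
  gsq s (Num.sqrt (x ^+ 2 + y ^+ 2)) (gsq s 0 Phi) rho.
Proof.
move=> mPhi Phi0; set r := Num.sqrt _.
have r2 : (r ^+ 2 = x ^+ 2 + y ^+ 2)%R by rewrite sqr_sqrtr// addr_ge0 ?sqr_ge0.
have [r0|r0] := eqVneq r 0%R.
  have x0 : x = 0%R by move: r2; rewrite r0; nra.
  have y0 : y = 0%R by move: r2; rewrite r0; nra.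
  by rewrite r0 x0 y0.
have cn : ((x / r) ^+ 2 + (y / r) ^+ 2 = 1)%R.
  by rewrite !expr_div_n -mulrDl -r2 divff// sqrf_eq0.
by have := gsq_rotation s r _ _ Phi rho cn mPhi Phi0; rewrite !divfK.
Qed.

(** The sum [r a + s b] of two independent Gaussians is [q] times the first coordinate of a rotated
    pair; this coordinate is again standard. *)
Lemma gsq_convolution s r x Phi rho :
  measurable_fun setT Phi -> (forall t, 0 <= Phi t) ->
  \int[nu]_g gsq s (x + r * g)%R Phi rho =
  gsq (Num.sqrt (s ^+ 2 + r ^+ 2)) x Phi rho.
Proof.
move=> mPhi Phi0; set q := Num.sqrt _.
have q2 : (q ^+ 2 = s ^+ 2 + r ^+ 2)%R by rewrite sqr_sqrtr// addr_ge0 ?sqr_ge0.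
have [q0|q0] := eqVneq q 0%R.
  have s0 : s = 0%R by move: q2; rewrite q0; nra.
  have r0 : r = 0%R by move: q2; rewrite q0; nra.
  rewrite q0 s0 r0 /gsq.
  under eq_integral do under eq_integral do rewrite !mul0r !addr0.
  rewrite integral_cst//= probability_setT mule1.
  by apply: eq_integral => g _; rewrite mul0r addr0.
pose F (z : R * R) := Phi (rho + (x + q * z.1) ^+ 2)%R.
have mF : measurable_fun setT F.
  apply: measurableT_comp => //; apply: measurable_funD => //.
  apply: measurable_funX.
  by apply: measurable_funD => //; exact: measurable_funM.
have F0 z : 0 <= F z by exact: Phi0.
have cn : ((r / q) ^+ 2 + (- (s / q)) ^+ 2 = 1)%R.
  by rewrite sqrrN !expr_div_n -mulrDl addrC -q2 divff// sqrf_eq0.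
transitivity (\int[nu]_a \int[nu]_b F (a, b)); last first.
  apply: eq_integral => a _; rewrite /F/=.
  by rewrite integral_cst//= probability_setT mule1.
apply: (eq_trans _ (ge0_integral_rotation _ _ F cn mF F0)).
rewrite /gsq; apply: eq_integral => a _; apply: eq_integral => b _.
rewrite /F/=; congr (Phi (_ + _ ^+ 2)%R).
by field.
Qed.

End gsq.

(** * Effect of the mean on a one-dimensional Gaussian average *)

Section gsq_order.
Context {R : realType}.
Local Notation mu := (@lebesgue_measure R).
Local Notation nu := (@normal_prob R 0 1).
Local Notation phi := (@normal_pdf R 0 1).
Local Open Scope ereal_scope.
Implicit Types (s x y r rho : R) (Phi : R -> \bar R).

Let measurable_phi_aff (a b : R) :
  measurable_fun setT (fun g : R => (phi (a * g + b))%:E).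
Proof.
apply/measurable_EFinP; apply: (measurableT_comp (measurable_normal_pdf 0 1)).
by apply: measurable_funD => //; exact: measurable_funM.
Qed.

Lemma normal_pdfN x : phi (- x)%R = phi x.
Proof. by rewrite !normal_pdfE ?oner_eq0// /normal_fun !subr0 sqrrN. Qed.

Lemma ge0_integral_normal_probN (f : R -> \bar R) :
  measurable_fun setT f -> (forall x, 0 <= f x) ->
  \int[nu]_g f (- g)%R = \int[nu]_g f g.
Proof.
move=> mf f0.
have mfN : measurable_fun setT (fun g : R => f (- g)%R).
  by apply: measurableT_comp => //; exact: oppr_measurable.
apply: (eq_trans (ge0_integral_normal_prob (fun g : R => f (- g)%R) mfN (fun=> f0 _))).
apply/esym; apply: (eq_trans (ge0_integral_normal_prob f mf f0)); apply/esym.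
pose F (g : R) := f g * (phi g)%:E.
have mF : measurable_fun setT F.
  apply: emeasurable_funM => //; apply/measurable_EFinP.
  exact: measurable_normal_pdf.
have F0 g : 0 <= F g by rewrite mule_ge0// lee_fin normal_pdf_ge0.
apply: (eq_trans _ (ge0_integral_reflection F mF F0)).
by apply: eq_integral => g _; rewrite /F normal_pdfN.
Qed.

Lemma ge0_integral_normal_prob_shift (a : R) (f : R -> \bar R) :
  measurable_fun setT f -> (forall x, 0 <= f x) ->
  \int[nu]_g f (g + a)%R = \int[mu]_g (f g * (phi (g - a))%:E).
Proof.
move=> mf f0.
have mfa : measurable_fun setT (fun g : R => f (g + a)%R).
  by apply: measurableT_comp => //; exact: measurable_funD.
apply: (eq_trans (ge0_integral_normal_prob (fun g : R => f (g + a)%R) mfa (fun=> f0 _))).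
pose F (g : R) := f g * (phi (g - a)%R)%:E.
have mF : measurable_fun setT F.
  apply: emeasurable_funM => //; have := measurable_phi_aff 1 (- a).
  by under eq_fun do rewrite mul1r.
have F0 g : 0 <= F g by rewrite mule_ge0// lee_fin normal_pdf_ge0.
apply: (eq_trans _ (ge0_integral_translation a F mF F0)).
by apply: eq_integral => g _; rewrite /F addrK.
Qed.

Lemma ge0_integralDE (F G : R -> \bar R) :
  measurable_fun setT F -> measurable_fun setT G ->
  (forall x, 0 <= F x) -> (forall x, 0 <= G x) ->
  \int[mu]_x F x + \int[mu]_x G x = \int[mu]_x (F x + G x).
Proof. by move=> mF mG F0 G0; rewrite ge0_integralD. Qed.

(** Halving in [\bar R]: it allows symmetrisation arguments in which each integral is added to its
    reflected form before the integrands are compared. *)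
Lemma lee_twice (I J A B : \bar R) : 0 <= J -> I + I = A -> J + J = B ->
  A <= B -> I <= J.
Proof.
move=> J0 <- <- IJ; rewrite leNgt; apply/negP => JI.
have Jfin : J \is a fin_num by rewrite ge0_fin_numE// (lt_le_trans JI)// leey.
by have := lteD JI JI; rewrite ltNge IJ.
Qed.

Lemma normal_pdf_le_norm x y : (`|x| <= `|y|)%R -> (phi y <= phi x)%R.
Proof.
move=> xy; rewrite !normal_pdfE ?oner_eq0// /normal_fun !subr0.
rewrite ler_wpM2l ?normal_peak_ge0// ler_expR ler_pM2r ?invr_gt0 ?mulrn_wgt0 ?expr1n//.
by rewrite lerN2 -(real_normK (num_real x)) -(real_normK (num_real y)) lerXn2r// nnegrE.
Qed.

(* Reflecting in the midpoint a / 2 exchanges the two Gaussian densities, so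
   twice the difference of the two sides is the integral of
   (psi g - psi (a - g)) (phi (g - a) - phi g), whose factors have the same
   sign. *)
Lemma normal_prob_shift_ge (a : R) (psi : R -> \bar R) :
  measurable_fun setT psi -> (forall g, 0 <= psi g) -> 
  (forall g h : R, (`|g| <= `|h|)%R -> psi g <= psi h) -> (0 <= a)%R ->
  \int[nu]_g psi g <= \int[nu]_g psi (g + a)%R.
Proof.
move=> mpsi psi0 psi_le a0.
have J0 : 0 <= \int[nu]_g psi (g + a)%R by exact: integral_ge0.
have mpsia : measurable_fun setT (fun g : R => psi (- g + a)%R).
  by apply: measurableT_comp => //; exact: measurable_funD.
have mphi_ b c : measurable_fun setT (fun g : R => psi g * (phi (b * g + c)%R)%:E).
  by apply: emeasurable_funM => //; exact: measurable_phi_aff.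
have mphi_' b c : measurable_fun setT (fun g : R => psi (- g + a)%R * (phi (b * g + c)%R)%:E).
  by apply: emeasurable_funM => //; exact: measurable_phi_aff.
pose F1 (g : R) := psi g * (phi (1 * g + - a)%R)%:E.
pose F2 (g : R) := psi (- g + a)%R * (phi (1 * g + 0)%R)%:E.
pose G1 (g : R) := psi g * (phi (1 * g + 0)%R)%:E.
pose G2 (g : R) := psi (- g + a)%R * (phi (1 * g + - a)%R)%:E.
have phi0 x : 0 <= (phi x)%:E by rewrite lee_fin normal_pdf_ge0.
have F10 g : 0 <= F1 g by exact: mule_ge0.
have F20 g : 0 <= F2 g by exact: mule_ge0.
have G10 g : 0 <= G1 g by exact: mule_ge0.
have G20 g : 0 <= G2 g by exact: mule_ge0.
have eF1 : \int[nu]_g psi (g + a)%R = \int[mu]_g F1 g.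
  apply: (eq_trans (ge0_integral_normal_prob_shift a psi mpsi psi0)).
  by apply: eq_integral => g _; rewrite /F1 mul1r.
have eF2 : \int[nu]_g psi (g + a)%R = \int[mu]_g F2 g.
  have mpsia' : measurable_fun setT (fun g : R => psi (g + a)%R).
    by apply: measurableT_comp => //; exact: measurable_funD.
  apply: (eq_trans (esym (ge0_integral_normal_probN _ mpsia' (fun=> psi0 _)))).
  apply: (eq_trans (ge0_integral_normal_prob _ mpsia (fun=> psi0 _))).
  by apply: eq_integral => g _; rewrite /F2 mul1r addr0.
have eG1 : \int[nu]_g psi g = \int[mu]_g G1 g.
  apply: (eq_trans (ge0_integral_normal_prob _ mpsi psi0)).
  by apply: eq_integral => g _; rewrite /G1 mul1r addr0.
have eG2 : \int[nu]_g psi g = \int[mu]_g G2 g.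
  apply: (eq_trans (esym (ge0_integral_normal_probN _ mpsi psi0))).
  have mpsiN : measurable_fun setT (fun g : R => psi (- g + a)%R) by [].
  have := ge0_integral_normal_prob_shift a _ mpsiN (fun=> psi0 _).
  under eq_integral do rewrite opprD subrK.
  move=> ->; apply: eq_integral => g _; rewrite /G2 mul1r//.
apply: (lee_twice _ _ _ _ J0
  (etrans (congr2 _ eG1 eG2) (ge0_integralDE G1 G2 (mphi_ _ _) (mphi_' _ _) G10 G20))
  (etrans (congr2 _ eF1 eF2) (ge0_integralDE F1 F2 (mphi_ _ _) (mphi_' _ _) F10 F20))).
apply: ge0_le_integral => //.
- by move=> g _; exact: adde_ge0.
- by apply: emeasurable_funD; [exact: mphi_|exact: mphi_'].
- by apply: emeasurable_funD; [exact: mphi_|exact: mphi_'].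
(* Rearrangement inequality, written with sums because [p] and [q] may be infinite. Which side of
   the midpoint [a / 2] contains [g] decides how the two pairs are ordered. *)
have key (p q : \bar R) (u v : R) : 0 <= p -> p <= q -> (0 <= u)%R -> (u <= v)%R ->
    p * v%:E + q * u%:E <= p * u%:E + q * v%:E.
  move=> p0 pq u0 uv; have q0 := le_trans p0 pq.
  have vu : (0 <= v - u)%R by rewrite subr_ge0.
  have -> : (v = u + (v - u))%R by rewrite addrC subrK.
  rewrite EFinD !ge0_muleDr ?lee_fin//.
  rewrite -addeA leeD2l// [leRHS]addeC leeD2r//.
  by rewrite lee_wpmul2r ?lee_fin.
move=> g _; rewrite /F1 /F2 /G1 /G2 !mul1r !addr0.
have [ga|ga] := lerP (a / 2) g.
  rewrite addeC [leRHS]addeC.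
  apply: key; rewrite ?normal_pdf_ge0//.
    by apply: psi_le; rewrite (@ger0_norm _ g) ?ler_norml; lra.
  by apply: normal_pdf_le_norm; rewrite (@ger0_norm _ g) ?ler_norml; lra.
apply: key; rewrite ?normal_pdf_ge0//.
  by apply: psi_le; rewrite (@ger0_norm _ (- g + a)) ?ler_norml; lra.
apply: normal_pdf_le_norm; rewrite (@ler0_norm _ (g - a)) ?ler_norml; lra.
Qed.

(** For even [psi] the shifted density may be averaged over [a] and [- a], which multiplies [phi g]
    by e^{-a^2/2} cosh (a g), and cosh is at least 1. *)
Lemma normal_prob_shift_cosh (a : R) (psi : R -> \bar R) :
  measurable_fun setT psi -> (forall g, 0 <= psi g) ->
  (forall g, psi (- g)%R = psi g) ->
  (expR (- a ^+ 2 / 2))%:E * \int[nu]_g psi g <= \int[nu]_g psi (g + a)%R.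
Proof.
move=> mpsi psi0 psiN.
set k := expR _.
have k0 : (0 <= k)%R by exact: expR_ge0.
have J0 : 0 <= \int[nu]_g psi (g + a)%R by exact: integral_ge0.
have phi0 x : 0 <= (phi x)%:E by rewrite lee_fin normal_pdf_ge0.
have mphi_ b c : measurable_fun setT (fun g : R => psi g * (phi (b * g + c)%R)%:E).
  by apply: emeasurable_funM => //; exact: measurable_phi_aff.
pose F1 (g : R) := psi g * (phi (1 * g + - a)%R)%:E.
pose F2 (g : R) := psi g * (phi (1 * g + a)%R)%:E.
pose G (g : R) := psi g * (phi (1 * g + 0)%R)%:E.
have F10 g : 0 <= F1 g by exact: mule_ge0.
have F20 g : 0 <= F2 g by exact: mule_ge0.
have G0 g : 0 <= G g by exact: mule_ge0.
have eF1 : \int[nu]_g psi (g + a)%R = \int[mu]_g F1 g.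
  apply: (eq_trans (ge0_integral_normal_prob_shift a psi mpsi psi0)).
  by apply: eq_integral => g _; rewrite /F1 mul1r.
have eF2 : \int[nu]_g psi (g + a)%R = \int[mu]_g F2 g.
  apply: (eq_trans eF1).
  apply: (eq_trans (esym (ge0_integral_reflection F1 (mphi_ _ _) F10))).
  apply: eq_integral => g _; rewrite /F1 /F2 psiN.
  by rewrite -[in LHS]normal_pdfN !mul1r opprD !opprK.
have eG : \int[nu]_g psi g = \int[mu]_g G g.
  apply: (eq_trans (ge0_integral_normal_prob _ mpsi psi0)).
  by apply: eq_integral => g _; rewrite /G mul1r addr0.
have mkG : measurable_fun setT (fun g => k%:E * G g).
  by apply: emeasurable_funM => //; exact: mphi_.
have kG0 g : 0 <= k%:E * G g by rewrite mule_ge0 ?lee_fin.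
have ekG : k%:E * \int[nu]_g psi g = \int[mu]_g (k%:E * G g).
  by rewrite eG ge0_integralZl ?lee_fin//; exact: mphi_.
apply: (lee_twice _ _ _ _ J0
  (etrans (congr2 _ ekG ekG) (ge0_integralDE _ _ mkG mkG kG0 kG0))
  (etrans (congr2 _ eF1 eF2) (ge0_integralDE F1 F2 (mphi_ _ _) (mphi_ _ _) F10 F20))).
apply: ge0_le_integral => //.
- by move=> g _; rewrite adde_ge0// mule_ge0 ?lee_fin.
- by apply: emeasurable_funD; apply: emeasurable_funM => //; exact: mphi_.
- by apply: emeasurable_funD; exact: mphi_.
move=> g _; rewrite /F1 /F2 /G !mul1r !addr0.
rewrite muleCA -!ge0_muleDr ?mule_ge0 ?lee_fin ?normal_pdf_ge0//.
rewrite lee_wpmul2l// -!EFinM -!EFinD lee_fin.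
rewrite !normal_pdfE ?oner_eq0// /normal_fun !subr0 expr1n.
rewrite -!mulrDr mulrCA ler_wpM2l ?normal_peak_ge0//.
rewrite /k mulrDr -!expRD.
set u := expR (_ + _); have u0 : (0 < u)%R by exact: expR_gt0.
have -> : expR (- (g - a) ^+ 2 / 2) = (u * expR (a * g))%R.
  by rewrite /u -expRD; congr expR; field.
have -> : expR (- (g + a) ^+ 2 / 2) = (u * expR (- (a * g)))%R.
  by rewrite /u -expRD; congr expR; field.
rewrite -mulrDr -[X in (X <= _)%R]mulr2n -mulr_natr ler_pM2l//.
have := expR_ge1Dx (a * g); have := expR_ge1Dx (- (a * g)); lra.
Qed.

End gsq_order.

(** * Several coordinates: reduction to the squared norm of the mean *)

Section gsq_iterated.
Context {R : realType}.
Local Notation nu := (@normal_prob R 0 1).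
Local Open Scope ereal_scope.
Implicit Types (s x y r rho t : R) (Phi : R -> \bar R).

(** A class of test functions stable under [gsq]. Monotonicity gives the comparison of means; the
    bound by 1 makes [1 - Phi] nonnegative, as the opposite estimate requires. *)
Record monotone_test Phi : Prop := MonotoneTest {
  test_measurable : measurable_fun setT Phi;
  test_ge0 : forall t, 0 <= Phi t;
  test_le1 : forall t, Phi t <= 1;
  test_homo : forall t u, (t <= u)%R -> Phi t <= Phi u }.

Let measurable_gsq_integrand s x rho Phi : measurable_fun setT Phi ->
  measurable_fun setT (fun g : R => Phi (rho + (x + s * g) ^+ 2)%R).
Proof.
move=> mPhi; apply: measurableT_comp => //; apply: measurable_funD => //.
apply: measurable_funX; apply: measurable_funD => //; exact: measurable_funM.
Qed.

Lemma monotone_test_gsq s x Phi : monotone_test Phi -> monotone_test (gsq s x Phi).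
Proof.
move=> [mP P0 P1 Ph]; split.
- exact: measurable_gsq.
- by move=> t; exact: gsq_ge0.
- move=> t; rewrite /gsq.
  apply: (@le_trans _ _ (\int[nu]_g 1)).
    apply: ge0_le_integral => //; exact: measurable_gsq_integrand.
  by rewrite integral_cst//= probability_setT mule1.
- move=> t u tu; apply: ge0_le_integral => //; try exact: measurable_gsq_integrand.
  by move=> g _; apply: Ph; rewrite lerD2r.
Qed.

Lemma monotone_test_iter_gsq s n Phi :
  monotone_test Phi -> monotone_test (iter n (gsq s 0) Phi).
Proof. by move=> tP; elim: n => //= n IH; exact: monotone_test_gsq. Qed.

Lemma gsq_shiftE s y Phi rho : s != 0%R ->
  gsq s y Phi rho = \int[nu]_g Phi (rho + (s * (g + y / s)) ^+ 2)%R.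
Proof.
move=> s0; apply: eq_integral => g _; congr (Phi (_ + _ ^+ 2)%R).
by rewrite mulrDr [(s * (y / s))%R]mulrC divfK// addrC.
Qed.

Let measurable_psi s rho Phi : measurable_fun setT Phi ->
  measurable_fun setT (fun g : R => Phi (rho + (s * g) ^+ 2)%R).
Proof.
move=> mPhi; have := measurable_gsq_integrand s 0 rho Phi mPhi.
by under eq_fun do rewrite add0r.
Qed.

Lemma gsq0_le s y Phi rho : (0 < s)%R -> (0 <= y)%R -> monotone_test Phi ->
  gsq s 0 Phi rho <= gsq s y Phi rho.
Proof.
move=> s0 y0 [mP P0 P1 Ph].
rewrite (gsq_shiftE _ y) ?gt_eqF// (gsq_shiftE _ 0) ?gt_eqF//.
under eq_integral do rewrite mul0r addr0.
apply: (normal_prob_shift_ge _ (fun g => Phi (rho + (s * g) ^+ 2)%R)) => //.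
- exact: measurable_psi.
- move=> g h gh; apply: Ph; rewrite lerD2l !exprMn ler_wpM2l ?sqr_ge0//.
  by rewrite -(real_normK (num_real g)) -(real_normK (num_real h)) lerXn2r// nnegrE.
- by rewrite divr_ge0// ltW.
Qed.

Lemma gsq_ge_expR s y Phi rho : (0 < s)%R ->
  measurable_fun setT Phi -> (forall t, 0 <= Phi t) ->
  (expR (- (y / s) ^+ 2 / 2))%:E * gsq s 0 Phi rho <= gsq s y Phi rho.
Proof.
move=> s0 mP P0.
rewrite (gsq_shiftE _ y) ?gt_eqF// (gsq_shiftE _ 0) ?gt_eqF//.
under eq_integral do rewrite mul0r addr0.
apply: (normal_prob_shift_cosh _ (fun g => Phi (rho + (s * g) ^+ 2)%R)) => //.
- exact: measurable_psi.
- by move=> g; rewrite mulrN sqrrN.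
Qed.

(* The lower bound gsq_ge_expR is applied to 1 - Phi. *)
Lemma gsq_le_gsq0D s y Phi rho : (0 < s)%R -> monotone_test Phi ->
  gsq s y Phi rho <= gsq s 0 Phi rho + ((y / s) ^+ 2 / 2)%:E.
Proof.
move=> s0 tP; have [mP P0 P1 Ph] := tP.
pose Psi t := 1 - Phi t.
have Pfin t : Phi t \is a fin_num.
  by rewrite ge0_fin_numE// (le_lt_trans (P1 t))// ltry.
have Psi0 t : 0 <= Psi t by rewrite /Psi sube_ge0 ?P1// Pfin.
have mPsi : measurable_fun setT Psi by exact: emeasurable_funB.
have split1 z : gsq s z Phi rho + gsq s z Psi rho = 1.
  rewrite /gsq -ge0_integralD//; try exact: measurable_gsq_integrand.
  under eq_integral do rewrite /Psi addeC subeK//.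
  by rewrite integral_cst//= probability_setT mule1.
have [_ gP0 gP1 _] : monotone_test (gsq s 0 Phi) by exact: monotone_test_gsq.
have [_ yP0 yP1 _] : monotone_test (gsq s y Phi) by exact: monotone_test_gsq.
have fin (a b : \bar R) : 0 <= a -> 0 <= b -> a + b = 1 ->
    exists r, a = r%:E /\ b = (1 - r)%:E.
  case: a => [a| |]; case: b => [b| |] //=; rewrite ?lee_fin => _ _ [ab].
  by exists a; split => //; congr EFin; rewrite -ab addrAC subrr add0r.
have [p [ep ep']] := fin _ _ (gP0 rho) (gsq_ge0 s 0 Psi rho Psi0) (split1 0%R).
have [q [eq eq']] := fin _ _ (yP0 rho) (gsq_ge0 s y Psi rho Psi0) (split1 y).
have := gsq_ge_expR s y Psi rho s0 mPsi Psi0.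
rewrite ep' eq' ep eq -EFinM -EFinD !lee_fin.
have p1 : (p <= 1)%R by rewrite -lee_fin -ep gP1.
have p0 : (0 <= p)%R by rewrite -lee_fin -ep gP0.
have := expR_ge1Dx (- (y / s) ^+ 2 / 2)%R.
have : (0 <= (y / s) ^+ 2)%R by exact: sqr_ge0.
set u := ((y / s) ^+ 2)%R; set k := expR _.
by rewrite mulNr => *; nra.
Qed.

Lemma gsqN s x Phi rho : measurable_fun setT Phi -> (forall t, 0 <= Phi t) ->
  gsq s (- x) Phi rho = gsq s x Phi rho.
Proof.
move=> mP P0.
have mg := measurable_gsq_integrand s x rho Phi mP.
apply: (eq_trans _ (ge0_integral_normal_probN _ mg (fun=> P0 _))).
apply: eq_integral => g _; congr (Phi (_ + _)%R).
by rewrite -sqrrN opprD opprK mulrN.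
Qed.

Definition gsqs s (l : seq R) Phi : R -> \bar R := foldr (gsq s) Phi l.

(* The mean of Phi (|y + s G|^2), for G a standard Gaussian vector in R^(n+1)
   and any y with |y|^2 = t: y can be rotated onto the first axis. *)
Definition radial s n Phi t : \bar R :=
  gsq s (Num.sqrt t) (iter n (gsq s 0) Phi) 0%R.

Lemma monotone_test_gsqs s l Phi : monotone_test Phi -> monotone_test (gsqs s l Phi).
Proof. by move=> tP; elim: l => //= x l IH; exact: monotone_test_gsq. Qed.

(** The induction quantifies over the parameter space because each coordinate that is averaged out
    enlarges [T] to [T * R]. *)
Lemma measurable_gsqs_param (I : Type) d (T : measurableType d) s (l : seq I)
    (z : I -> T -> R) (rho : T -> R) Phi :
  (forall i, measurable_fun setT (z i)) -> measurable_fun setT rho ->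
  monotone_test Phi ->
  measurable_fun setT (fun o : T => gsqs s [seq z i o | i <- l] Phi (rho o)).
Proof.
move=> + + tP.
elim: l d T z rho => [|i l IH] d T z rho mz mrho /=.
  by apply: measurableT_comp => //; exact: test_measurable.
apply: (@measurable_gsq_param _ _ _ s (z i) rho (fun o : T => gsqs s [seq z i o | i <- l] Phi)) => //.
- apply: (IH _ _ (fun i p => z i p.1) snd) => // j.
  exact: measurableT_comp.
- by move=> t u; apply: test_ge0; exact: monotone_test_gsqs.
Qed.

(** By induction the tail acts as one coordinate whose mean is its Euclidean norm, followed by
    centred ones; [gsq_comp] then rotates this mean into the head. *)
Lemma gsqs_radial s x (l : seq R) Phi rho : monotone_test Phi ->
  gsqs s (x :: l) Phi rho =
  gsq s (Num.sqrt (\sum_(y <- x :: l) y ^+ 2)) (iter (size l) (gsq s 0) Phi) rho.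
Proof.
move=> tP; elim: l x rho => [|y l IH] x rho.
  have [mP P0 _ _] := tP.
  rewrite big_seq1 sqrtr_sqr /=.
  have [x0|x0] := lerP 0%R x; first by rewrite ger0_norm.
  by rewrite ltr0_norm// gsqN.
rewrite [LHS]/=.
have -> : gsq s y (gsqs s l Phi) =
  gsq s (Num.sqrt (\sum_(y0 <- y :: l) y0 ^+ 2)) (iter (size l) (gsq s 0) Phi).
  by apply/funext => t; exact: IH.
have [mi i0 _ _] := monotone_test_iter_gsq s (size l) Phi tP.
have S0 : (0 <= \sum_(j <- y :: l) j ^+ 2)%R.
  by apply: sumr_ge0 => j _; exact: sqr_ge0.
rewrite (gsq_comp _ _ _ _ _ mi i0) (sqr_sqrtr S0) [in RHS]big_cons.
exact: erefl.
Qed.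

Lemma gsqs_radial0 s (l : seq R) Phi : monotone_test Phi -> (0 < size l)%N ->
  gsqs s l Phi 0%R = radial s (size l).-1 Phi (\sum_(y <- l) y ^+ 2).
Proof. by case: l => // x l tP _; exact: gsqs_radial. Qed.

(** The increment [e] is moved to the second axis, where it changes a mean from 0 to sqrt e while
    the first mean stays fixed. Both comparisons of [radial] below then reduce to one coordinate,
    uniformly in [t]. *)
Let radialD s n Phi t (e : R) : monotone_test Phi -> (0 <= t)%R -> (0 <= e)%R ->
  radial s n.+1 Phi (t + e) =
  gsq s (Num.sqrt t) (gsq s (Num.sqrt e) (iter n (gsq s 0) Phi)) 0%R.
Proof.
move=> tP t0 e0; have [mi i0 _ _] := monotone_test_iter_gsq s n Phi tP.
by rewrite (gsq_comp _ _ _ _ _ mi i0) (sqr_sqrtr t0) (sqr_sqrtr e0).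
Qed.

Lemma radial_le s n Phi t u : (0 < s)%R -> monotone_test Phi ->
  (0 <= t)%R -> (t <= u)%R -> radial s n.+1 Phi t <= radial s n.+1 Phi u.
Proof.
move=> s0 tP t0 tu; have ut0 : (0 <= u - t)%R by rewrite subr_ge0.
have -> : (u = t + (u - t))%R by rewrite addrC subrK.
rewrite (radialD s n Phi t (u - t) tP t0 ut0).
have ti := monotone_test_iter_gsq s n Phi tP.
have [m1 p1 _ _] := monotone_test_iter_gsq s n.+1 _ tP.
have [m2 p2 _ _] := monotone_test_gsq s (Num.sqrt (u - t)) _ ti.
apply: ge0_le_integral => //; try exact: measurable_gsq_integrand.
move=> g _; exact: (gsq0_le s _ _ _ s0 (sqrtr_ge0 _) ti).
Qed.

Lemma radialD_le s n Phi t (e : R) : (0 < s)%R -> monotone_test Phi ->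
  (0 <= t)%R -> (0 <= e)%R ->
  radial s n.+1 Phi (t + e) <= radial s n.+1 Phi t + (e / (2 * s ^+ 2))%:E.
Proof.
move=> s0 tP t0 e0; rewrite (radialD s n Phi t e tP t0 e0).
have ti := monotone_test_iter_gsq s n Phi tP.
have [m1 p1 _ _] := monotone_test_gsq s 0 _ ti.
have [m2 p2 _ _] := monotone_test_gsq s (Num.sqrt e) _ ti.
have c0 : (0 <= e / (2 * s ^+ 2))%R by rewrite divr_ge0// mulr_ge0// sqr_ge0.
apply: (@le_trans _ _ (\int[nu]_g (gsq s 0 (iter n (gsq s 0) Phi)
    (0 + (Num.sqrt t + s * g) ^+ 2)%R + (e / (2 * s ^+ 2))%:E))).
  apply: ge0_le_integral => //; try exact: measurable_gsq_integrand.
    by apply: emeasurable_funD => //; exact: measurable_gsq_integrand.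
  move=> g _; apply: (le_trans (gsq_le_gsq0D _ _ _ _ s0 ti)).
  rewrite leeD2l// lee_fin expr_div_n sqr_sqrtr//.
  by rewrite le_eqVlt; apply/orP; left; apply/eqP; field; rewrite gt_eqF.
rewrite ge0_integralD//; last exact: measurable_gsq_integrand.
by rewrite integral_cst//= probability_setT mule1.
Qed.

Lemma radial_ge0 s n Phi t : monotone_test Phi -> 0 <= radial s n Phi t.
Proof.
by move=> tP; exact: (test_ge0 _ (monotone_test_gsq _ _ _ (monotone_test_iter_gsq s n Phi tP))).
Qed.

End gsq_iterated.

Set Implicit Arguments.
Unset Strict Implicit.
Unset Printing Implicit Defensive.

(** * Independent Gaussian vectors *)

Lemma pushforward_measureP d1 d2 (T1 : measurableType d1) (T2 : measurableType d2)
    (R : realType) (m : {measure set T1 -> \bar R}) (f : T1 -> T2) :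
  measurable_fun setT f ->
  exists m' : {measure set T2 -> \bar R},
    (forall A, m' A = m (f @^-1` A)) /\
    (forall g : T2 -> \bar R, measurable_fun setT g -> (forall x, 0 <= g x)%E ->
      (\int[m']_x g x = \int[m]_x g (f x))%E).
Proof.
move=> mf.
unshelve eexists (pushforward m f : {measure set T2 -> \bar R}); first exact: mf.
split=> // g mg g0.
have := @ge0_integral_pushforward _ _ _ _ R _ mf m setT g measurableT mg (fun p _ => g0 p).
by rewrite preimage_setT.
Qed.

Section gaussian_independence.
Local Open Scope ereal_scope.
Context {R : realType}.
Local Notation nu := (@normal_prob R 0 1).

Lemma finite_measure_prod_ext d1 d2 (T1 : measurableType d1) (T2 : measurableType d2)
    (m1 m2 : {measure set (T1 * T2) -> \bar R}) :
  m1 setT < +oo ->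
  (forall A B, measurable A -> measurable B -> m1 (A `*` B) = m2 (A `*` B)) ->
  forall X, measurable X -> m1 X = m2 X.
Proof.
move=> m1fin m12 X mX.
pose C : set (set (T1 * T2)) :=
  [set C | exists A, measurable A /\ exists B, measurable B /\ C = A `*` B].
have CI : setI_closed C.
  move=> /= _ _ [X1 [mX1 [X2 [mX2 ->]]]] [Y1 [mY1 [Y2 [mY2 ->]]]].
  rewrite -setXI; exists (X1 `&` Y1); split; first exact: measurableI.
  by exists (X2 `&` Y2); split => //; exact: measurableI.
apply: (measure_unique C (fun=> setT)) => //.
- rewrite measurable_prod_measurableType//; congr (<<s _ >>).
  rewrite predeqE; split => [[A mA [B mB <-]]|[A [mA [B [mB ->]]]]].
    by exists A; split => //; exists B.
  by exists A => //; exists B.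
- move=> n; exists setT; split => //; exists setT; split => //.
  by rewrite setXTT.
- by rewrite bigcup_const.
- by move=> A [A1 [mA1 [A2 [mA2 ->]]]]; exact: m12.
Qed.

Context d (Omega : measurableType d) (P : probability Omega R) (I : eqType)
  (xi : I -> Omega -> R) (r : R).
Hypothesis mxi : forall i, measurable_fun setT (xi i).

(** The common law of the [xi i] is written as the image of [nu] under scaling by [r], which makes
    sense for [r = 0] too, the case [eta = 0]. *)
Definition gauss_indep d' (T : measurableType d') (Y : Omega -> T) (l : seq I) :=
  forall (A : set T) (C : I -> set R), measurable A ->
    (forall i, measurable (C i)) ->
  P (Y @^-1` A `&` \big[setI/setT]_(i <- l) (xi i @^-1` C i)) =
  P (Y @^-1` A) * \prod_(i <- l) nu ((fun g : R => r * g)%R @^-1` C i).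

Lemma bigsetI_upd (i : I) (l : seq I) (B : set R) (C : I -> set R) : i \notin l ->
  \big[setI/setT]_(j <- l) (xi j @^-1` (if j == i then B else C j)) =
  \big[setI/setT]_(j <- l) (xi j @^-1` C j).
Proof.
move=> il; apply: eq_big_seq => j jl.
by case: eqP jl => // ->; rewrite (negbTE il).
Qed.

Lemma bigprod_upd (i : I) (l : seq I) (B : set R) (C : I -> set R) : i \notin l ->
  \prod_(j <- l) nu ((fun g : R => r * g)%R @^-1` (if j == i then B else C j)) =
  \prod_(j <- l) nu ((fun g : R => r * g)%R @^-1` C j).
Proof.
move=> il; apply: eq_big_seq => j jl.
by case: eqP jl => // ->; rewrite (negbTE il).
Qed.

Lemma measurable_bigsetI_xi (l : seq I) (C : I -> set R) :
  (forall i, measurable (C i)) ->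
  measurable (\big[setI/setT]_(j <- l) (xi j @^-1` C j)).
Proof.
move=> mC; elim: l => [|j l IH]; first by rewrite big_nil.
rewrite big_cons; apply: measurableI => //.
by rewrite -[X in measurable X]setTI; exact: mxi.
Qed.

Lemma measurable_scale_preimage (C : set R) : measurable C ->
  measurable ((fun g : R => r * g)%R @^-1` C).
Proof.
move=> mC; rewrite -[X in measurable X]setTI.
have mf : measurable_fun setT (fun g : R => r * g)%R by exact: measurable_funM.
exact: mf.
Qed.

Section peel.
Context d' (T : measurableType d') (Y : Omega -> T).
Hypothesis mY : measurable_fun setT Y.
Variables (i : I) (l : seq I).
Hypotheses (il : i \notin l) (iY : gauss_indep Y (i :: l)).

Lemma gauss_indep_head (A : set T) (B : set R) : measurable A -> measurable B ->
  P (Y @^-1` A `&` xi i @^-1` B) = P (Y @^-1` A) * nu ((fun g : R => r * g)%R @^-1` B).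
Proof.
move=> mA mB.
have := @iY A (fun j => if j == i then B else setT) mA.
rewrite !big_cons eqxx bigsetI_upd// bigprod_upd//.
rewrite [X in _ `&` (_ `&` X)]big1 ?setIT//.
rewrite [X in _ * (_ * X)]big1; last first.
  by move=> j _; rewrite preimage_setT probability_setT.
rewrite mule1; apply.
by move=> j; case: ifP.
Qed.

(** Restricting [P] to the event [D] on the remaining coordinates and multiplying [P] by the
    constant [k] give two finite laws of the pair that agree on rectangles, hence on all measurable
    sets. *)
Lemma gauss_indep_cons : gauss_indep (fun o => (Y o, xi i o)) l.
Proof.
move=> A C mA mC.
set D := \big[setI/setT]_(_ <- _) _; set k := \prod_(_ <- _) _.
have mD : measurable D by exact: measurable_bigsetI_xi.
have mYx : measurable_fun setT (fun o => (Y o, xi i o)).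
  by apply/measurable_fun_pair.
have k0 : 0 <= k by apply: prode_ge0 => j _; exact: measure_ge0.
have kfin : k \is a fin_num.
  apply: prode_fin_num => j _; apply: fin_num_measure.
  exact: measurable_scale_preimage.
have k0' : (0 <= fine k)%R by rewrite fine_ge0.
have [m1 [m1E _]] := pushforward_measureP (mrestr P mD) mYx.
have [mP [mPE _]] := pushforward_measureP P mYx.
pose m2 : {measure set (T * R) -> \bar R} := mscale (NngNum k0') mP.
have m2E B : m2 B = k * P ((fun o => (Y o, xi i o)) @^-1` B).
  by rewrite -mPE -[X in X * _]fineK.
have : m1 A = m2 A.
  apply: finite_measure_prod_ext => //.
    rewrite m1E; apply: (@le_lt_trans _ _ 1); last exact: ltry.
    by apply: probability_le1; apply: measurableI => //; rewrite preimage_setT.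
  move=> A' B mA' mB.
  rewrite m1E m2E /=.
  rewrite (_ : _ @^-1` (A' `*` B) = Y @^-1` A' `&` xi i @^-1` B)//.
  rewrite gauss_indep_head// /mrestr.
  have := @iY A' (fun j => if j == i then B else C j) mA'.
  rewrite !big_cons eqxx bigsetI_upd// bigprod_upd// -/D -/k setIA => ->; last first.
    by move=> j; case: ifP.
  by rewrite muleA [RHS]muleC.
rewrite m1E m2E [RHS]muleC => <-; exact: erefl.
Qed.

Lemma integral_gauss_indep_head (f : T * R -> \bar R) :
  measurable_fun setT f -> (forall p, 0 <= f p) ->
  \int[P]_o f (Y o, xi i o) = \int[P]_o \int[nu]_g f (Y o, r * g)%R.
Proof.
move=> mf f0.
have mYx : measurable_fun setT (fun o => (Y o, xi i o)).
  by apply/measurable_fun_pair.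
have mYg : measurable_fun setT (fun p : Omega * R => (Y p.1, r * p.2)%R).
  apply/measurable_fun_pair; first exact: measurableT_comp.
  exact: measurable_funM.
have [m1 [m1E e1]] := pushforward_measureP P mYx.
have [m2 [m2E e2]] := pushforward_measureP (P \x nu)%E mYg.
have m12 A : measurable A -> m1 A = m2 A.
  apply: finite_measure_prod_ext => //.
    rewrite m1E; apply: (@le_lt_trans _ _ 1); last exact: ltry.
    by apply: probability_le1; rewrite preimage_setT.
  move=> A' B mA' mB; rewrite m1E m2E.
  have mYA : measurable (Y @^-1` A').
    by rewrite -[X in measurable X]setTI; exact: mY.
  apply: (eq_trans (gauss_indep_head mA' mB)).
  exact/esym/(product_measure1E P nu mYA (measurable_scale_preimage mB)).
apply: (eq_trans (esym (e1 f mf f0))).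
have e12 : \int[m1]_p f p = \int[m2]_p f p.
  by apply: eq_measure_integral => A mA _; exact: m12.
apply: (eq_trans e12); apply: (eq_trans (e2 f mf f0)).
pose F (p : Omega * R) := f (Y p.1, r * p.2)%R.
have mF : measurable_fun setT F by exact: measurableT_comp.
have F0 p : 0 <= F p by exact: f0.
exact: (@fubini_tonelli1 _ _ _ _ _ P nu F mF F0).
Qed.

End peel.

(** Induction on the coordinates. For a fixed value of the first regularising Gaussian the other
    coordinates are treated by induction, with [xi i] joined to [Y]; after exchanging the integrals
    back, [xi i] is integrated out and merges with that Gaussian by [gsq_convolution]. *)
Lemma integral_gsqs_gauss_indep s Phi d' (T : measurableType d') (Y : Omega -> T)
    (l : seq I) (z : I -> T -> R) (rho : T -> R) :
  measurable_fun setT Y -> (forall i, measurable_fun setT (z i)) ->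
  measurable_fun setT rho -> monotone_test Phi ->
  uniq l -> gauss_indep Y l ->
  \int[P]_o gsqs s [seq (z i (Y o) + xi i o)%R | i <- l] Phi (rho (Y o)) =
  \int[P]_o gsqs (Num.sqrt (s ^+ 2 + r ^+ 2)) [seq z i (Y o) | i <- l] Phi (rho (Y o)).
Proof.
move=> + + + tP; set s' := Num.sqrt _.
elim: l d' T Y z rho => [//|i l IH] d' T Y z rho mY mz mrho /= /andP[il ul] iY.
pose F (p : Omega * R) := gsqs s [seq (z j (Y p.1) + xi j p.1)%R | j <- l] Phi
  (rho (Y p.1) + ((z i (Y p.1) + xi i p.1) + s * p.2) ^+ 2)%R.
pose G (p : Omega * R) := gsqs s' [seq z j (Y p.1) | j <- l] Phi
  (rho (Y p.1) + ((z i (Y p.1) + xi i p.1) + s * p.2) ^+ 2)%R.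
have mzY j : measurable_fun setT (fun p : Omega * R => z j (Y p.1)).
  by apply: measurableT_comp => //; exact: measurableT_comp.
have mxi1 j : measurable_fun setT (fun p : Omega * R => xi j p.1).
  exact: measurableT_comp.
have mr : measurable_fun setT (fun p : Omega * R =>
    rho (Y p.1) + ((z i (Y p.1) + xi i p.1) + s * p.2) ^+ 2)%R.
  apply: measurable_funD.
    by apply: measurableT_comp => //; exact: measurableT_comp.
  apply: measurable_funX; apply: measurable_funD; first exact: measurable_funD.
  exact: measurable_funM.
have mF : measurable_fun setT F.
  apply: (measurable_gsqs_param _ _ _ s l
    (fun j p => z j (Y p.1) + xi j p.1)%R) => // j.
  exact: measurable_funD.
have mG : measurable_fun setT G.
  exact: (measurable_gsqs_param _ _ _ s' l (fun j p => z j (Y p.1))).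
have F0 p : 0 <= F p by exact: (test_ge0 _ (monotone_test_gsqs _ _ _ tP)).
have G0 p : 0 <= G p by exact: (test_ge0 _ (monotone_test_gsqs _ _ _ tP)).
apply: (eq_trans (@fubini_tonelli _ _ _ _ _ P nu F mF F0)).
transitivity (\int[nu]_g \int[P]_o G (o, g)).
  apply: eq_integral => g _; rewrite /F /G /=.
  have mYx : measurable_fun setT (fun o => (Y o, xi i o)).
    by apply/measurable_fun_pair.
  apply: (IH _ _ (fun o => (Y o, xi i o)) (fun j p => z j p.1)
    (fun p => rho p.1 + ((z i p.1 + p.2) + s * g) ^+ 2)%R) => //.
  - by move=> j; exact: measurableT_comp.
  - apply: measurable_funD; first exact: measurableT_comp.
    apply: measurable_funX; apply: measurable_funD => //.
    by apply: measurable_funD => //; exact: measurableT_comp.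
  - exact: (gauss_indep_cons mY il iY).
apply: (eq_trans (esym (@fubini_tonelli _ _ _ _ _ P nu G mG G0))).
pose H (p : T * R) :=
  gsq s (z i p.1 + p.2)%R (gsqs s' [seq z j p.1 | j <- l] Phi) (rho p.1).
have mH : measurable_fun setT H.
  apply: (measurable_gsq_param _ _ s (fun p : T * R => z i p.1 + p.2)%R
    (fun p => rho p.1) (fun p => gsqs s' [seq z j p.1 | j <- l] Phi)).
  - by apply: measurable_funD => //; exact: measurableT_comp.
  - exact: measurableT_comp.
  - have mzp j : measurable_fun setT (fun p : T * R * R => z j p.1.1).
      by apply: measurableT_comp => //; exact: measurableT_comp.
    exact: (measurable_gsqs_param _ _ _ s' l _ snd Phi mzp measurable_snd tP).
  - by move=> p t; exact: (test_ge0 _ (monotone_test_gsqs s' [seq z j p.1 | j <- l] Phi tP)).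
have H0 p : 0 <= H p.
  by apply: gsq_ge0 => t; exact: (test_ge0 _ (monotone_test_gsqs _ _ _ tP)).
apply: (eq_trans (integral_gauss_indep_head mY il iY mH H0)).
apply: eq_integral => o _.
have [mt t0 _ _] := monotone_test_gsqs s' [seq z j (Y o) | j <- l] Phi tP.
exact: gsq_convolution.
Qed.

End gaussian_independence.

(** * The hypergraph Laplacian *)

Section extrema.
Context {R : realType} {V : finType}.
Implicit Types (f : V -> R) (e : {set V}).

Lemma edge_maxP f e : e != finset.set0 ->
  (exists2 u, u \in e & f u = edge_max f e) /\
  (forall v, v \in e -> f v <= edge_max f e).
Proof.
case/set0Pn => u0 u0e.
have [u ue uP] := @Order.TotalTheory.arg_maxP _ _ V u0 (fun u => u \in e) f u0e.
suff -> : edge_max f e = f u by split; [exists u | exact: uP].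
apply/eqP; rewrite eq_le; apply/andP; split.
  apply: ge_sup; first by exists (f u), u.
  by move=> _ [v /= ve <-]; exact: uP.
apply: ub_le_sup; last by exists u.
by exists (f u) => _ [v /= ve <-]; exact: uP.
Qed.

Lemma edge_minP f e : e != finset.set0 ->
  (exists2 u, u \in e & f u = edge_min f e) /\
  (forall v, v \in e -> edge_min f e <= f v).
Proof.
case/set0Pn => u0 u0e.
have [u ue uP] := @Order.TotalTheory.arg_minP _ _ V u0 (fun u => u \in e) f u0e.
suff -> : edge_min f e = f u by split; [exists u | exact: uP].
apply/eqP; rewrite eq_le; apply/andP; split.
  apply: ge_inf; last by exists u.
  by exists (f u) => _ [v /= ve <-]; exact: uP.
apply: lb_le_inf; first by exists (f u), u.
by move=> _ [v /= ve <-]; exact: uP.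
Qed.

Lemma Smax_neq0 f e : e != finset.set0 -> Smax f e != finset.set0.
Proof.
by case/(edge_maxP f) => -[u ue fu] _; apply/set0Pn; exists u; rewrite inE ue fu eqxx.
Qed.

Lemma Imin_neq0 f e : e != finset.set0 -> Imin f e != finset.set0.
Proof.
by case/(edge_minP f) => -[u ue fu] _; apply/set0Pn; exists u; rewrite inE ue fu eqxx.
Qed.

Lemma level_Imin f (a : R) (U : {set V}) e : e != finset.set0 ->
  (forall u, (u \in U) = (f u == a)) ->
  (Imin f e \subset U) = (edge_min f e == a).
Proof.
move=> e0 UE; apply/fintype.subsetP/eqP => [sub|ma u].
  have /set0Pn[u ui] := Imin_neq0 f e0.
  by have := sub _ ui; rewrite UE; move: ui; rewrite inE => /andP[_ /eqP ->] /eqP.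
by rewrite inE UE -ma => /andP[_].
Qed.

Lemma level_Smax f (a : R) (U : {set V}) e : e != finset.set0 ->
  (forall u, (u \in U) = (f u == a)) ->
  (Smax f e :&: U != finset.set0)%SET = (edge_max f e == a).
Proof.
move=> e0 UE; apply/set0Pn/eqP => [[u]|ma].
  by rewrite !inE UE => /andP[/andP[_ /eqP ->] /eqP].
by have /set0Pn[u ui] := Smax_neq0 f e0; exists u; move: ui; rewrite !inE UE -ma => /andP[-> ->].
Qed.

End extrema.

Section conservation.
Context {R : realType} {V : finType} {E : {set {set V}}} {w : {set V} -> R}.
Hypothesis HE : weighted_hypergraph E w.
Implicit Types (f : V -> R) (e : {set V}) (A U X P : {set V}) (F : {set {set V}}).

Let c f e := w e * (edge_max f e - edge_min f e).

Let E0 e : e \in E -> e != finset.set0.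
Proof. exact: edge_nonempty HE _. Qed.

Lemma set_weight_gt0 X : X != finset.set0 -> 0 < set_weight E w X.
Proof.
case/set0Pn => u uX; rewrite /set_weight (bigD1 u)//= ltr_wpDr ?(vweight_gt0 HE)//.
by apply: sumr_ge0 => v _; rewrite ltW ?(vweight_gt0 HE).
Qed.

Definition stage_argmax f A U F : {set V} :=
  [arg max_(X > U | (X != finset.set0) && (X \subset U)) density E w f A F X]%O.

Lemma stage_argmaxP f A U F : U != finset.set0 ->
  (stage_argmax f A U F != finset.set0) && (stage_argmax f A U F \subset U).
Proof.
by move=> U0; rewrite /stage_argmax; case: Order.TotalTheory.arg_maxP => //=; rewrite U0 fintype.subxx.
Qed.

(* The procedure moves the flow c_e of every edge from its maximizers to its
   minimizers. *)
Lemma rate_rec_sum f (a : R) (U0 : {set V}) k A U F :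
  (forall u, (u \in U0) = (f u == a)) ->
  (#|U| <= k)%N -> (A :|: U = U0)%SET -> (A :&: U = finset.set0)%SET ->
  F \subset E ->
  (forall e, e \in F -> Imin f e \subset U0 -> ~~ (Imin f e \subset A)) ->
  (forall e, e \in F -> (Smax f e :&: A)%SET = finset.set0) ->
  \sum_(v in U) vweight E w v * rate_rec E w f k A U F v =
  \sum_(e in F | Imin f e \subset U0) c f e -
  \sum_(e in F | (Smax f e :&: U0 != finset.set0)%SET) c f e.
Proof.
move=> U0E.
elim: k A U F => [|k IH] A U F Uk AU AIU FE FI FS.
  have U_0 : U = finset.set0 by apply/eqP; rewrite -cards_eq0 -leqn0.
  move: AU; rewrite U_0 finset.setU0 big_set0 => AU.
  rewrite big1; last by move=> e /andP[eF sub]; have := FI e eF sub; rewrite AU sub.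
  rewrite big1 ?subrr// => e /andP[eF].
  by rewrite -AU FS// eqxx.
have [U_0|U_n0] := eqVneq U finset.set0.
  move: AU; rewrite U_0 finset.setU0 big_set0 => AU.
  rewrite big1; last by move=> e /andP[eF sub]; have := FI e eF sub; rewrite AU sub.
  rewrite big1 ?subrr// => e /andP[eF].
  by rewrite -AU FS// eqxx.
have /andP[P0 PU] := stage_argmaxP f A F U_n0.
rewrite /= -/(stage_argmax f A U F); set P := stage_argmax f A U F in P0 PU *.
have AP0 : (A :|: P \subset U0)%SET.
  by rewrite -AU finset.setUS.
rewrite (big_setID P) /= (finset.setIidPr PU).
set F' := (F :\: (IX f A F P :|: SX f F P))%SET.
have F'F : F' \subset F by exact: finset.subsetDl.
have -> : \sum_(v in P) vweight E w v *
    (if v \in P then density E w f A F P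
     else rate_rec E w f k (A :|: P) (U :\: P) F' v) =
    edges_cost w f (IX f A F P) - edges_cost w f (SX f F P).
  transitivity (set_weight E w P * density E w f A F P).
    by rewrite /set_weight mulr_suml; apply: eq_bigr => v ->.
  by rewrite /density mulrC divfK// gt_eqF// set_weight_gt0.
have -> : \sum_(v in U :\: P) vweight E w v *
    (if v \in P then density E w f A F P
     else rate_rec E w f k (A :|: P) (U :\: P) F' v) =
   \sum_(e in F' | Imin f e \subset U0) c f e -
   \sum_(e in F' | (Smax f e :&: U0 != finset.set0)%SET) c f e.
  rewrite -(IH (A :|: P)%SET (U :\: P)%SET F').
  - by apply: eq_bigr => v; rewrite inE => /andP[/negbTE ->].
  - rewrite -ltnS (leq_trans _ Uk)// cardsD (finset.setIidPr PU).
    rewrite ltn_subrL !card_gt0 P0 /=.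
    by apply: contra_neq U_n0 => U0'; rewrite U0'.
  - by rewrite -finset.setUA -AU -[in RHS](finset.setID U P) (finset.setIidPr PU).
  - apply/setP => v; rewrite !inE; apply/negP => /and3P[/orP[vA|vP] vnP vU].
      by have := finset.in_set0 v; rewrite -AIU inE vA vU.
    by rewrite vP in vnP.
  - exact: fintype.subset_trans F'F FE.
  - move=> e; rewrite !inE negb_or => /andP[/andP[eI eS] eF] _.
    by rewrite eF /= in eI.
  - move=> e; rewrite !inE negb_or => /andP[/andP[eI eS] eF].
    rewrite eF /= negbK in eS.
    by rewrite finset.setIUr FS// (eqP eS) finset.setU0.
(* An edge whose minimum and maximum both lie on the level [a] has cost 0. Hence an edge removed in
   this stage on account of one end loses nothing at its other end. *)
have c0 e : e \in F -> Imin f e \subset U0 ->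
    (Smax f e :&: U0 != finset.set0)%SET -> c f e = 0.
  move=> eF; have e0 := E0 (fintype.subsetP FE _ eF).
  by rewrite (level_Imin e0 U0E) (level_Smax e0 U0E) /c => /eqP -> /eqP ->; rewrite subrr mulr0.
have eI : edges_cost w f (IX f A F P) + \sum_(e in F' | Imin f e \subset U0) c f e =
    \sum_(e in F | Imin f e \subset U0) c f e.
  rewrite /edges_cost [X in X + _]big_mkcond [X in _ + X]big_mkcond [RHS]big_mkcond -big_split /=.
  apply: eq_bigr => e _; rewrite !inE -/(c f e).
  have [eF|] := boolP (e \in F); last by rewrite !andbF !andFb addr0.
  rewrite /= !andbT.
  have [Ie|Ie] := boolP (Imin f e \subset _) => /=.
    by rewrite (fintype.subset_trans Ie AP0) addr0.
  have [Se|Se] := boolP (_ != finset.set0) => /=; last by rewrite add0r.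
  rewrite add0r; case: ifP => // IU0; rewrite c0//.
  apply: contra_neq Se => SU0; apply/eqP; rewrite -finset.subset0 -SU0 finset.setIS//.
  exact: fintype.subset_trans (finset.subsetUr A P) AP0.
have eS : edges_cost w f (SX f F P) +
      \sum_(e in F' | (Smax f e :&: U0 != finset.set0)%SET) c f e =
    \sum_(e in F | (Smax f e :&: U0 != finset.set0)%SET) c f e.
  rewrite /edges_cost [X in X + _]big_mkcond [X in _ + X]big_mkcond [RHS]big_mkcond -big_split /=.
  apply: eq_bigr => e _; rewrite !inE -/(c f e).
  have [eF|] := boolP (e \in F); last by rewrite !andbF !andFb addr0.
  rewrite /= !andbT.
  have [Se|Se] := boolP (Smax f e :&: P != finset.set0)%SET.
    rewrite orbT /= addr0 ifT//; apply: contra_neq Se => SU0.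
    apply/eqP; rewrite -finset.subset0 -SU0 finset.setIS//.
    exact: fintype.subset_trans (finset.subsetUr A P) AP0.
  rewrite orbF add0r.
  have [Ie|Ie] := boolP (Imin f e \subset _) => //=.
  by case: ifP => // SU0; rewrite c0// (fintype.subset_trans Ie AP0).
rewrite -eI -eS; ring.
Qed.

Lemma sum_level_rate f (v : V) :
  \sum_(u in level_class f v) vweight E w u * rate E w f u =
  \sum_(e in E | edge_min f e == f v) c f e -
  \sum_(e in E | edge_max f e == f v) c f e.
Proof.
set U := level_class f v.
have UE u : (u \in U) = (f u == f v) by rewrite inE.
transitivity (\sum_(u in U) vweight E w u *
    rate_rec E w f #|V| finset.set0 U (class_edges E f U) u).
  apply: eq_bigr => u uU; congr (_ * _); rewrite /rate.
  suff -> : level_class f u = U by [].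
  by apply/setP => u'; rewrite !inE; move: uU; rewrite UE => /eqP ->.
have FE e : e \in class_edges E f U -> e \in E by rewrite inE => /andP[].
rewrite (rate_rec_sum UE) ?max_card ?finset.set0U ?finset.set0I//; last 3 first.
- by apply/fintype.subsetP => e; exact: FE.
- move=> e eF _; rewrite finset.subset0; exact: (Imin_neq0 _ (E0 (FE _ eF))).
- by move=> e _; rewrite finset.setI0.
congr (_ - _); apply: eq_bigl => e; rewrite inE.
  have [eE|//] := boolP (e \in E); have e0 := E0 eE.
  rewrite /= (level_Imin e0 UE); have [m|_] := eqVneq (edge_min f e) (f v); last by rewrite andbF.
  rewrite andbT; apply/set0Pn; have /set0Pn[u ui] := Imin_neq0 f e0; exists u.
  by rewrite finset.in_setI finset.in_setU ui UE /=; move: ui; rewrite inE => /andP[_ /eqP ->]; rewrite m.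
have [eE|//] := boolP (e \in E); have e0 := E0 eE.
rewrite /= (level_Smax e0 UE); have [m|_] := eqVneq (edge_max f e) (f v); last by rewrite andbF.
rewrite andbT; apply/set0Pn; have /set0Pn[u ui] := Smax_neq0 f e0; exists u.
by rewrite finset.in_setI finset.in_setU ui orbT UE /=; move: ui; rewrite inE => /andP[_ /eqP ->]; rewrite m.
Qed.

Lemma level_average f (phi : R -> R) (v : V) :
  \sum_(u | f u == f v) phi (f u) / #|level_class f u|%:R = phi (f v).
Proof.
transitivity (\sum_(u in level_class f v) phi (f v) / #|level_class f v|%:R).
  apply: eq_big => u; first by rewrite inE.
  move=> /eqP fu; rewrite fu; suff -> : level_class f u = level_class f v by [].
  by apply/setP => u'; rewrite !inE fu.
rewrite sumr_const -[RHS](@mulfVK _ #|level_class f v|%:R) ?mulr_natr//.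
  by rewrite pnatr_eq0 -lt0n; apply/card_gt0P; exists v; rewrite inE.
Qed.

(* A sum over V is regrouped by level classes by spreading every term evenly
   over its class. *)
Lemma rate_dot f (phi : R -> R) :
  \sum_v vweight E w v * rate E w f v * phi (f v) =
  \sum_(e in E) c f e * (phi (edge_min f e) - phi (edge_max f e)).
Proof.
pose k v := phi (f v) / #|level_class f v|%:R.
transitivity (\sum_v k v * \sum_(u in level_class f v) vweight E w u * rate E w f u).
  transitivity (\sum_u \sum_(v | f v == f u) vweight E w u * rate E w f u * k v).
    by apply: eq_bigr => u _; rewrite -mulr_sumr level_average.
  rewrite (exchange_big_dep xpredT)//=.
  apply: eq_bigr => v _; rewrite mulr_sumr; apply: eq_big => u.
    by rewrite inE eq_sym.
  by rewrite mulrC.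
transitivity (\sum_v k v * (\sum_(e in E | edge_min f e == f v) c f e) -
    \sum_v k v * (\sum_(e in E | edge_max f e == f v) c f e)).
  by rewrite -sumrB; apply: eq_bigr => v _; rewrite sum_level_rate mulrBr.
have regroup (m : {set V} -> R) : (forall e, e \in E -> exists u, f u = m e) ->
    \sum_v k v * (\sum_(e in E | m e == f v) c f e) =
    \sum_(e in E) c f e * phi (m e).
  move=> mE; under eq_bigr do rewrite mulr_sumr.
  rewrite (exchange_big_dep (fun e => e \in E))/=; last by move=> v e _ /andP[].
  apply: eq_bigr => e eE; have [u <-] := mE e eE.
  rewrite -(level_average f phi u) mulr_sumr; apply: eq_big => v.
    by rewrite eE /= eq_sym.
  by rewrite mulrC.
rewrite regroup; last by move=> e /E0 /(edge_minP f) [[u _ <-] _]; exists u.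
rewrite regroup; last by move=> e /E0 /(edge_maxP f) [[u _ <-] _]; exists u.
by rewrite -sumrB; apply: eq_bigr => e _; rewrite mulrBr.
Qed.

End conservation.

(** * Energy identity, coercivity and local boundedness of the Laplacian *)

Section laplacian_facts.
Context {R : realType} {V : finType} {E : {set {set V}}} {w : {set V} -> R}.
Hypothesis HE : weighted_hypergraph E w.
Implicit Types (f x y : V -> R) (e : {set V}) (A U X P : {set V}) (F : {set {set V}}).

Local Notation W := (vweight E w).
Local Notation Pi := (proj_x1 E w).
Local Notation L := (laplacian E w).

Let resc x : V -> R := fun u => x u / Num.sqrt (W u).
Let spread f e := edge_max f e - edge_min f e.

Let E0 e : e \in E -> e != finset.set0.
Proof. exact: edge_nonempty HE _. Qed.

Let W0 v : 0 < Num.sqrt (W v).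
Proof. by rewrite sqrtr_gt0 (vweight_gt0 HE). Qed.

Let sqW v : Num.sqrt (W v) * Num.sqrt (W v) = W v.
Proof. by rewrite -expr2 sqr_sqrtr// ltW// (vweight_gt0 HE). Qed.

(** This is [rate_dot] for the identity: each edge moves its cost across its own spread. *)
Lemma laplacian_dot x :
  vdot x (L x) = \sum_(e in E) w e * spread (resc x) e ^+ 2.
Proof.
transitivity (- \sum_v W v * rate E w (resc x) v * idfun (resc x v)).
  rewrite -sumrN; apply: eq_bigr => v _; rewrite /laplacian /laplacian_w /= -/(resc x).
  have xE : x v = Num.sqrt (W v) * resc x v.
    by rewrite /resc mulrC divfK// gt_eqF.
  rewrite {1}xE -[X in - (X * _ * _)](sqW v); ring.
rewrite rate_dot// -sumrN; apply: eq_bigr => e _.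
by rewrite /spread /=; ring.
Qed.

(** Conservation of mass: [rate_dot] for a constant function. *)
Lemma x1_laplacian x : vdot (x1 E w) (L x) = 0.
Proof.
transitivity (- \sum_v W v * rate E w (resc x) v * cst 1 (resc x v)).
  rewrite -sumrN; apply: eq_bigr => v _.
  by rewrite /laplacian /laplacian_w /x1 -/(resc x) mulrA sqW mulrN mulr1.
by rewrite rate_dot// big1 ?oppr0// => e _; rewrite subrr mulr0.
Qed.

Lemma vdotC x y : vdot x y = vdot y x.
Proof. by apply: eq_bigr => v _; rewrite mulrC. Qed.

Lemma vdot_ge0 x : 0 <= vdot x x.
Proof. by apply: sumr_ge0 => v _; rewrite -expr2 sqr_ge0. Qed.

Lemma vdot_x1_gt0 : 0 < vdot (x1 E w) (x1 E w).
Proof.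
have /card_gt0P[v _] := ltnW (two_vertices HE).
rewrite /vdot (bigD1 v)//= ltr_wpDr//.
  by apply: sumr_ge0 => u _; rewrite -expr2 sqr_ge0.
by rewrite sqW (vweight_gt0 HE).
Qed.

Lemma vdot_proj_l x y : vdot (Pi x) y = vdot x y - vdot x (x1 E w) / vdot (x1 E w) (x1 E w) * vdot (x1 E w) y.
Proof.
rewrite [X in _ - _ * X]/vdot mulr_sumr {2}/vdot -sumrB.
by apply: eq_bigr => v _; rewrite /proj_x1 mulrBl mulrA.
Qed.

Lemma proj_orth x : vdot (Pi x) (x1 E w) = 0.
Proof. by rewrite vdot_proj_l divfK ?subrr// gt_eqF// vdot_x1_gt0. Qed.

Lemma vdot_proj_le x : vdot (Pi x) (Pi x) <= vdot x x.
Proof.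
rewrite vdot_proj_l [vdot (x1 E w) (Pi x)]vdotC proj_orth mulr0 subr0.
rewrite vdotC vdot_proj_l -[leRHS]subr0 lerD2l lerN2.
by rewrite [vdot (x1 E w) x]vdotC mulrAC -expr2 divr_ge0 ?sqr_ge0// ltW// vdot_x1_gt0.
Qed.

(** Rescaling turns [x1] into the constant 1, so the projection only shifts the rescaled vector by a
    constant. *)
Lemma proj_resc x u v : resc (Pi x) u - resc (Pi x) v = resc x u - resc x v.
Proof.
rewrite /resc /proj_x1 /x1; field.
by rewrite ?gt_eqF ?W0 ?vdot_x1_gt0// -/(x1 E w).
Qed.

Lemma discrepancy_ge0 x : 0 <= discrepancy E w x.
Proof.
rewrite /discrepancy divr_ge0//; last by apply: sumr_ge0 => u _; rewrite sqr_ge0.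
apply: sumr_ge0 => e eE; rewrite mulr_ge0 ?(edge_weight_ge0 HE)//.
by apply: bigmax_ge_id.
Qed.

Lemma gamma2_ge0 : 0 <= gamma2 E w.
Proof.
rewrite /gamma2; set A := (X in inf X).
(* The default value of [inf] on the empty set is 0. *)
have [->|/set0P A0] := eqVneq A set0; first by rewrite inf0.
by apply: lb_le_inf => // _ [x _ <-]; exact: discrepancy_ge0.
Qed.

Lemma gamma2_le x : vdot x (x1 E w) = 0 ->
  gamma2 E w * vdot x x <= \sum_(e in E) w e *
     \big[Num.max/0]_(u in e) \big[Num.max/0]_(v in e) (resc x u - resc x v) ^+ 2.
Proof.
move=> xx1; have [x0|x0] := eqVneq (vdot x x) 0.
  rewrite x0 mulr0; apply: sumr_ge0 => e eE; rewrite mulr_ge0 ?(edge_weight_ge0 HE)//.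
  exact: bigmax_ge_id.
have xp : 0 < vdot x x by rewrite lt_neqAle eq_sym x0 vdot_ge0.
rewrite -ler_pdivlMr//.
have -> : vdot x x = \sum_u x u ^+ 2 by apply: eq_bigr => u _; rewrite expr2.
apply: ge_inf; first by exists 0 => _ [y _ <-]; exact: discrepancy_ge0.
exists x => //; split => // x_0; move: x0; rewrite x_0 /vdot big1 ?eqxx// => v _.
by rewrite mul0r.
Qed.

(** As [L x] is orthogonal to [x1], [Pi x] may be replaced by [x] on the right, which gives the
    energy; its spreads are those of [Pi x] and bound the differences in the discrepancy ratio. *)
Lemma laplacian_coercive x :
  gamma2 E w * vdot (Pi x) (Pi x) <= vdot (Pi x) (L x).
Proof.
rewrite [leRHS]vdot_proj_l x1_laplacian mulr0 subr0 laplacian_dot.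
apply: (le_trans (gamma2_le (proj_orth x))).
apply: ler_sum => e eE; rewrite ler_wpM2l ?(edge_weight_ge0 HE)//.
have [[_ mx] [_ mn]] := (edge_maxP (resc x) (E0 eE), edge_minP (resc x) (E0 eE)).
apply: bigmax_le => [|u ue]; first exact: sqr_ge0.
apply: bigmax_le => [|v ve]; first exact: sqr_ge0.
rewrite proj_resc -[leLHS]real_normK ?num_real// lerXn2r ?nnegrE//.
  by rewrite /spread; have := mx u ue; have := mn u ue; lra.
rewrite /spread ler_norml.
have := mx u ue; have := mn u ue; have := mx v ve; have := mn v ve.
by move=> *; apply/andP; split; lra.
Qed.

Let spread_ge0 f e : e \in E -> 0 <= spread f e.
Proof.
move=> /E0 e0; have [[[u ue fu] _] [_ mn]] := (edge_maxP f e0, edge_minP f e0).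
by rewrite /spread subr_ge0 -fu mn.
Qed.

Let total_cost f := \sum_(e in E) w e * spread f e.

Let edges_cost_bounds f F : F \subset E -> 0 <= edges_cost w f F <= total_cost f.
Proof.
move=> FE.
have t0 e : e \in E -> 0 <= w e * spread f e.
  by move=> eE; rewrite mulr_ge0 ?spread_ge0 ?(edge_weight_ge0 HE).
apply/andP; split.
  by apply: sumr_ge0 => e eF; apply: t0; exact: (fintype.subsetP FE).
rewrite /total_cost (big_setID F) /= (finset.setIidPr FE) lerDl.
by apply: sumr_ge0 => e; rewrite inE => /andP[_]; exact: t0.
Qed.

(** At every stage both costs in the density lie between 0 and the total cost, and a set [P]
    containing [v] weighs at least [W v]. *)
Lemma rate_bound f v : `|rate E w f v| <= total_cost f / W v.
Proof.
have Wv : 0 < W v by exact: vweight_gt0 HE v.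
have C0 : 0 <= total_cost f.
  by have /andP[] := edges_cost_bounds f (fintype.subxx E) => /le_trans h /h.
have bound k A U F : F \subset E -> `|rate_rec E w f k A U F v| <= total_cost f / W v.
  elim: k A U F => [|k IH] A U F FE /=; first by rewrite normr0 divr_ge0// ltW.
  rewrite -/(stage_argmax (E := E) (w := w) f A U F); case: ifPn => [vP|_].
    set P := stage_argmax f A U F in vP *.
    have WP : W v <= set_weight E w P.
      rewrite /set_weight (bigD1 v)//= lerDl.
      by apply: sumr_ge0 => u _; rewrite ltW// (vweight_gt0 HE).
    have P0 : 0 < set_weight E w P by exact: lt_le_trans WP.
    have /andP[I0 IC] : 0 <= edges_cost w f (IX f A F P) <= total_cost f.
      apply: edges_cost_bounds; apply: fintype.subset_trans FE.
      by apply/fintype.subsetP => e; rewrite inE => /andP[].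
    have /andP[S0 SC] : 0 <= edges_cost w f (SX f F P) <= total_cost f.
      apply: edges_cost_bounds; apply: fintype.subset_trans FE.
      by apply/fintype.subsetP => e; rewrite inE => /andP[].
    rewrite /density normrM normfV (gtr0_norm P0) ler_pM ?invr_ge0 ?(ltW P0)//.
      by rewrite ler_norml; apply/andP; split; lra.
    by rewrite lef_pV2 ?posrE.
  by apply: IH; apply: fintype.subset_trans FE; exact: finset.subsetDl.
apply: bound; apply/fintype.subsetP => e; rewrite inE => /andP[]//.
Qed.

Lemma laplacian_bound (M : R) : 0 <= M ->
  exists K, 0 <= K /\
    forall x, (forall u, `|x u| <= M) -> forall v, `|L x v| <= K.
Proof.
move=> M0.
pose M' := \sum_u M / Num.sqrt (W u).
have M'0 : 0 <= M' by apply: sumr_ge0 => u _; rewrite divr_ge0// ltW.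
pose C := \sum_(e in E) w e * (2 * M').
have C0 : 0 <= C.
  by apply: sumr_ge0 => e eE; rewrite mulr_ge0 ?(edge_weight_ge0 HE)// mulr_ge0.
pose k v := Num.sqrt (W v) * (C / W v).
have k0 v : 0 <= k v.
  by rewrite mulr_ge0 ?(ltW (W0 v))// divr_ge0// ltW// (vweight_gt0 HE).
exists (\sum_v k v); split; first by apply: sumr_ge0 => v _.
move=> x xM v.
apply: (@le_trans _ _ (k v)); last first.
  by rewrite (bigD1 v)//= lerDl; apply: sumr_ge0 => u _.
rewrite /laplacian /laplacian_w -/(resc x) normrM normrN (gtr0_norm (W0 v)) /k.
rewrite ler_wpM2l ?(ltW (W0 v))//; apply: (le_trans (rate_bound _ _)).
rewrite ler_wpM2r ?invr_ge0 ?(ltW (vweight_gt0 HE v))//.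
apply: ler_sum => e eE; rewrite ler_wpM2l ?(edge_weight_ge0 HE)//.
have fM u : `|resc x u| <= M'.
  rewrite /resc normrM normfV (gtr0_norm (W0 u)).
  apply: (@le_trans _ _ (M / Num.sqrt (W u))).
    by rewrite ler_wpM2r ?invr_ge0 ?(ltW (W0 u)).
  by rewrite /M' (bigD1 u)//= lerDl; apply: sumr_ge0 => i _; rewrite divr_ge0// ltW.
have [[[u ue fu] _] [[u' ue' fu'] _]] := (edge_maxP (resc x) (E0 eE), edge_minP (resc x) (E0 eE)).
rewrite /spread -fu -fu'.
by have := fM u; have := fM u'; rewrite !ler_norml => /andP[? ?] /andP[? ?]; lra.
Qed.

End laplacian_facts.

(** * Decrease of the norm along a path *)

(** Compactness is used as near-covering with the parameter [rho] tending to 0 from the right;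
    halving the local radius [r] keeps both points within [r] of the centre. *)
Lemma heine_cantor (R : realType) (f : R -> R) (a b : R) (delta : R) :
  {within `[a, b], continuous f} -> 0 < delta ->
  exists2 rho, 0 < rho & forall s s', s \in `[a, b] -> s' \in `[a, b] ->
    `|s - s'| < rho -> `|f s - f s'| < delta.
Proof.
move=> cf d0.
pose P (rho s : R) := s \in `[a, b] -> forall s', s' \in `[a, b] ->
    `|s - s'| < rho -> `|f s - f s'| < delta.
have /compact_near_coveringP cov := @segment_compact R a b.
have : \forall rho \near 0^'+, `[a, b]%classic `<=` P rho.
  apply: cov => s /= sab.
  have d20 : 0 < delta / 2 by rewrite divr_gt0.
  move/subspace_continuousP : (cf) => cf'.
  have /cvgrPdist_lt/(_ _ d20) := cf' s sab.
  rewrite near_withinE => -[r /= r0 rP].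
  exists (ball s (r / 2), [set rho | 0 < rho < r / 2]).
    split => /=; first by apply: nbhsx_ballx; rewrite divr_gt0.
    by exists (r / 2) => /=; [rewrite divr_gt0|move=> x /=; rewrite sub0r normrN => + x0; rewrite (gtr0_norm x0) x0 => ->].
  move=> [y rho] /= [sy /andP[rho0 rhor]] yab s' s'ab ys'.
  rewrite /ball/= in sy.
  have h1 : `|f s - f y| < delta / 2.
    apply: rP => //; rewrite /ball/= (lt_le_trans sy)// ler_pdivrMr//; lra.
  have h2 : `|f s - f s'| < delta / 2.
    apply: rP => //; rewrite /ball/=.
    have -> : s - s' = (s - y) + (y - s') by ring.
    apply: (le_lt_trans (ler_normD _ _)); lra.
  have -> : f y - f s' = - (f s - f y) + (f s - f s') by ring.
  apply: (le_lt_trans (ler_normD _ _)); rewrite normrN; lra.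
case=> r /= r0 rP; exists (r / 2); first by rewrite divr_gt0.
move=> s s' sab s'ab ss'.
apply: (rP (r / 2) _ _ s) => //=.
  by rewrite sub0r normrN gtr0_norm ?divr_gt0// ltr_pdivrMr//; lra.
by rewrite divr_gt0.
Qed.

Lemma Rintegral_combination (R : realType) (V : Type) d (T : measurableType d)
    (mu : {measure set T -> \bar R}) (D : set T) (A : V -> R) (f : V -> T -> R)
    (r : seq V) :
  measurable D -> (forall v, mu.-integrable D (EFin \o f v)) ->
  mu.-integrable D (EFin \o (fun u => \sum_(v <- r) A v * f v u)) /\
  \int[mu]_(u in D) (\sum_(v <- r) A v * f v u) =
  \sum_(v <- r) A v * \int[mu]_(u in D) f v u.
Proof.
move=> mD intf; elim: r => [|v r [IH1 IH2]].
  under eq_Rintegral do rewrite big_nil.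
  rewrite big_nil Rintegral_cst// mul0r; split => //.
  rewrite /comp; under eq_fun do rewrite big_nil; exact: integrable0.
have intv : mu.-integrable D (EFin \o (fun u => A v * f v u)).
  exact: (integrableZl mD (A v) (intf v)).
split.
  have := integrableD mD intv IH1; congr (_.-integrable _ _).
  by apply/funext => u /=; rewrite big_cons EFinD.
rewrite big_cons -IH2 -RintegralZl//.
have <- := RintegralD mD intv IH1.
by apply: eq_Rintegral => u _; rewrite big_cons.
Qed.

Section Rintegral_interval.
Context {R : realType} {V : finType}.
Local Notation mu := (@lebesgue_measure R).

Lemma Rintegral_combination_ge (s s' c : R) (A : V -> R) (f : V -> R -> R) :
  s <= s' -> (forall v, mu.-integrable `]s, s'] (EFin \o f v)) ->
  (forall u, u \in `]s, s'] -> c <= \sum_v A v * f v u) ->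
  c * (s' - s) <= \sum_v A v * \int[mu]_(u in `]s, s']) f v u.
Proof.
move=> ss' intf cA.
have mI : measurable (`]s, s']%classic : set (measurableTypeR R)) by exact: measurable_itv.
have [intA <-] := Rintegral_combination A (index_enum V) mI intf.
have -> : c * (s' - s) = \int[mu]_(u in `]s, s']) c.
  rewrite Rintegral_cst//= lebesgue_measure_itv/= lte_fin.
  case: ltP => [_|]; first by rewrite -EFinB.
  by move=> s's; rewrite (le_anti (introT andP (conj ss' s's))) subrr.
apply: le_Rintegral => //.
apply/integrableP; split; first exact/measurable_EFinP.
by rewrite integral_cst//= lebesgue_measure_itv/=; case: ifP => _; rewrite ?mule0 ?ltry.
Qed.

End Rintegral_interval.

Section vdot_bounds.
Context {R : realType} {V : finType}.
Implicit Types (x y z : V -> R).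
Local Notation n := (#|V|%:R : R).

Lemma vdotDl x y z : vdot (fun v => x v + y v) z = vdot x z + vdot y z.
Proof. by rewrite /vdot -big_split; apply: eq_bigr => v _; rewrite mulrDl. Qed.

Lemma vdotBl x y z : vdot (fun v => x v - y v) z = vdot x z - vdot y z.
Proof. by rewrite /vdot -sumrB; apply: eq_bigr => v _; rewrite mulrBl. Qed.

Lemma vdot_norm_le x y (p q : R) : 0 <= p -> (forall v, `|x v| <= p) ->
  (forall v, `|y v| <= q) -> `|vdot x y| <= n * (p * q).
Proof.
move=> p0 xp yq; apply: (le_trans (ler_norm_sum _ _ _)).
apply: (@le_trans _ _ (\sum_(v : V) p * q)).
  by apply: ler_sum => v _; rewrite normrM ler_pM.
by rewrite sumr_const mulr_natl.
Qed.

Lemma vdot_sub_sqr x y : vdot x x - vdot y y =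
  vdot (fun v => x v - y v) (fun v => x v + y v).
Proof. by rewrite /vdot -sumrB; apply: eq_bigr => v _; ring. Qed.

End vdot_bounds.

Section step.
Context {R : realType} {V : finType} {E : {set {set V}}} {w : {set V} -> R}.
Hypothesis HE : weighted_hypergraph E w.
Implicit Types (x y z : V -> R).
Local Notation n := (#|V|%:R : R).
Local Notation Pi := (proj_x1 E w).
Local Notation L := (laplacian E w).
Local Notation g := (gamma2 E w).
Local Notation mu := (@lebesgue_measure R).

Lemma projD x y : Pi (fun v => x v + y v) = (fun v => Pi x v + Pi y v).
Proof. by apply/funext => v; rewrite /proj_x1 vdotDl; ring. Qed.

Lemma projB x y : Pi (fun v => x v - y v) = (fun v => Pi x v - Pi y v).
Proof. by apply/funext => v; rewrite /proj_x1 vdotBl; ring. Qed.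

Lemma proj_proj x : Pi (Pi x) = Pi x.
Proof. by apply/funext => v; rewrite {1}/proj_x1 (proj_orth HE) !mul0r subr0. Qed.

Lemma vdot_proj_proj x y : vdot (Pi x) (Pi y) = vdot (Pi x) y.
Proof.
rewrite vdotC vdot_proj_l [vdot (x1 E w) (Pi x)]vdotC (proj_orth HE) mulr0 subr0.
by rewrite vdotC.
Qed.

Lemma proj_norm_le x (p : R) : (forall v, `|x v| <= p) ->
  forall v, `|Pi x v| <= n * p.
Proof.
move=> xp v.
have n1 : 1 <= n by rewrite ler1n (leq_trans _ (two_vertices HE)).
have p0 : 0 <= p by exact: le_trans (xp v).
rewrite -[leRHS]ger0_norm ?mulr_ge0// -ler_sqr ?nnegrE ?normr_ge0// !real_normK ?num_real//.
apply: (@le_trans _ _ (vdot (Pi x) (Pi x))).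
  rewrite /vdot (bigD1 v)//= -expr2 lerDl.
  by apply: sumr_ge0 => u _; rewrite -expr2 sqr_ge0.
apply: (le_trans (vdot_proj_le HE x)).
apply: (le_trans (ler_norm _)); apply: (le_trans (vdot_norm_le p0 xp xp)).
rewrite exprMn -expr2 ler_wpM2r ?sqr_ge0//.
by rewrite expr2 ler_peMl// (le_trans _ n1).
Qed.

(* |y'|^2 - |y|^2 = - <y' + y, y - y'> with y - y' = int L(x_u) du, and
   y' + y is close to 2 Pi x_u on a short interval: neither Ito calculus nor
   continuity of the Laplacian is needed. *)
Lemma vdot_proj_step (x : R -> V -> R) (D y : V -> R) (s s' M K delta : R) :
  s <= s' -> 0 <= delta -> delta <= M -> 0 <= K ->
  (forall u, u \in `[s, s'] -> forall v, `|x u v| <= M) ->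
  (forall u, u \in `[s, s'] -> forall v, `|L (x u) v| <= K) ->
  (forall u, u \in `[s, s'] -> forall v, `|x u v - x s v| <= delta) ->
  (forall u, u \in `[s, s'] -> forall v, `|x s' v - x u v| <= delta) ->
  (forall v, `|D v| <= delta) ->
  (forall v, mu.-integrable `]s, s'] (EFin \o (fun u => L (x u) v))) ->
  (forall v, x s' v = x s v - \int[mu]_(u in `]s, s']) L (x u) v + D v) ->
  y = Pi (fun v => x s v + D v) ->
  vdot (Pi (x s')) (Pi (x s')) <= (1 - 2 * g * (s' - s)) * vdot y y +
    (s' - s) * ((n * (n * 3 * K) + 2 * g * (n * (n * 2 * (n * (3 * M))))) * delta).
Proof.
move=> ss' d0 dM K0 xM LK xs xs' Dd intL xE yE.
set C := n * (n * 3 * K) + _.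
pose a v := x s v + D v.
pose I v := \int[mu]_(u in `]s, s']) L (x u) v.
have xsE : x s' = (fun v => a v - I v) by apply/funext => v; rewrite xE /a /I; ring.
have g0 : 0 <= g by exact: gamma2_ge0 HE.
have n0 : 0 <= n by [].
have M0 : 0 <= M by exact: le_trans dM.
(* [Pi b] is the sum y' + y, where y' stands for [Pi (x s')]. *)
pose b v := x s' v + a v.
have eq1 : vdot (Pi (x s')) (Pi (x s')) = vdot y y - vdot (Pi b) I.
  suff : vdot (Pi (x s')) (Pi (x s')) - vdot y y = - vdot (Pi b) I by lra.
  rewrite vdot_sub_sqr -(vdot_proj_proj b I).
  have -> : (fun v => Pi (x s') v - y v) = (fun v => - Pi I v).
    by apply/funext => v; rewrite xsE projB yE -/a; ring.
  have -> : (fun v => Pi (x s') v + y v) = Pi b by rewrite /b projD yE.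
  by rewrite vdotC /vdot -sumrN; apply: eq_bigr => v _; ring.
(* Coercivity at [x u] is transferred to [b] and [y]. Replacing [b] by [2 x u] costs the first term
   of [C], through the bound [K] on the Laplacian; replacing [Pi (x u)] by [y] costs the second,
   through the bound [M] on the path. *)
have key u : u \in `]s, s'] ->
    2 * g * vdot y y - C * delta <= \sum_v Pi b v * L (x u) v.
  move=> us; have {}us : u \in `[s, s'] by apply: subset_itv_oc_cc us.
  have e1 v : `|b v - (x u v + x u v)| <= 3 * delta.
    have -> : b v - (x u v + x u v) = (x s' v - x u v) + ((x s v - x u v) + D v).
      by rewrite /b /a; ring.
    have h1 := xs' u us v; have h2 := xs u us v; have h3 := Dd v.
    rewrite distrC in h2.
    apply: (le_trans (ler_normD _ _)).
    by have := ler_normD (x s v - x u v) (D v); lra.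
  have e2 v : `|a v - x u v| <= 2 * delta.
    have -> : a v - x u v = (x s v - x u v) + D v by rewrite /a; ring.
    have h2 := xs u us v; have h3 := Dd v; rewrite distrC in h2.
    by apply: (le_trans (ler_normD _ _)); lra.
  have e3 v : `|a v + x u v| <= 3 * M.
    have h1 := xM u us v; have h3 := Dd v.
    have h2 : `|x s v| <= M by apply: xM; rewrite in_itv/= lexx ss'.
    apply: (le_trans (ler_normD _ _)).
    by have := ler_normD (x s v) (D v); rewrite /a; lra.
  have -> : \sum_v Pi b v * L (x u) v = vdot (Pi b) (L (x u)) by [].
  have -> : vdot (Pi b) (L (x u)) = 2 * vdot (Pi (x u)) (L (x u)) +
      vdot (Pi (fun v => b v - (x u v + x u v))) (L (x u)).
    by rewrite projB projD vdotBl vdotDl; ring.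
  have c1 := laplacian_coercive HE (x u).
  have c2 := vdot_norm_le (mulr_ge0 n0 (mulr_ge0 (ler0n _ 3) d0)) (proj_norm_le e1) (LK u us).
  have c3 := vdot_norm_le (mulr_ge0 n0 (mulr_ge0 (ler0n _ 2) d0)) (proj_norm_le e2) (proj_norm_le e3).
  have c4 : vdot y y - vdot (Pi (x u)) (Pi (x u)) <= n * (n * (2 * delta) * (n * (3 * M))).
    rewrite vdot_sub_sqr; apply: le_trans c3; apply: (le_trans (ler_norm _)).
    by rewrite yE -/a projB projD.
  have c5 := ler_wpM2l g0 c4.
  move: c2; rewrite ler_norml => /andP[c2 _].
  rewrite /C; set p := vdot (Pi (fun v => _)) _ in c2 *.
  set q := vdot (Pi (x u)) (L _) in c1 *.
  set r := vdot y y in c4 c5 *; set r' := vdot (Pi (x u)) (Pi (x u)) in c1 c4 c5.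
  have -> : 2 * g * r - (n * (n * 3 * K) + 2 * g * (n * (n * 2 * (n * (3 * M))))) * delta
    = 2 * (g * (r - r') - g * (n * (n * (2 * delta) * (n * (3 * M))))) + 2 * (g * r') - n * (n * (3 * delta) * K).
    by ring.
  lra.
have := Rintegral_combination_ge ss' intL key.
rewrite -[X in _ <= X]/(vdot (Pi b) I) eq1 => h.
rewrite mulrBl mul1r -addrA lerD2l; move: h; lra.
Qed.

End step.

Section paths.
Context {R : realType} {V : finType} {E : {set {set V}}} {w : {set V} -> R}.
Hypothesis HE : weighted_hypergraph E w.
Local Notation n := (#|V|%:R : R).
Local Notation Pi := (proj_x1 E w).
Local Notation L := (laplacian E w).
Local Notation g := (gamma2 E w).
Local Notation mu := (@lebesgue_measure R).

(** The inverse of 1 plus the sum of the inverses replaces a minimum, and remains positive for empty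
    [V]. *)
Lemma common_lower_bound (r : V -> R) : (forall v, 0 < r v) ->
  exists2 rho, 0 < rho & forall v, rho <= r v.
Proof.
move=> r0; pose S := 1 + \sum_v (r v)^-1.
have S0 : 0 < S by rewrite ltr_pwDl// sumr_ge0// => v _; rewrite invr_ge0 ltW.
exists S^-1; first by rewrite invr_gt0.
move=> v; rewrite -[leRHS]invrK lef_pV2 ?posrE ?invr_gt0//.
rewrite /S (bigD1 v)//= addrCA lerDl addr_ge0//.
by apply: sumr_ge0 => u _; rewrite invr_ge0 ltW.
Qed.

Lemma continuous_path_modulus (x : R -> V -> R) (t delta : R) :
  continuous_path x -> 0 <= t -> 0 < delta ->
  exists2 rho, 0 < rho & forall s s', s \in `[0, t] -> s' \in `[0, t] ->
    `|s - s'| < rho -> forall v, `|x s v - x s' v| < delta.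
Proof.
move=> cx t0 d0.
have cxv v : {within `[0, t], continuous (fun s => x s v)}.
  by apply: continuous_subspaceW (cx v) => s /=; rewrite !in_itv/= andbT => /andP[].
have /choice[r rP] v : exists r, 0 < r /\ forall s s', s \in `[0, t] -> s' \in `[0, t] ->
    `|s - s'| < r -> `|x s v - x s' v| < delta.
  by have [r r0 rP] := heine_cantor (cxv v) d0; exists r.
have [rho rho0 rhoP] := common_lower_bound (fun v => (rP v).1).
exists rho => // s s' st s't ss' v; apply: (rP v).2 => //.
exact: lt_le_trans ss' (rhoP v).
Qed.

Lemma continuous_path_bound (x : R -> V -> R) (t : R) :
  continuous_path x -> 0 <= t ->
  exists2 M, 1 <= M & forall s, s \in `[0, t] -> forall v, `|x s v| <= M.
Proof.
move=> cx t0.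
have cxv v : {within `[0, t], continuous (fun s => x s v)}.
  by apply: continuous_subspaceW (cx v) => s /=; rewrite !in_itv/= andbT => /andP[].
have /choice[M MP] v : exists M, 0 <= M /\ forall s, s \in `[0, t] -> `|x s v| <= M.
  have [c _ cP] := EVT_max t0 (cxv v); have [c' _ c'P] := EVT_min t0 (cxv v).
  exists (`|x c v| + `|x c' v|); split; first exact: addr_ge0.
  move=> s st; have h1 := cP s st; have h2 := c'P s st.
  have h3 := ler_norm (x c v); have h4 := ler_normr (x c' v) (- x c' v).
  have h5 : - x c' v <= `|x c' v| by rewrite -normrN ler_norm.
  have h6 : 0 <= `|x c v| by []. have h7 : 0 <= `|x c' v| by [].
  by rewrite ler_norml; apply/andP; split; lra.
exists (1 + \sum_v M v); first by rewrite lerDl sumr_ge0// => v _; exact: (MP v).1.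
move=> s st v; apply: (le_trans ((MP v).2 s st)).
rewrite (bigD1 v)//= addrCA lerDl addr_ge0// sumr_ge0// => u _; exact: (MP u).1.
Qed.

Lemma path_steps (x B : R -> V -> R) (eta t eps : R) :
  0 < t -> 0 < eps -> continuous_path x -> continuous_path B ->
  (forall s, 0 <= s -> forall v,
    mu.-integrable `[0, s] (EFin \o (fun u => L (x u) v))) ->
  (forall s, 0 <= s -> forall v,
    x s v = x 0 v - \int[mu]_(u in `[0, s]) L (x u) v + Num.sqrt eta * B s v) ->
  exists m0, forall m, (m0 <= m)%N -> (0 < m)%N -> forall k, (k < m)%N ->
    forall (h : R) (z : V -> R), h = t / m%:R ->
    z = (fun v => Pi (x (k%:R * h)) v +
      Num.sqrt eta * (B (k.+1%:R * h) v - B (k%:R * h) v)) ->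
    vdot (Pi (x (k.+1%:R * h))) (Pi (x (k.+1%:R * h))) <=
      expR (- (2 * g * h)) * vdot z z + h * eps.
Proof.
move=> t0 eps0 cx cB intL xE.
have [M M1 xM] := continuous_path_bound cx (ltW t0).
have M0 : 0 <= M by exact: le_trans M1.
have [K [K0 LK]] := laplacian_bound HE M0.
have g0 : 0 <= g by exact: gamma2_ge0 HE.
set C := n * (n * 3 * K) + 2 * g * (n * (n * 2 * (n * (3 * M)))).
have C0 : 0 <= C.
  by rewrite /C addr_ge0// !mulr_ge0// ?mulr_ge0// ?mulr_ge0// ?ltW.
have se0 : 0 <= Num.sqrt eta by exact: sqrtr_ge0.
pose delta := Num.min 1 (eps / (C + 1)).
have C10 : 0 < C + 1 by lra.
have d0 : 0 < delta by rewrite /delta lt_min ltr01 divr_gt0.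
have dM : delta <= M by apply: le_trans M1; rewrite /delta ge_min lexx.
have Cd : C * delta <= eps.
  apply: (@le_trans _ _ (C * (eps / (C + 1)))).
    by rewrite ler_wpM2l// /delta ge_min lexx orbT.
  by rewrite mulrA ler_pdivrMr// mulrC ler_pM2l//; lra.
have [r1 r10 r1P] := continuous_path_modulus cx (ltW t0) d0.
(* Increments of [B] this small stay below [delta] after multiplication by the square root of [eta];
   the added 1 covers [eta = 0]. *)
have dB0 : 0 < delta / (Num.sqrt eta + 1) by rewrite divr_gt0//; lra.
have [r2 r20 r2P] := continuous_path_modulus cB (ltW t0) dB0.
pose m0 := (Num.bound (t / r1) + Num.bound (t / r2))%N.
exists m0 => m m0m m_gt0 k km h z hE zE.
have mR : 0 < m%:R :> R by rewrite ltr0n.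
have h0 : 0 < h by rewrite hE divr_gt0.
have small r : 0 < r -> (Num.bound (t / r) <= m)%N -> h < r.
  move=> r0 bm; rewrite hE ltr_pdivrMr// mulrC -ltr_pdivrMr//.
  apply: (lt_le_trans (archi_boundP _)); first by rewrite divr_ge0 ?ltW.
  by rewrite ler_nat.
have hr1 : h < r1 by apply: small => //; apply: leq_trans m0m; exact: leq_addr.
have hr2 : h < r2 by apply: small => //; apply: leq_trans m0m; exact: leq_addl.
set s := k%:R * h in zE *; set s' := k.+1%:R * h in zE *.
have s0 : 0 <= s by rewrite /s mulr_ge0// ltW.
have ss'h : s' - s = h by rewrite /s' /s -natr1; ring.
have ss' : s <= s' by rewrite -subr_ge0 ss'h ltW.
have s't : s' <= t.
  rewrite /s' hE mulrA ler_pdivrMr// mulrC ler_pM2l// ler_nat//.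
have s'0 : 0 <= s' by exact: le_trans ss'.
have sub u : u \in `[s, s'] -> u \in `[0, t].
  rewrite !in_itv/= => /andP[su us']; rewrite (le_trans s0 su)/=.
  exact: le_trans us' s't.
have ss : s \in `[s, s'] by rewrite in_itv/= lexx.
have s's : s' \in `[s, s'] by rewrite in_itv/= lexx ss'.
pose D v := Num.sqrt eta * (B s' v - B s v).
have Dd v : `|D v| <= delta.
  rewrite /D normrM (ger0_norm se0).
  have : `|B s' v - B s v| < delta / (Num.sqrt eta + 1).
    by apply: r2P; rewrite ?sub// ss'h gtr0_norm.
  rewrite ltr_pdivlMr; last by lra.
  have : 0 <= `|B s' v - B s v| by [].
  set q := `|_ - _|; set e := Num.sqrt eta; rewrite mulrDr mulr1 mulrC; lra.
have dist u : u \in `[s, s'] -> `|u - s| < r1 /\ `|s' - u| < r1.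
  rewrite in_itv/= => /andP[su us'].
  rewrite !ger0_norm ?subr_ge0//; split; apply: le_lt_trans hr1; rewrite -ss'h; lra.
have int0 v := intL s' s'0 v.
have intLs v : mu.-integrable `]s, s'] (EFin \o (fun u => L (x u) v)).
  apply: integrableS (int0 v) => //= u /=; rewrite !in_itv/= => /andP[su ->].
  by rewrite (le_trans s0 (ltW su)).
have xs'E v : x s' v = x s v - \int[mu]_(u in `]s, s']) L (x u) v + D v.
  rewrite (xE s s0) (xE s' s'0) /D.
  have := @Rintegral_itvB R (fun u => L (x u) v) (BLeft 0) (BRight s') s (int0 v).
  rewrite !bnd_simp s0 ss' => /(_ isT isT) <-; ring.
have := @vdot_proj_step R V E w HE x D _ s s' M K delta ss' (ltW d0) dM K0
  (fun u us => xM u (sub u us)) (fun u us => LK _ (xM u (sub u us)))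
  _ _ Dd intLs xs'E erefl.
have p1 u : u \in `[s, s'] -> forall v, `|x u v - x s v| <= delta.
  move=> us v; apply: ltW; apply: r1P; rewrite ?sub//; exact: (dist u us).1.
have p2 u : u \in `[s, s'] -> forall v, `|x s' v - x u v| <= delta.
  move=> us v; apply: ltW; apply: r1P; rewrite ?sub//; exact: (dist u us).2.
move=> /(_ p1 p2); rewrite ss'h -/C => step.
apply: (le_trans step); apply: lerD; last by rewrite ler_wpM2l// ltW.
(* [y] is the projection of [z], in which the increment of [B] is left unprojected, so the norm of
   [y] is at most that of [z]. The remaining factor comes from 1 - u <= e^{-u}. *)
set y := Pi (fun v => x s v + D v).
have y0 : 0 <= vdot y y by exact: vdot_ge0.
have yz : vdot y y <= vdot z z.
  have -> : y = Pi z.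
    by rewrite zE (@projD R V E w (Pi (x s)) D) (proj_proj HE) -projD.
  exact: (vdot_proj_le HE).
apply: (@le_trans _ _ (expR (- (2 * g * h)) * vdot y y)).
  by rewrite ler_wpM2r//; have := expR_ge1Dx (- (2 * g * h)).
by rewrite ler_wpM2l// expR_ge0.
Qed.

End paths.

(** * Gaussian increments of arbitrary variance *)

Section scaling.
Context {R : realType}.
Local Notation mu := (@lebesgue_measure R).
Local Notation nu := (@normal_prob R 0 1).
Local Open Scope ereal_scope.

Lemma ge0_integral_scale (s : R) (f : R -> \bar R) : (0 < s)%R ->
  measurable_fun setT f -> (forall x, 0 <= f x) ->
  \int[mu]_x f x = s%:E * \int[mu]_x f (s * x)%R.
Proof.
move=> s0 mf f0.
have ms : measurable_fun [set: measurableTypeR R]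
    (fun x : measurableTypeR R => (s * x)%R : measurableTypeR R).
  exact: measurable_funM.
have [m1 [m1E m1I]] := pushforward_measureP mu ms.
pose m2 : {measure set (measurableTypeR R) -> \bar R} := mscale (NngNum (ltW s0)) m1.
have m2E A : m2 A = s%:E * m1 A by [].
have mum2 A : measurable A -> mu A = m2 A.
  move=> mA; apply: lebesgue_measure_unique => // _ [[a b]] _ <-.
  rewrite m2E m1E.
  have -> : (fun x : R => (s * x)%R) @^-1` `]a, b] = `](a / s)%R, (b / s)%R]%classic.
    by apply/seteqP; split => x /=; rewrite !in_itv/= ltr_pdivrMr// ler_pdivlMr// mulrC.
  rewrite [X in _ * X](lebesgue_measure_itv `](a / s)%R, (b / s)%R])/=.
  rewrite lebesgue_measure_itv/= !lte_fin ltr_pM2r ?invr_gt0//.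
  case: ifP => _; last by rewrite mule0.
  by rewrite -!EFinB -EFinM -mulrBl mulrC divfK ?gt_eqF.
transitivity (\int[m2]_x f x).
  by apply: eq_measure_integral => A mA _; exact: mum2.
rewrite ge0_integral_mscale//.
by congr (_ * _); exact: m1I.
Qed.

Lemma normal_prob_scale (s : R) (C : set R) : (0 < s)%R -> measurable C ->
  normal_prob 0 s C = nu ((fun g : R => s * g)%R @^-1` C).
Proof.
move=> s0 mC; rewrite /normal_prob integral_mkcond.
have mpC : measurable_fun setT ((fun x => (normal_pdf 0 s x)%:E) \_ C).
  apply/(measurable_restrictT _ _).1 => //; apply/measurable_EFinP.
  by apply: measurable_funTS; exact: measurable_normal_pdf.
have pC0 x : 0 <= ((fun x => (normal_pdf 0 s x)%:E) \_ C) x.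
  by rewrite patchE; case: ifP => // _; rewrite lee_fin normal_pdf_ge0.
rewrite (ge0_integral_scale s0 mpC pC0) [RHS]integral_mkcond.
rewrite -ge0_integralZl//; last 2 first.
- by apply: measurableT_comp => //; exact: measurable_funM.
- by rewrite lee_fin ltW.
apply: eq_integral => x _.
rewrite !patchE.
have -> : ((s * x)%R \in C) = (x \in (fun g : R => s * g)%R @^-1` C).
  by apply/idP/idP; rewrite !inE.
case: ifP => _; last by rewrite mule0.
rewrite -EFinM; congr EFin.
rewrite !normal_pdfE ?oner_eq0 ?gt_eqF// /normal_fun !subr0 mulrA; congr (_ * expR _)%R.
  rewrite /normal_peak expr1n mul1r -mulrnAr sqrtrM ?sqr_ge0// sqrtr_sqr gtr0_norm//.
  by rewrite invfM mulrA divff ?gt_eqF// mul1r.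
by rewrite expr1n; field; rewrite gt_eqF.
Qed.

End scaling.

Section independence.
Context {R : realType} {V : finType} d (Omega : measurableType d)
  (P : probability Omega R).
Local Open Scope ereal_scope.

Lemma gauss_indep_of_vector (G : set (set Omega)) (s c : R) (xi : Omega -> V -> R)
    d' (T : measurableType d') (Y : Omega -> T) (l : seq V) :
  (0 < s)%R -> indep_gaussian_vector P G s xi ->
  (forall A, measurable A -> G (Y @^-1` A)) -> uniq l ->
  gauss_indep P (fun v o => c * xi o v)%R (c * s)%R Y l.
Proof.
move=> s0 [mxi lawxi indep] GY ul A C mA mC.
pose f (g : R) := (c * g)%R.
have mfC v : measurable (f @^-1` C v).
  have mf : measurable_fun setT f by exact: measurable_funM.
  by rewrite -[X in measurable X]setTI; exact: mf.
pose A' (o : option V) := if o is Some v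
  then (fun omega => xi omega v) @^-1` (f @^-1` C v) else Y @^-1` A.
pose J := (None |: [set Some v | v in l])%SET.
have NJ : None \notin [set Some v | v in l]%SET by apply/imsetP => -[].
have := @indep J A'.
have -> : \bigcap_(i in [set` J]) A' i =
    Y @^-1` A `&` \big[setI/setT]_(v <- l) ((fun o => c * xi o v)%R @^-1` C v).
  rewrite -bigcap_seq; apply/seteqP; split => o /=.
    move=> H; split; first by apply: (H None); rewrite /= !inE.
    move=> v /= vl; apply: (H (Some v)); rewrite /= !inE.
    by apply/imsetP; exists v.
  move=> [HY H] [v|] //=; rewrite !inE /= => /imsetP[u ul' [->]].
  exact: (H u).
move=> ->; last first.
  move=> [v|] _ /=; last exact: GY.
  by exists (f @^-1` C v) => //; rewrite setTI.
rewrite big_setU1//= big_imset/=; last by move=> u v _ _ [].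
congr (_ * _); rewrite big_uniq//; apply: eq_bigr => v _.
by rewrite lawxi// normal_prob_scale//; congr (normal_prob _ _ _); apply/funext => g /=; rewrite /f mulrA.
Qed.

End independence.

(** * Comparison of a discrete chain with a Gaussian *)

Section chain.
Context {R : realType} {V : finType} d (Omega : measurableType d)
  (P : probability Omega R).
Local Open Scope ereal_scope.
Variables (N : nat) (Phi : R -> \bar R).
Hypotheses (VN : #|V| = N.+2) (tPhi : monotone_test Phi).

Lemma sum_sqr_vdot (x : V -> R) : (\sum_(v <- enum V) x v ^+ 2)%R = vdot x x.
Proof. by rewrite big_enum; apply: eq_bigr => v _; rewrite expr2. Qed.

Lemma gsqs_vdot (s : R) (x : V -> R) :
  gsqs s [seq x v | v <- enum V] Phi 0%R = radial s N.+1 Phi (vdot x x).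
Proof.
have sE : size [seq x v | v <- enum V] = N.+2 by rewrite size_map -cardE.
have s0 : (0 < size [seq x v | v <- enum V])%N by rewrite sE.
by rewrite (gsqs_radial0 _ _ _ tPhi s0) sE big_map sum_sqr_vdot.
Qed.

Lemma measurable_radial (s : R) : measurable_fun setT (radial s N.+1 Phi).
Proof.
have [mi i0 _ _] := monotone_test_iter_gsq s N.+1 Phi tPhi.
apply: (@measurable_gsq_param R _ R s Num.sqrt (fun=> 0%R) (fun=> iter N.+1 (gsq s 0) Phi)) => //.
- by apply: continuous_measurable_fun; exact: sqrt_continuous.
- exact: measurableT_comp.
Qed.

Lemma measurable_vdot d' (T : measurableType d') (x : T -> V -> R) :
  (forall v, measurable_fun setT (fun o => x o v)) ->
  measurable_fun setT (fun o => vdot (x o) (x o)).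
Proof.
move=> mx; rewrite /vdot; apply: measurable_sum => v.
exact: measurable_funM.
Qed.

Lemma integral_radial_gauss (G : set (set Omega)) (s tau a c : R)
    (Z xi : Omega -> V -> R) :
  sigma_algebra setT G -> G `<=` measurable ->
  (forall v C, measurable C -> G ((fun o => Z o v) @^-1` C)) ->
  (0 < tau)%R -> indep_gaussian_vector P G tau xi ->
  \int[P]_o radial s N.+1 Phi
    (vdot (fun v => a * Z o v + c * xi o v)%R (fun v => a * Z o v + c * xi o v)%R) =
  \int[P]_o radial (Num.sqrt (s ^+ 2 + (c * tau) ^+ 2)) N.+1 Phi
    (vdot (fun v => a * Z o v)%R (fun v => a * Z o v)%R).
Proof.
move=> sG Gm ZG tau0 ixi.
pose T := g_sigma_algebraType G.
(* With the identity into [Omega] equipped with [G] as conditioning variable, independence from [G]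
   becomes [gauss_indep], and [Z] is a function of this variable. *)
pose Y : Omega -> T := id.
have mGE (A : set T) : measurable A -> G A.
  by rewrite /measurable/= sigma_algebra_id.
have mY : measurable_fun setT Y.
  by move=> _ A mA; rewrite setTI; apply: Gm; exact: mGE.
have mz v : measurable_fun setT (fun o : T => a * Z o v)%R.
  apply: measurable_funM => // _ C mC; rewrite setTI.
  by apply: sub_sigma_algebra; exact: ZG.
have mxi v : measurable_fun setT (fun o => c * xi o v)%R.
  by apply: measurable_funM => //; case: ixi => m _ _; exact: m.
have ind : gauss_indep P (fun v o => c * xi o v)%R (c * tau)%R Y (enum V).
  by apply: gauss_indep_of_vector ixi _ _ => //; exact: enum_uniq.
have m0 : measurable_fun setT (fun _ : T => 0%R : R) by exact: measurable_cst.
have h := integral_gsqs_gauss_indep mxi s mY mz m0 tPhi (enum_uniq V) ind.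
apply: (eq_trans _ (eq_trans h _)); apply: eq_integral => o _.
  by rewrite -gsqs_vdot.
by rewrite -gsqs_vdot.
Qed.

(* Standard deviation of sigma G_0 + r (c G_1 + ... + c^j G_j). *)
Fixpoint chain_std (sigma c r : R) (j : nat) : R :=
  if j is j'.+1 then Num.sqrt (chain_std sigma c r j' ^+ 2 + (c ^+ j * r) ^+ 2)
  else sigma.

Lemma chain_std_ge (sigma c r : R) j : (0 <= sigma)%R -> (sigma <= chain_std sigma c r j)%R.
Proof.
move=> s0; elim: j => //= j IH.
rewrite -[leLHS]ger0_norm// -sqrtr_sqr ler_sqrt ?addr_ge0 ?sqr_ge0//.
apply: (@le_trans _ _ (chain_std sigma c r j ^+ 2)%R).
  by rewrite ler_sqr ?nnegrE// (le_trans s0).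
by rewrite lerDl sqr_ge0.
Qed.

Lemma ge0_integralD_cst (f : Omega -> \bar R) (D : R) :
  measurable_fun setT f -> (forall o, 0 <= f o) -> (0 <= D)%R ->
  \int[P]_o (f o + D%:E) = \int[P]_o f o + D%:E.
Proof.
move=> mf f0 D0; rewrite ge0_integralD//.
by rewrite integral_cst//= probability_setT mule1.
Qed.

Variables (F : nat -> set (set Omega)) (sigma c e tau delta : R) (m : nat)
  (Z xi : nat -> Omega -> V -> R).
Hypotheses (sF : forall k, sigma_algebra setT (F k)) (Fm : forall k, F k `<=` measurable).
Hypothesis ZF : forall k v C, measurable C -> F k ((fun o => Z k o v) @^-1` C).
Hypotheses (sigma0 : (0 < sigma)%R) (c01 : (0 <= c <= 1)%R) (tau0 : (0 < tau)%R)
  (delta0 : (0 <= delta)%R).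
Hypothesis ixi : forall k, indep_gaussian_vector P (F k) tau (xi k).
Hypothesis Zstep : forall k, (k < m)%N -> forall o,
  (vdot (Z k.+1 o) (Z k.+1 o) <= c ^+ 2 *
     vdot (fun v => Z k o v + e * xi k o v) (fun v => Z k o v + e * xi k o v) + delta)%R.

Let S := chain_std sigma c (e * tau).

(** The integrand at index [k] is a value function: the [m - k] steps still to come contract by [c]
    to that power and contribute the noise contained in [S (m - k)]. Each step of the chain adds at
    most delta / (2 sigma^2). *)
Lemma integral_chain k : (k <= m)%N ->
  \int[P]_o radial (S (m - k)) N.+1 Phi (c ^+ (m - k) ^+ 2 * vdot (Z k o) (Z k o)) <=
  \int[P]_o radial (S m) N.+1 Phi (c ^+ m ^+ 2 * vdot (Z 0 o) (Z 0 o)) +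
    (k%:R * (delta / (2 * sigma ^+ 2)))%:E.
Proof.
elim: k => [|k IH] km; first by rewrite subn0 mul0r adde0.
apply: (@le_trans _ _ (\int[P]_o radial (S (m - k)) N.+1 Phi
    (c ^+ (m - k) ^+ 2 * vdot (Z k o) (Z k o)) +
    (delta / (2 * sigma ^+ 2))%:E)); last first.
  apply: (@le_trans _ _ (\int[P]_o radial (S m) N.+1 Phi (c ^+ m ^+ 2 * vdot (Z 0 o) (Z 0 o)) +
    (k%:R * (delta / (2 * sigma ^+ 2)))%:E + (delta / (2 * sigma ^+ 2))%:E)).
    by rewrite leeD2r// IH// ltnW.
  set D := (delta / _)%R.
  have -> : (k.+1%:R * D = k%:R * D + D)%R by rewrite -[k.+1%:R]natr1 mulrDl mul1r.
  by rewrite EFinD addeA.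
have mkE : (m - k = (m - k.+1).+1)%N by rewrite subnSK.
rewrite mkE; set j := (m - k.+1)%N.
have /andP[c0 c1] := c01.
have Sj : (sigma <= S j)%R by apply: chain_std_ge; exact: ltW.
have Sj0 : (0 < S j)%R by exact: lt_le_trans Sj.
have mZ i v : measurable_fun setT (fun o => Z i o v).
  by move=> _ C mC; rewrite setTI; exact: (@Fm i _ (@ZF i v C mC)).
have mxi i v : measurable_fun setT (fun o => xi i o v).
  by have [mx _ _] := ixi i; exact: mx.
(* The contraction of step [k] is included in the coefficients, so [q] is an adapted vector plus an
   independent Gaussian, ready for [integral_radial_gauss]. *)
pose q o v := (c ^+ j.+1 * Z k o v + c ^+ j.+1 * e * xi k o v)%R.
have mq : measurable_fun setT (fun o => vdot (q o) (q o)).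
  by apply: measurable_vdot => v; apply: measurable_funD; apply: measurable_funM.
have d0 : (0 <= delta / (2 * sigma ^+ 2))%R.
  by rewrite divr_ge0// mulr_ge0// sqr_ge0.
apply: (@le_trans _ _ (\int[P]_o (radial (S j) N.+1 Phi (vdot (q o) (q o)) +
    (delta / (2 * sigma ^+ 2))%:E))).
  apply: ge0_le_integral => //.
  - by move=> o _; exact: radial_ge0.
  - apply: (measurableT_comp (measurable_radial (S j))).
    by apply: measurable_funM => //; exact: measurable_vdot.
  - apply: emeasurable_funD => //.
    exact: (measurableT_comp (measurable_radial (S j))).
  move=> o _.
  have qE : vdot (q o) (q o) = (c ^+ j ^+ 2 * (c ^+ 2 *
     vdot (fun v => Z k o v + e * xi k o v) (fun v => Z k o v + e * xi k o v)))%R.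
    rewrite /vdot !mulr_sumr; apply: eq_bigr => v _.
    by rewrite /q exprS; ring.
  apply: (@le_trans _ _ (radial (S j) N.+1 Phi (vdot (q o) (q o) + c ^+ j ^+ 2 * delta)%R)).
    apply: radial_le => //.
      rewrite mulr_ge0 ?sqr_ge0//; apply: sumr_ge0 => v _.
      by rewrite -expr2 sqr_ge0.
    by rewrite qE -mulrDr ler_wpM2l ?sqr_ge0// Zstep.
  apply: (le_trans (radialD_le _ _ _ _ _ Sj0 tPhi _ _)).
  - by apply: sumr_ge0 => v _; rewrite -expr2 sqr_ge0.
  - by rewrite mulr_ge0// sqr_ge0.
  (* [c <= 1] and [sigma <= S j] make the cost independent of the step. *)
  rewrite leeD2l// lee_fin; apply: ler_pM.
  - by rewrite mulr_ge0// sqr_ge0.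
  - by rewrite invr_ge0 mulr_ge0// sqr_ge0.
  - by rewrite ler_piMl// exprn_ile1// ?exprn_ge0// exprn_ile1.
  rewrite lef_pV2 ?posrE ?mulr_gt0 ?exprn_gt0// ler_pM2l//.
  by rewrite ler_sqr ?nnegrE ?(ltW sigma0) ?(ltW Sj0).
have mr : measurable_fun setT (fun o => radial (S j) N.+1 Phi (vdot (q o) (q o))).
  exact: (measurableT_comp (measurable_radial (S j))).
rewrite (ge0_integralD_cst mr (fun o => radial_ge0 _ _ _ _ tPhi) d0).
apply: leeD (lexx _).
rewrite le_eqVlt; apply/orP; left; apply/eqP.
apply: (eq_trans (integral_radial_gauss (S j) (c ^+ j.+1) (c ^+ j.+1 * e)
  (sF k) (@Fm k) (@ZF k) tau0 (ixi k))).
have vE o : vdot (fun v => c ^+ j.+1 * Z k o v)%R (fun v => c ^+ j.+1 * Z k o v)%R =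
    (c ^+ j.+1 ^+ 2 * vdot (Z k o) (Z k o))%R.
  by rewrite /vdot mulr_sumr; apply: eq_bigr => v _; ring.
have sE : (c ^+ j.+1 * e * tau = c ^+ j.+1 * (e * tau))%R by rewrite mulrA.
by apply: eq_integral => o _; rewrite vE sE.
Qed.

End chain.

(** * Limits of probabilities and thresholds *)

Section limits.
Context {R : realType} d (Omega : measurableType d) (P : probability Omega R).
Local Open Scope ereal_scope.

Lemma probability_lim_sup_set (E : (set Omega)^nat) :
  (forall k, measurable (E k)) ->
  P (\bigcup_(k >= n) E k) @[n --> \oo] --> P (lim_sup_set E).
Proof.
move=> mE; apply: lim_sup_set_cvg => //.
apply: (@le_lt_trans _ _ 1); last exact: ltry.
by apply: probability_le1; apply: bigcup_measurable => k _; exact: mE.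
Qed.

(** Reverse Fatou for events. It takes the place of a weak limit when both the threshold and the
    variance vary along the sequence. *)
Lemma le_probability_limsup (E : (set Omega)^nat) (A : set Omega) (x : \bar R)
    (e : R^nat) :
  (forall k, measurable (E k)) -> measurable A ->
  lim_sup_set E `<=` A -> e @ \oo --> (0 : R)%R ->
  (forall k, x <= P (E k) + (e k)%:E) -> x <= P A.
Proof.
move=> mE mA EA e0 xE.
have mG n : measurable (\bigcup_(k >= n) E k) by exact: bigcup_measurable.
have cvg : (P (\bigcup_(k >= n) E k) + (e n)%:E) @[n --> \oo] --> P (lim_sup_set E) + 0%:E.
  apply: cvgeD; first by rewrite fin_num_adde_defl.
    exact: probability_lim_sup_set.
  by apply/fine_cvgP; split; [exact: nearW | exact: e0].
rewrite adde0 in cvg.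
have mL : measurable (lim_sup_set E).
  by apply: bigcap_measurable => // n _; exact: mG.
apply: (@le_trans _ _ (P (lim_sup_set E))); last by apply: le_measure; rewrite ?inE.
rewrite -(cvg_lim _ cvg)//; apply: lime_ge; first exact: cvgP cvg.
apply: nearW => n; apply: (le_trans (xE n)); rewrite leeD2r//.
by apply: le_measure; rewrite ?inE//; apply: bigcup_sup => /=.
Qed.

(** The tail unions decrease to [lim_sup_set E], which is null. A mesh depending on the path thus
    becomes a deterministic one, up to probability [q]. *)
Lemma probability_eventually (E : (set Omega)^nat) :
  (forall k, measurable (E k)) ->
  {ae P, forall o, exists m0, forall m, (m0 <= m)%N -> ~ E m o} ->
  forall q : R, (0 < q)%R -> exists m0, forall m, (m0 <= m)%N -> P (E m) <= q%:E.
Proof.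
move=> mE aeE q q0.
have mL : measurable (lim_sup_set E).
  by apply: bigcap_measurable => // n _; exact: bigcup_measurable.
have L0 : P (lim_sup_set E) = 0.
  apply/eqP; rewrite eq_le measure_ge0 andbT.
  have [N [mN N0 sub]] := aeE; rewrite -N0; apply: le_measure; rewrite ?inE//.
  apply: subset_trans sub => o /= Lo [m0 H].
  by have [m /= m0m Emo] := Lo m0 I; exact: H m0m Emo.
have := probability_lim_sup_set mE; rewrite L0.
move/fine_cvgP => [_ /cvgrPdist_le /(_ q q0) [m0 _ H]].
exists m0 => m m0m.
have mG : measurable (\bigcup_(k >= m) E k) by exact: bigcup_measurable.
apply: (@le_trans _ _ (P (\bigcup_(k >= m) E k))).
  by apply: le_measure; rewrite ?inE//; apply: bigcup_sup => /=.
have := H m m0m; rewrite /= sub0r normrN => h.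
rewrite -[leLHS]fineK ?fin_num_measure// lee_fin.
exact: le_trans (ler_norm _) h.
Qed.

End limits.

Section threshold.
Context {R : realType}.
Local Notation nu := (@normal_prob R 0 1).
Local Open Scope ereal_scope.

Definition above (b t : R) : \bar R := ((b <= t)%R%:R)%:E.

Lemma aboveE (b t : R) : above b t = (\1_`[b, +oo[ t)%:E.
Proof. by rewrite /above indicE mem_setE in_itv/= andbT. Qed.

Lemma monotone_test_above (b : R) : monotone_test (above b).
Proof.
split.
- have -> : above b = EFin \o \1_`[b, +oo[ by apply/funext => t; exact: aboveE.
  by apply/measurable_EFinP; exact: measurable_indic.
- by move=> t; rewrite lee_fin ler0n.
- by move=> t; rewrite lee_fin lern1 leq_b1.
- move=> t u tu; rewrite lee_fin ler_nat.
  by case: leP => //= bt; rewrite (le_trans bt tu).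
Qed.

Lemma measurable_superlevel d (T : measurableType d) (f : T -> R) (b : R) :
  measurable_fun setT f -> measurable [set o | (b <= f o)%R].
Proof.
move=> mf; have := mf measurableT `[b, +oo[%classic (measurable_itv _).
rewrite setTI; rewrite (_ : _ @^-1` _ = [set o | (b <= f o)%R])//.
by apply/seteqP; split => o /=; rewrite in_itv/= andbT.
Qed.

Lemma integral_above d (T : measurableType d) (m : {measure set T -> \bar R})
    (b : R) (f : T -> R) : measurable_fun setT f ->
  \int[m]_o above b (f o) = m [set o | (b <= f o)%R].
Proof.
move=> mf; rewrite -[[set o | _]]setIT -integral_indic//; last exact: measurable_superlevel.
apply: eq_integral => o _; rewrite /above indicE; congr ((nat_of_bool _)%:R%:E)%R.
by apply/idP/idP; rewrite inE.
Qed.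

Lemma gsq_s0 (x : R) (Phi : R -> \bar R) rho : gsq 0 x Phi rho = Phi (rho + x ^+ 2)%R.
Proof.
rewrite /gsq; under eq_integral do rewrite mul0r addr0.
by rewrite integral_cst//= probability_setT mule1.
Qed.

Lemma radial_s0 N (Phi : R -> \bar R) t : (0 <= t)%R -> radial 0 N Phi t = Phi t.
Proof.
move=> t0; rewrite /radial gsq_s0 add0r sqr_sqrtr//.
by elim: N t t0 => //= N IH t t0; rewrite gsq_s0 expr0n addr0 IH.
Qed.

Lemma le_iter_gsq0 (s : R) N (Phi : R -> \bar R) t : monotone_test Phi ->
  Phi t <= iter N (gsq s 0) Phi t.
Proof.
move=> tP; elim: N t => //= N IH t.
have [mi i0 i1 ih] := monotone_test_iter_gsq s N Phi tP.
apply: (le_trans (IH t)).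
have -> : iter N (gsq s 0) Phi t = \int[nu]_g (iter N (gsq s 0) Phi t).
  by rewrite integral_cst//= probability_setT mule1.
apply: ge0_le_integral => //.
- apply: measurableT_comp => //; apply: measurable_funD => //.
  apply: measurable_funX; apply: measurable_funD => //; exact: measurable_funM.
- by move=> g _; apply: ih; rewrite lerDl sqr_ge0.
Qed.

(* For |g| <= L one has (beta + s g)^2 >= (beta - q)^2 whenever s L <= q <= beta. *)
Lemma radial_above_ge (s q beta L : R) N : (0 <= s)%R -> (0 <= beta)%R -> (s * L <= q)%R ->
  nu `[(- L)%R, L] <= radial s N (above (Num.max 0 (beta - q) ^+ 2)%R) (beta ^+ 2).
Proof.
move=> s0 b0 sLq; set b' := (Num.max 0 (beta - q) ^+ 2)%R.
have tP := monotone_test_above b'.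
have [mP _ _ _] := tP.
have [mi i0 _ _] := monotone_test_iter_gsq s N _ tP.
rewrite /radial sqrtr_sqr ger0_norm//.
have mI : measurable (`[(- L)%R, L]%classic : set R) by exact: measurable_itv.
rewrite -[X in nu X]setIT -integral_indic//.
apply: ge0_le_integral => //.
- by apply/measurable_EFinP; exact: measurable_indic.
- apply: measurableT_comp => //; apply: measurable_funD => //.
  apply: measurable_funX; apply: measurable_funD => //; exact: measurable_funM.
move=> g _; apply: (@le_trans _ _ (above b' (0 + (beta + s * g) ^+ 2)%R)); last exact: le_iter_gsq0.
rewrite add0r /above lee_fin indicE ler_nat mem_setE in_itv/=.
case: (boolP (- L <= g <= L)%R) => //= /andP[Lg gL].
rewrite lt0b; have h1 : (- q <= s * g)%R.
  by rewrite lerNl -mulrN; apply: le_trans sLq; rewrite ler_wpM2l// lerNl.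
rewrite /b'; case: (lerP 0%R (beta - q)%R) => h2; last by rewrite expr0n sqr_ge0.
by rewrite ler_sqr ?nnegrE//; lra.
Qed.

End threshold.

(** * Variance of the chain and Ornstein-Uhlenbeck variance *)

Section ou_limit.
Context {R : realType}.
Implicit Types (sigma c r g eta t h : R).

Lemma chain_std_sqr sigma c r j :
  chain_std sigma c r j ^+ 2 = sigma ^+ 2 + r ^+ 2 * \sum_(i < j) (c ^+ 2) ^+ i.+1.
Proof.
elim: j => [|j IH] /=; first by rewrite big_ord0 mulr0 addr0.
rewrite sqr_sqrtr ?addr_ge0 ?sqr_ge0// IH big_ord_recr /= mulrDr addrA.
by congr (_ + _); rewrite exprMn mulrC -!exprM mulnC.
Qed.

(* The Riemann sum h (e^{-2gh} + ... + e^{-2gt}) of the decreasing function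
   e^{-2gs} on [0, t]. *)
Lemma chain_std_ou sigma g eta t (m : nat) : 0 <= g -> 0 <= eta -> 0 < t -> (0 < m)%N ->
  let h := t / m%:R in
  `|chain_std sigma (expR (- (g * h))) (Num.sqrt eta * Num.sqrt h) m ^+ 2
     - (sigma ^+ 2 + ou_variance g eta t)| <= eta * h.
Proof.
move=> g0 eta0 t0 m0 /=.
set h := t / m%:R.
have mR : 0 < m%:R :> R by rewrite ltr0n.
have h0 : 0 < h by rewrite divr_gt0.
have hm : h * m%:R = t by rewrite /h divfK// gt_eqF.
rewrite chain_std_sqr exprMn !sqr_sqrtr// ?(ltW h0)//.
set rho := expR (- (g * h)) ^+ 2.
have rhoE : rho = expR (- (2 * g * h)).
  by rewrite /rho -expRM_natl; congr expR; ring.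
rewrite opprD addrACA subrr add0r /ou_variance.
(* For [g = 0] all terms of the Riemann sum are 1 and the sum is exact. *)
have [gz|gn0] := eqVneq g 0.
  have -> : rho = 1 by rewrite rhoE gz mulr0 mul0r oppr0 expR0.
  under eq_bigr do rewrite expr1n.
  have -> : eta * h * \sum_(i < m) 1 = eta * t.
    by rewrite sumr_const card_ord -mulrA hm.
  by rewrite subrr normr0; apply: mulr_ge0 => //; exact: ltW.
have gp : 0 < g by rewrite lt_neqAle eq_sym gn0.
set u := 2 * g * h in rhoE.
have u0 : 0 < u by apply: mulr_gt0 => //; apply: mulr_gt0.
have r0 : 0 < rho by rewrite rhoE expR_gt0.
have r1 : rho < 1 by rewrite rhoE -expR0 ltr_expR oppr_lt0.
(* [u * rho <= 1 - rho <= u] expresses that, on one mesh interval, the integral of e^{-2gs} lies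
   between [h] times its two endpoint values. *)
have ru : 1 - rho <= u by rewrite rhoE; have := expR_ge1Dx (- u); lra.
have ur : u * rho <= 1 - rho.
  have : (1 + u) * rho <= 1.
    rewrite rhoE -[leRHS](expR0) -[in leRHS](subrr u) expRD ler_pM2r ?expR_gt0//.
    exact: expR_ge1Dx.
  lra.
have rm : rho ^+ m = expR (- (2 * g * t)).
  rewrite rhoE -expRM_natr; congr expR; rewrite /u -hm; ring.
have geo : (1 - rho) * \sum_(i < m) rho ^+ i.+1 = rho * (1 - rho ^+ m).
  under eq_bigr do rewrite exprS.
  rewrite -mulr_sumr mulrCA; congr (_ * _).
  have := subrX1 rho m; set A := \sum_(i < m) _; lra.
set Sm := \sum_(i < m) _ in geo *.
set D := 1 - expR _.
have DE : 1 - rho ^+ m = D by rewrite rm.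
have D0 : 0 <= D by rewrite /D subr_ge0 -expR0 ler_expR oppr_le0 !mulr_ge0// ltW.
have D1 : D <= 1 by rewrite /D; have := expR_ge0 (- (2 * g * t)); lra.
have r1' : 0 < 1 - rho by lra.
have SmE : Sm = rho * D / (1 - rho).
  by apply: (mulfI (lt0r_neq0 r1')); rewrite geo DE mulrCA divff ?mulr1// gt_eqF.
have up : h * Sm <= D / (2 * g).
  rewrite SmE mulrA ler_pdivrMr// [leRHS]mulrAC ler_pdivlMr ?mulr_gt0//.
  have -> : h * (rho * D) * (2 * g) = D * (u * rho) by rewrite /u; ring.
  by rewrite ler_wpM2l.
have lo : D / (2 * g) - h <= h * Sm.
  have key : D / (2 * g) * (1 - rho) <= h * (rho * D) + h * (1 - rho).
    rewrite [leLHS]mulrAC ler_pdivrMr ?mulr_gt0//.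
    have -> : (h * (rho * D) + h * (1 - rho)) * (2 * g) = u * (rho * D + (1 - rho)) by rewrite /u; ring.
    apply: (@le_trans _ _ (D * u)); first by rewrite ler_wpM2l.
    rewrite mulrC ler_wpM2l ?(ltW u0)//.
    have := ler_wpM2l (ltW r1') D1; lra.
  rewrite SmE mulrA -(ler_pM2r r1') divfK ?gt_eqF//; lra.
have -> : eta * h * Sm - eta / (2 * g) * D = eta * (h * Sm - D / (2 * g)).
  by field; rewrite gt_eqF.
rewrite normrM ger0_norm// ler_wpM2l// ler_norml; apply/andP; split; lra.
Qed.

End ou_limit.

(** * The product sigma-algebra and equality of laws *)

Section laws.
Context {R : realType} {V : finType}.
Local Open Scope ereal_scope.

Definition borelV := g_sigma_algebraType (@vborel R V).

Lemma measurable_coord (v : V) : measurable_fun setT (fun y : borelV => y v : R).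
Proof.
move=> _ C mC; rewrite setTI; apply: sub_sigma_algebra.
by apply: sub_sigma_algebra; exists v, C.
Qed.

Lemma sigma_algebra_vborel : sigma_algebra setT (@vborel R V).
Proof. exact: smallest_sigma_algebra. Qed.

Lemma measurable_borelV (A : set borelV) : measurable A -> vborel A.
Proof. by rewrite /measurable/= sigma_algebra_id//; exact: sigma_algebra_vborel. Qed.

Lemma measurable_random_vector d (Omega : measurableType d) (Y : Omega -> V -> R) :
  random_vector Y -> measurable_fun setT (Y : Omega -> borelV).
Proof.
move=> mY _ A mA; rewrite setTI.
have : vborel A by exact: measurable_borelV.
apply: (@smallest_sub _ _ _ [set A | measurable (Y @^-1` A)]).
  split.
  - by rewrite /= preimage_set0.
  - by move=> B /= mB; rewrite setTD preimage_setC; exact: measurableC.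
  - by move=> S /= mS; rewrite preimage_bigcup; exact: bigcupT_measurable.
move=> _ [v [C [mC ->]]] /=.
by have := mY v measurableT C mC; rewrite setTI.
Qed.

Lemma same_law_integral d d' (Omega : measurableType d) (Omega' : measurableType d')
    (P : probability Omega R) (P' : probability Omega' R)
    (Y : Omega -> V -> R) (Y' : Omega' -> V -> R) (f : borelV -> \bar R) :
  random_vector Y -> random_vector Y' -> same_law P P' Y Y' ->
  measurable_fun setT f -> (forall y, 0 <= f y) ->
  \int[P]_o f (Y o) = \int[P']_o f (Y' o).
Proof.
move=> /measurable_random_vector mY /measurable_random_vector mY' law mf f0.
have [m1 [m1E m1I]] := pushforward_measureP P mY.
have [m2 [m2E m2I]] := pushforward_measureP P' mY'.
rewrite -[LHS](m1I f mf f0) -[RHS](m2I f mf f0).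
apply: eq_measure_integral => A mA _; rewrite m1E m2E; apply: law.
exact: measurable_borelV.
Qed.

End laws.

(** * Discretisation of the process *)

Section comparison.
Context {R : realType} {V : finType} {E : {set {set V}}} {w : {set V} -> R}.
Hypothesis HE : weighted_hypergraph E w.
Context {d : measure_display} {Omega : measurableType d} {P : probability Omega R}.
Local Notation Pi := (proj_x1 E w).
Local Notation g := (gamma2 E w).
Local Notation N := (#|V|.-2).
Local Open Scope ereal_scope.

Let VN : #|V| = N.+2.
Proof. by case: #|V| (two_vertices HE) => [|[|k]]. Qed.

Lemma measurable_proj d' (T : measurableType d') (x : T -> V -> R) :
  (forall v, measurable_fun setT (fun o => x o v)) ->
  forall v, measurable_fun setT (fun o => Pi (x o) v).
Proof.
move=> mx v; rewrite /proj_x1; apply: measurable_funB => //.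
apply: measurable_funM => //; apply: measurable_funM => //.
by rewrite /vdot; apply: measurable_sum => u; exact: measurable_funM.
Qed.

(** [integral_radial_gauss] is read backwards with no initial regularisation: [radial 0] leaves the
    indicator unchanged, and the single kick [S * xi] produces all of the standard deviation [S]. *)
Lemma hat_integral d' (Omega' : measurableType d') (P' : probability Omega' R)
    (Y0 xi : Omega' -> V -> R) (a S b : R) :
  random_vector Y0 -> (0 <= S)%R ->
  indep_gaussian_vector P' (preimage_set_system setT Y0 (@vborel R V)) 1 xi ->
  \int[P']_o radial S N.+1 (above b)
    (vdot (fun v => a * Pi (Y0 o) v)%R (fun v => a * Pi (Y0 o) v)%R) =
  P' [set o | (b <= vdot (fun v => a * Pi (Y0 o) v + S * xi o v)
                         (fun v => a * Pi (Y0 o) v + S * xi o v))%R].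
Proof.
move=> mY0 S0 ixi.
have mY := measurable_random_vector mY0.
have sG : sigma_algebra setT (preimage_set_system setT Y0 (@vborel R V)).
  by apply: sigma_algebra_preimage; exact: sigma_algebra_vborel.
have Gm : preimage_set_system setT Y0 (@vborel R V) `<=` measurable.
  move=> _ [A vA <-]; apply: mY => //.
  exact: sub_sigma_algebra.
have mPi : forall v, measurable_fun setT (fun y : @borelV R V => Pi y v).
  by apply: measurable_proj => v; exact: measurable_coord.
have ZG v C : measurable C -> preimage_set_system setT Y0 (@vborel R V)
    ((fun o => Pi (Y0 o) v) @^-1` C).
  move=> mC; exists ((fun y => Pi y v) @^-1` C); last by rewrite setTI.
  by apply: measurable_borelV; have := mPi v measurableT C mC; rewrite setTI.
have e := integral_radial_gauss VN (monotone_test_above b) 0 a S sG Gm ZG ltr01 ixi.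
have SE : (Num.sqrt (0 ^+ 2 + (S * 1) ^+ 2) = S)%R.
  by rewrite expr0n add0r mulr1 sqrtr_sqr ger0_norm.
rewrite SE in e; apply: (eq_trans (esym e)).
pose y o v := (a * Pi (Y0 o) v + S * xi o v)%R.
have mPiY v : measurable_fun setT (fun o => Pi (Y0 o) v).
  by move=> _ C mC; rewrite setTI; apply: Gm; exact: ZG.
have mxi v : measurable_fun setT (fun o => xi o v).
  by case: ixi => m _ _; exact: m.
have my v : measurable_fun setT (fun o => y o v).
  apply: measurable_funD.
    exact: (measurable_funM (measurable_cst a) (mPiY v)).
  exact: (measurable_funM (measurable_cst S) (mxi v)).
have mf := measurable_vdot my.
apply: (eq_trans _ (integral_above P' b mf)); apply: eq_integral => o _.
exact: (radial_s0 _ _ (vdot_ge0 _)).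
Qed.

Context {F : R -> set (set Omega)} {B X : R -> Omega -> V -> R} {eta t : R}.
Hypotheses (HF : filtration F) (HB : brownian_motion P F B)
  (HX : ito_process P F B (laplacian E w) (Num.sqrt eta) X).
Hypotheses (eta0 : (0 <= eta)%R) (t0 : (0 < t)%R).

Lemma adapted_measurable (x : R -> Omega -> V -> R) s s' v : adapted F x ->
  (0 <= s)%R -> (s <= s')%R ->
  measurable_fun setT (fun o : g_sigma_algebraType (F s') => x s o v).
Proof.
move=> ax s0 ss' _ C mC; rewrite setTI; apply: sub_sigma_algebra.
by apply: (filtration_mono HF s0 ss'); exact: ax.
Qed.

Lemma random_vector_adapted (x : R -> Omega -> V -> R) s : adapted F x ->
  (0 <= s)%R -> random_vector (x s).
Proof.
move=> ax s0 v _ C mC; rewrite setTI.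
by apply: (filtration_measurable HF s0); exact: ax.
Qed.

Section mesh.
Variables (m : nat) (eps : R).
Hypotheses (m0 : (0 < m)%N) (eps0 : (0 <= eps)%R).
Let h : R := (t / m%:R)%R.
Let time (k : nat) : R := (k%:R * h)%R.

Let Z k (o : Omega) : V -> R := Pi (X (time k) o).
Let xi k (o : Omega) : V -> R := fun v => (B (time k.+1) o v - B (time k) o v)%R.
Let kick k (o : Omega) : V -> R := fun v => (Z k o v + Num.sqrt eta * xi k o v)%R.

Definition good_step k (o : Omega) : bool :=
  (vdot (Z k.+1 o) (Z k.+1 o) <=
   expR (- (2 * g * h)) * vdot (kick k o) (kick k o) + h * eps)%R.

Fixpoint good_until k (o : Omega) : bool :=
  if k is k'.+1 then good_until k' o && good_step k' o else true.

(* The process is set to 0 from the first bad step on. *)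
Definition killed k (o : Omega) : V -> R := fun v => if good_until k o then Z k o v else 0%R.

Let h0 : (0 < h)%R.
Proof. by rewrite /h divr_gt0// ltr0n. Qed.

Let time_ge0 k : (0 <= time k)%R.
Proof. by rewrite /time mulr_ge0// ltW. Qed.

Let time_le k k' : (k <= k')%N -> (time k <= time k')%R.
Proof. by move=> kk'; rewrite /time ler_wpM2r ?ler_nat// ltW. Qed.

Let mZ k k' v : (k <= k')%N ->
  measurable_fun setT (fun o : g_sigma_algebraType (F (time k')) => Z k o v).
Proof.
move=> kk'; apply: measurable_proj => u.
by apply: adapted_measurable => //; [exact: ito_adapted HX|exact: time_le].
Qed.

Let mgood k k' : (k <= k')%N ->
  measurable_fun setT (fun o : g_sigma_algebraType (F (time k')) => good_until k o).
Proof.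
elim: k => [//|k IH] kk' /=.
apply: measurable_and; first by apply: IH; exact: ltnW.
apply: measurable_fun_ler.
  by apply: measurable_vdot => v; exact: mZ.
apply: measurable_funD => //; apply: measurable_funM => //.
have mB i v : (i <= k')%N ->
    measurable_fun setT (fun o : g_sigma_algebraType (F (time k')) => B (time i) o v).
  by move=> ik; apply: adapted_measurable; [exact: brownian_adapted HB| |exact: time_le].
have mxi v := measurable_funB (mB k.+1 v kk') (mB k v (ltnW kk')).
apply: measurable_vdot => v; apply: (measurable_funD (mZ v (ltnW kk'))).
exact: (measurable_funM (measurable_cst (Num.sqrt eta)) (mxi v)).
Qed.

Let killed_adapted k v C : measurable C -> F (time k) ((fun o => killed k o v) @^-1` C).
Proof.
move=> mC.
have mk : measurable_fun setT (fun o : g_sigma_algebraType (F (time k)) => killed k o v).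
  apply: measurable_fun_ifT; [exact: mgood|exact: mZ|exact: measurable_cst].
have := mk measurableT C mC; rewrite setTI /measurable/= sigma_algebra_id//.
exact: filtration_sigma HF _ (time_ge0 k).
Qed.

Lemma measurable_killed k v : measurable_fun setT (fun o => killed k o v).
Proof.
move=> _ C mC; rewrite setTI; apply: (filtration_measurable HF (time_ge0 k)).
exact: killed_adapted.
Qed.

Lemma measurable_good_until k : measurable [set o | good_until k o].
Proof.
have mg := mgood (leqnn k).
have := mg measurableT [set true] I.
rewrite setTI => H; apply: (filtration_measurable HF (time_ge0 k)).
by move: H; rewrite /measurable/= sigma_algebra_id//; exact: filtration_sigma HF _ (time_ge0 k).
Qed.

Let S sigma := chain_std sigma (expR (- (g * h))) (Num.sqrt eta * Num.sqrt h) m.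

Let xi_indep k : indep_gaussian_vector P (F (time k)) (Num.sqrt h) (xi k).
Proof.
have hE : (h = time k.+1 - time k)%R by rewrite /time -natr1; ring.
rewrite {1}hE; apply: (brownian_increment HB) => //.
by rewrite -subr_gt0 -hE.
Qed.

(** While the chain survives this is [good_step]; once it is killed, the left side is 0 and the
    right side nonnegative. *)
Let killed_step k (o : Omega) : (k < m)%N ->
  (vdot (killed k.+1 o) (killed k.+1 o) <= expR (- (g * h)) ^+ 2 *
    vdot (fun v => killed k o v + Num.sqrt eta * xi k o v)
         (fun v => killed k o v + Num.sqrt eta * xi k o v) + h * eps)%R.
Proof.
move=> _; have he : (0 <= h * eps)%R by rewrite mulr_ge0// ltW.
have cE : (expR (- (g * h)) ^+ 2 = expR (- (2 * g * h)))%R.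
  by rewrite -expRM_natl; congr expR; ring.
rewrite /killed /=; case: (good_until k o) => /=; last first.
  rewrite [leLHS](_ : _ = 0%R); last by rewrite /vdot big1// => v _; rewrite mul0r.
  by rewrite addr_ge0// mulr_ge0 ?sqr_ge0// vdot_ge0.
case: (boolP (good_step k o)) => [gs|_]; first by rewrite cE.
rewrite [leLHS](_ : _ = 0%R); last by rewrite /vdot big1// => v _; rewrite mul0r.
by rewrite addr_ge0// mulr_ge0 ?sqr_ge0// vdot_ge0.
Qed.

Lemma killed_integral_le sigma (b : R) : (0 < sigma)%R ->
  \int[P]_o radial sigma N.+1 (above b) (vdot (killed m o) (killed m o)) <=
  \int[P]_o radial (S sigma) N.+1 (above b)
     (vdot (fun v => expR (- (g * t)) * Pi (X 0 o) v)%R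
           (fun v => expR (- (g * t)) * Pi (X 0 o) v)%R) +
  (t * eps / (2 * sigma ^+ 2))%:E.
Proof.
move=> sigma0.
have g0 := gamma2_ge0 HE.
have c01 : (0 <= expR (- (g * h)) <= 1)%R.
  by rewrite expR_ge0 /= -expR0 ler_expR oppr_le0 mulr_ge0// ltW.
have sh0 : (0 < Num.sqrt h)%R by rewrite sqrtr_gt0.
have he : (0 <= h * eps)%R by rewrite mulr_ge0// ltW.
have sF k : sigma_algebra setT (F (time k)) by exact: filtration_sigma HF _ (time_ge0 k).
have Fm k : F (time k) `<=` measurable by exact: filtration_measurable HF _ (time_ge0 k).
have chain := integral_chain VN (monotone_test_above b) sF Fm killed_adapted sigma0 c01 sh0 he
   xi_indep (fun k km o => killed_step o km) (leqnn m).
rewrite subnn in chain; apply: (le_trans _ (le_trans chain _)).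
  rewrite le_eqVlt; apply/orP; left; apply/eqP; apply: eq_integral => o _.
  by rewrite expr0 expr1n mul1r.
apply: leeD.
  rewrite le_eqVlt; apply/orP; left; apply/eqP; apply: eq_integral => o _.
  congr radial; have -> : (expR (- (g * h)) ^+ m = expR (- (g * t)))%R.
    rewrite -expRM_natr; congr expR; rewrite /h mulNr -mulrA divfK//.
    by rewrite pnatr_eq0 -lt0n.
  rewrite /vdot mulr_sumr; apply: eq_bigr => v _.
  by rewrite /killed /= /Z /time mul0r; ring.
rewrite lee_fin le_eqVlt; apply/orP; left; apply/eqP.
rewrite /h; field; rewrite gt_eqF//= pnatr_eq0 -lt0n//.
Qed.

End mesh.
End comparison.

Arguments good_step {R V} E w {d Omega} B X eta t m eps k o.
Arguments good_until {R V} E w {d Omega} B X eta t m eps k o.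
Arguments killed {R V} E w {d Omega} B X eta t m eps k o.

(** * Estimate for a fixed mesh *)

Section mesh_domination.
Context {R : realType} {V : finType} {E : {set {set V}}} {w : {set V} -> R}.
Hypothesis HE : weighted_hypergraph E w.
Context {d : measure_display} {Omega : measurableType d} {P : probability Omega R}.
Context {F : R -> set (set Omega)} {B X : R -> Omega -> V -> R} {eta t : R}.
Hypotheses (HF : filtration F) (HB : brownian_motion P F B)
  (HX : ito_process P F B (laplacian E w) (Num.sqrt eta) X).
Hypotheses (eta0 : 0 <= eta) (t0 : 0 < t).
Local Notation Pi := (proj_x1 E w).
Local Notation g := (gamma2 E w).
Local Notation N := (#|V|.-2).
Local Notation nu := (@normal_prob R 0 1).
Local Notation good m eps := (good_until E w B X eta t m eps m).

(** [path_steps] applies to almost every path, with an [m0] that depends on the path. The shift to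
    [m.+1] ensures a positive number of steps. *)
Lemma good_eventually (eps : R) : 0 < eps ->
  {ae P, forall o, exists m0, forall m, (m0 <= m)%N -> ~ (~~ good m.+1 eps o)}.
Proof.
move=> eps0.
have cX := ito_continuous HX; have cB := brownian_continuous HB.
have iX := ito_integrable HX; have eX := ito_equation HX.
apply: (filterS _ (filterI (filterI cX cB) (filterI iX eX))).
move=> o [[cXo cBo] [iXo eXo]].
have [m0 H] := path_steps HE t0 eps0 cXo cBo iXo eXo.
exists m0 => m m0m; apply/negP; rewrite negbK.
have step k : (k < m.+1)%N -> good_step E w B X eta t m.+1 eps k o.
  move=> km; exact: (H m.+1 (leq_trans m0m (leqnSn m)) (ltn0Sn m) k km _ _ erefl erefl).
have : forall k, (k <= m.+1)%N -> good_until E w B X eta t m.+1 eps k o.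
  by elim=> [//|k IH] km /=; rewrite IH ?step// ltnW.
exact.
Qed.

Local Open Scope ereal_scope.

Context {d' : measure_display} {Omega' : measurableType d'} {P' : probability Omega' R}
  {Y0 xi : Omega' -> V -> R}.
Hypotheses (mY0 : random_vector Y0) (lawY0 : same_law P P' (X 0) Y0)
  (ixi : indep_gaussian_vector P' (preimage_set_system setT Y0 (@vborel R V)) 1 xi).

Let hat (S : R) (o : Omega') : V -> R :=
  fun v => (expR (- (g * t)) * Pi (Y0 o) v + S * xi o v)%R.

Let hat_sqr S o := vdot (hat S o) (hat S o).

(** Regularising the indicator blurs the threshold: lowering it by [q] makes the regularised
    function at least [nu [-L, L]] wherever the norm reaches [beta]. The other two error terms are
    the cost of the recursion and the probability of killing. *)
Lemma domination_mesh (m : nat) (eps sigma q beta L : R) : (0 < m)%N -> (0 <= eps)%R ->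
  (0 < sigma)%R -> (0 <= beta)%R -> (sigma * L <= q)%R ->
  nu `[(- L)%R, L] * P [set o | (beta ^+ 2 <= vdot (Pi (X t o)) (Pi (X t o)))%R] <=
  P' [set o | (Num.max 0 (beta - q) ^+ 2 <= hat_sqr
    (chain_std sigma (expR (- (g * (t / m%:R)))) (Num.sqrt eta * Num.sqrt (t / m%:R)) m) o)%R]
  + (t * eps / (2 * sigma ^+ 2))%:E + P [set o | ~~ good m eps o].
Proof.
move=> m0 eps0 sigma0 beta0 sL.
have VN : #|V| = N.+2 by case: #|V| (two_vertices HE) => [|[|k]].
set b := (Num.max 0 (beta - q) ^+ 2)%R.
set Bset := [set o | (beta ^+ 2 <= vdot (Pi (X t o)) (Pi (X t o)))%R].
set bad := [set o | ~~ good m eps o].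
have tb := monotone_test_above b.
pose K := killed E w B X eta t m eps m.
have mgood : measurable [set o | good m eps o].
  exact: (measurable_good_until HF HB HX t0 eps m0 m).
have mbad : measurable bad.
  have -> : bad = ~` [set o | good m eps o] by apply/seteqP; split => o /=; move/negP.
  exact: measurableC.
have mX v : measurable_fun setT (fun o => X t o v).
  exact: (random_vector_adapted HF (ito_adapted HX) (ltW t0)).
have mPX v : measurable_fun setT (fun o => Pi (X t o) v) by exact: measurable_proj.
have mB : measurable Bset.
  have mf := measurable_vdot mPX; exact: (measurable_superlevel (beta ^+ 2)%R mf).
have tmE : (m%:R * (t / m%:R) = t)%R by rewrite mulrC divfK// pnatr_eq0 -lt0n.
have KE o : K o = (fun v => if good m eps o then Pi (X t o) v else 0%R).
  by rewrite /K /killed tmE.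
have mK v : measurable_fun setT (fun o => K o v).
  exact: (measurable_killed HF HB HX t0 eps m0 m v).
have mKK := measurable_vdot mK.
pose f o := radial sigma N.+1 (above b) (vdot (K o) (K o)).
have mf : measurable_fun setT f.
  exact: (measurableT_comp (measurable_radial N tb sigma) mKK).
have f0 o : 0 <= f o by exact: radial_ge0.
have k1 : nu `[(- L)%R, L] <= 1 by apply: probability_le1; exact: measurable_itv.
have k0 : 0 <= nu `[(- L)%R, L] by exact: measure_ge0.
pose u o := nu `[(- L)%R, L] * (\1_Bset o)%:E.
have u0 o : 0 <= u o by rewrite mule_ge0// lee_fin.
have mu1 : measurable_fun setT u.
  by apply: emeasurable_funM => //; apply/measurable_EFinP; exact: measurable_indic.
have mbad1 : measurable_fun setT (fun o => (\1_bad o)%:E : \bar R).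
  by apply/measurable_EFinP; exact: measurable_indic.
have bad0 o : 0 <= (\1_bad o)%:E :> \bar R by rewrite lee_fin.
have uE : \int[P]_o u o = nu `[(- L)%R, L] * P Bset.
  rewrite ge0_integralZl//; last by apply/measurable_EFinP; exact: measurable_indic.
  by rewrite integral_indic// setIT.
have fE : \int[P]_o (f o + (\1_bad o)%:E) = \int[P]_o f o + P bad.
  by rewrite ge0_integralD// integral_indic// setIT.
(* On the good event the killed chain ends at [Pi (X t o)] and [radial_above_ge] applies; on the bad
   one the indicator suffices, as [nu [-L, L] <= 1]. *)
have ufb o : u o <= f o + (\1_bad o)%:E.
  rewrite /u !indicE; have [/set_mem Bo|_] := boolP (o \in Bset); last first.
    by rewrite mule0 adde_ge0.
  rewrite mule1; have [go|ng] := boolP (good m eps o).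
    rewrite (_ : (o \in bad) = false); last by apply/negbTE; rewrite notin_setE /bad /= go.
    rewrite adde0 /f KE go.
    apply: (le_trans (radial_above_ge N.+1 (ltW sigma0) beta0 sL)).
    by apply: (radial_le _ _ _ _ _ sigma0 tb (sqr_ge0 _)).
  rewrite mem_set//; apply: (le_trans k1).
  by rewrite -[leLHS]add0e leeD2r.
have step1 : nu `[(- L)%R, L] * P Bset <= \int[P]_o f o + P bad.
  rewrite -uE -fE; apply: ge0_le_integral => //.
  exact: emeasurable_funD.
apply: (le_trans step1); apply: leeD (lexx _).
apply: (le_trans (killed_integral_le HE HF HB HX t0 m0 eps0 b sigma0)).
apply: leeD (lexx _).
set S := chain_std _ _ _ _.
have S0 : (0 <= S)%R.
  by apply: (le_trans (ltW sigma0)); apply: chain_std_ge; exact: ltW.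
pose G (y : @borelV R V) := radial S N.+1 (above b)
  (vdot (fun v => expR (- (g * t)) * Pi y v)%R (fun v => expR (- (g * t)) * Pi y v)%R).
have mG : measurable_fun setT G.
  apply: (measurableT_comp (measurable_radial N tb S)).
  apply: measurable_vdot => v; apply: measurable_funM => //.
  by apply: measurable_proj => v'; exact: measurable_coord.
have G0 y : 0 <= G y by exact: radial_ge0.
have mX0 := random_vector_adapted HF (ito_adapted HX) (lexx 0%R).
have law := same_law_integral mX0 mY0 lawY0 mG G0.
have hatE := hat_integral HE (expR (- (g * t))) b mY0 S0 ixi.
by rewrite le_eqVlt; apply/orP; left; apply/eqP; apply: (eq_trans law hatE).
Qed.

End mesh_domination.

Section limit.
Context {R : realType}.
Local Notation nu := (@normal_prob R 0 1).

Lemma normal_prob_segment_cvg :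
  fine (nu `[- j.+1%:R, j.+1%:R]%classic) @[j --> \oo] --> (1 : R).
Proof.
pose S (j : nat) : set R := `[- j.+1%:R, j.+1%:R]%classic.
have mS j : measurable (S j) by exact: measurable_itv.
have ST : \bigcup_j S j = setT.
  apply/seteqP; split => // x _; exists (Num.bound `|x|) => //.
  rewrite /S /= in_itv/= -ler_norml.
  by apply: (le_trans (ltW (archi_boundP (normr_ge0 x)))); rewrite ler_nat.
have ndS : {homo S : n m / (n <= m)%N >-> (n <= m)%O}.
  move=> n m nm; rewrite subsetEset => x; rewrite /S /= !in_itv/= -!ler_norml => /le_trans.
  by apply; rewrite ler_nat.
have mU : measurable (\bigcup_j S j) by rewrite ST.
have h := nondecreasing_cvg_mu (mu := nu) mS mU ndS.
have e : nu (\bigcup_j S j) = 1%:E by rewrite ST; exact: probability_setT.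
have /fine_cvgP[] : nu (S j) @[j --> \oo] --> 1%:E by rewrite -e; exact: h.
by [].
Qed.

End limit.

(** * Passage to the limit *)

Section domination.
Context {R : realType} {V : finType} {E : {set {set V}}} {w : {set V} -> R}.
Hypothesis HE : weighted_hypergraph E w.
Context {d : measure_display} {Omega : measurableType d} {P : probability Omega R}.
Context {F : R -> set (set Omega)} {B X : R -> Omega -> V -> R} {eta t : R}.
Hypotheses (HF : filtration F) (HB : brownian_motion P F B)
  (HX : ito_process P F B (laplacian E w) (Num.sqrt eta) X).
Hypotheses (eta0 : 0 <= eta) (t0 : 0 < t).
Local Notation Pi := (proj_x1 E w).
Local Notation g := (gamma2 E w).
Local Notation nu := (@normal_prob R 0 1).
Local Notation good m eps := (good_until E w B X eta t m eps m).

Lemma mesh_exists (eps q : R) : 0 < eps -> 0 < q -> exists m,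
  [/\ (0 < m)%N, eta * (t / m%:R) <= q & (P [set o | ~~ good m eps o] <= q%:E)%E].
Proof.
move=> eps0 q0.
pose A m := [set o | ~~ good m.+1 eps o].
have mA m : measurable (A m).
  have -> : A m = ~` [set o | good m.+1 eps o] by apply/seteqP; split => o /=; move/negP.
  by apply: measurableC; exact: (measurable_good_until HF HB HX t0 eps (ltn0Sn m) m.+1).
have [m0 Hm0] := probability_eventually mA (good_eventually HE HB HX t0 eps0) q0.
have k0 : 0 <= eta * t / q by rewrite divr_ge0 ?mulr_ge0// ltW.
set k := Num.bound (eta * t / q).
have := archi_boundP k0; rewrite -/k => hk.
exists (maxn m0 k).+1; split=> //; last by apply: Hm0; exact: leq_maxl.
rewrite mulrA ler_pdivrMr ?ltr0n// -ler_pdivrMl// mulrC.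
by apply: (le_trans (ltW hk)); rewrite ler_nat leqW// leq_maxr.
Qed.

Context {d' : measure_display} {Omega' : measurableType d'} {P' : probability Omega' R}
  {Y0 xi : Omega' -> V -> R}.
Hypotheses (mY0 : random_vector Y0) (lawY0 : same_law P P' (X 0) Y0)
  (ixi : indep_gaussian_vector P' (preimage_set_system setT Y0 (@vborel R V)) 1 xi).

Let hat (S : R) (o : Omega') : V -> R :=
  fun v => expR (- (g * t)) * Pi (Y0 o) v + S * xi o v.

Let hat_sqr S o := vdot (hat S o) (hat S o).

Let measurable_hat_sqr S : measurable_fun setT (hat_sqr S).
Proof.
have mxi v : measurable_fun setT (fun o => xi o v) by case: ixi => m _ _; exact: m.
apply: measurable_vdot => v; apply: measurable_funD.
  exact: (measurable_funM (measurable_cst _) (measurable_proj mY0 v)).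
exact: (measurable_funM (measurable_cst S) (mxi v)).
Qed.

Let hat_sqr_cvg (s : R^nat) (S : R) o : s @ \oo --> S ->
  hat_sqr (s j) o @[j --> \oo] --> hat_sqr S o.
Proof.
move=> sS; rewrite /hat_sqr /vdot.
apply: cvg_big => [|v _]; first exact: add_continuous.
have h : hat (s j) o v @[j --> \oo] --> hat S o v.
  by apply: cvgD; [exact: cvg_cst|apply: cvgM => //; exact: cvg_cst].
exact: cvgM.
Qed.

Lemma domination_sqr (beta : R) : 0 < beta ->
  (P [set o | (beta ^+ 2 <= vdot (Pi (X t o)) (Pi (X t o)))%R] <=
   P' [set o | (beta ^+ 2 <= hat_sqr (Num.sqrt (ou_variance g eta t)) o)%R])%E.
Proof.
move=> beta0.
set x := P _.
(* The parameters make every error term of domination_mesh at most q: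
   sigma L = q and t eps / (2 sigma^2) = q, with L = 1 / q. *)
pose q (j : nat) : R := j.+1%:R^-1.
have q0 j : 0 < q j by rewrite invr_gt0 ltr0n.
have q1 j : q j <= 1 by rewrite invf_le1 ?ltr0n// ler1n.
have qcvg : q @ \oo --> (0 : R) by exact: cvg_harmonic.
pose eps j := 2 * q j ^+ 5 / t.
have eps0 j : 0 < eps j by rewrite /eps divr_gt0// mulr_gt0// exprn_gt0.
have [m Hm] := choice (fun j => mesh_exists (eps0 j) (q0 j)).
pose sigma j := q j ^+ 2.
pose S j := chain_std (sigma j) (expR (- (g * (t / (m j)%:R))))
  (Num.sqrt eta * Num.sqrt (t / (m j)%:R)) (m j).
set ou := ou_variance g eta t.
have S0 j : 0 <= S j.
  apply: (@le_trans _ _ (sigma j)); first exact: sqr_ge0.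
  by apply: chain_std_ge; exact: sqr_ge0.
(* The regularisation contributes sigma^2 = q^4 <= q and the Riemann sum an error at most
   [eta * h <= q], hence the width [2 * q j]. *)
have Ssqr : (S j ^+ 2) @[j --> \oo] --> ou.
  apply: (@squeeze_cvgr _ _ _ _ (fun j => ou - 2 * q j) (fun j => ou + 2 * q j)).
  - apply: nearW => j; have [mj0 hm _] := Hm j.
    have := le_trans (chain_std_ou (sigma j) (gamma2_ge0 HE) eta0 t0 mj0) hm.
    rewrite -/(S j) -/ou.
    have : 0 <= sigma j ^+ 2 <= q j.
      rewrite sqr_ge0 /sigma -exprM -[leRHS]expr1 /=.
      by rewrite ler_wiXn2l// ltW.
    move=> /andP[h1 h2]; rewrite ler_norml => /andP[h3 h4]; lra.
  - rewrite -[X in _ --> X]subr0 -[X in _ --> _ - X](mulr0 2).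
    by apply: cvgB; [exact: cvg_cst|apply: cvgM => //; exact: cvg_cst].
  - rewrite -[X in _ --> X]addr0 -[X in _ --> _ + X](mulr0 2).
    by apply: cvgD; [exact: cvg_cst|apply: cvgM => //; exact: cvg_cst].
have Scvg : S @ \oo --> Num.sqrt ou.
  have -> : S = (fun j => Num.sqrt (S j ^+ 2)).
    by apply/funext => j; rewrite sqrtr_sqr ger0_norm.
  by apply: continuous_cvg => //; exact: sqrt_continuous.
pose b j := Num.max 0 (beta - q j) ^+ 2.
have bcvg : b @ \oo --> beta ^+ 2.
  have c : Num.max 0 (beta - q j) @[j --> \oo] --> beta.
    apply: (@squeeze_cvgr _ _ _ _ (fun j => beta - q j) (fun=> beta)); last exact: cvg_cst.
      apply: nearW => j; rewrite le_max lexx orbT /= ge_max (ltW beta0)/=.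
      by rewrite lerBlDr lerDl ltW.
    rewrite -[X in _ --> X]subr0; by apply: cvgB => //; exact: cvg_cst.
  by rewrite /b expr2; under eq_fun do rewrite expr2; exact: cvgM.
pose A j := [set o | b j <= hat_sqr (S j) o].
pose k j := fine (nu `[- j.+1%:R, j.+1%:R]%classic).
(* One [q j] is the cost of the recursion, the other bounds the probability of killing; [1 - k j]
   pays for dropping the factor [nu [-L, L]], as probabilities are at most 1. *)
pose e j := 2 * q j + (1 - k j).
apply: (le_probability_limsup (E := A) (e := e)).
- by move=> j; apply: measurable_superlevel; exact: measurable_hat_sqr.
- by apply: measurable_superlevel; exact: measurable_hat_sqr.
(* The gap [b j - hat_sqr (S j) o] converges for each [o]; a positive limit would exclude [A j] from
   some index on. The closed inequality therefore survives the limit. *)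
- move=> o Lo; rewrite /= leNgt; apply/negP => lt.
  have c : (b j - hat_sqr (S j) o) @[j --> \oo] --> beta ^+ 2 - hat_sqr (Num.sqrt ou) o.
    by apply: cvgB => //; exact: hat_sqr_cvg.
  have lt0 : 0 < beta ^+ 2 - hat_sqr (Num.sqrt ou) o by rewrite subr_gt0.
  have [n _ Hn] := cvgr_gt _ c _ lt0.
  have [j /= nj Aj] := Lo n I.
  by have := Hn j nj; rewrite /= subr_gt0 ltNge Aj.
- have -> : (0 : R) = 2 * 0 + (1 - 1) by rewrite mulr0 subrr addr0.
  apply: cvgD; first by apply: cvgM => //; exact: cvg_cst.
  by apply: cvgB; [exact: cvg_cst|exact: normal_prob_segment_cvg].
- move=> j; have [mj0 _ pm] := Hm j.
  have sL : sigma j * j.+1%:R <= q j.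
    by rewrite /sigma /q expr2 mulfVK// pnatr_eq0.
  have main := domination_mesh HE HF HB HX t0 mY0 lawY0 ixi mj0 (ltW (eps0 j))
    (exprn_gt0 2 (q0 j)) (ltW beta0) sL.
  have eE : t * eps j / (2 * (q j ^+ 2) ^+ 2) = q j.
    by rewrite /eps; field; rewrite !gt_eqF.
  rewrite eE in main.
  have mX v : measurable_fun setT (fun o => X t o v).
    exact: (random_vector_adapted HF (ito_adapted HX) (ltW t0)).
  have mBeta := measurable_superlevel (beta ^+ 2) (measurable_vdot (measurable_proj mX)).
  have mA : measurable (A j) by apply: measurable_superlevel; exact: measurable_hat_sqr.
  have mK : measurable (`[- j.+1%:R, j.+1%:R]%classic : set R) by exact: measurable_itv.
  have k1 : k j <= 1 by rewrite -lee_fin /k fineK ?fin_num_measure//; exact: probability_le1.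
  have x1 : fine x <= 1 by rewrite -lee_fin fineK ?fin_num_measure//; exact: probability_le1.
  have xE : x = (fine x)%:E by rewrite fineK// fin_num_measure.
  have AE : P' (A j) = (fine (P' (A j)))%:E by rewrite fineK// fin_num_measure.
  have kE : nu `[- j.+1%:R, j.+1%:R]%classic = (k j)%:E.
    by rewrite /k fineK// fin_num_measure.
  have := le_trans main (leeD (lexx _) pm).
  rewrite -/x -/(S j) -/(A j) AE kE xE -EFinM -!EFinD !lee_fin => h.
  have : (1 - k j) * fine x <= 1 - k j by rewrite ler_piMr// subr_ge0.
  rewrite /e; lra.
Qed.

End domination.

Theorem mainTheorem2 (R : realType) (V : finType)
    (E : {set {set V}}) (w : {set V} -> R)
    (HE : weighted_hypergraph E w)
    (eta : R) (eta_ge0 : 0 <= eta)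
    (d : measure_display) (Omega : measurableType d) (P : probability Omega R)
    (F : R -> set (set Omega)) (HF : filtration F)
    (B : R -> Omega -> V -> R) (HB : brownian_motion P F B)
    (X : R -> Omega -> V -> R)
    (HX : ito_process P F B (laplacian E w) (Num.sqrt eta) X)
    (t : R) (t_ge0 : 0 <= t)
    (d' : measure_display) (Omega' : measurableType d')
    (P' : probability Omega' R)
    (* an independent pair (copy of X_0, standard Gaussian vector) *)
    (Y0 N : Omega' -> V -> R)
    (Y0_meas : random_vector Y0) (Y0_law : same_law P P' (X 0) Y0)
    (HN : indep_gaussian_vector P' (preimage_set_system setT Y0 (@vborel R V))
            1 N)
    (Xhat : Omega' -> V -> R)
    (HXhat : forall omega v, Xhat omega v =
       expR (- (gamma2 E w * t)) * proj_x1 E w (Y0 omega) v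
       + Num.sqrt (ou_variance (gamma2 E w) eta t) * N omega v) :
  stochastically_dominated P P'
    (fun omega => vnorm (proj_x1 E w (X t omega)))
    (fun omega => vnorm (Xhat omega)).
Proof.
rewrite /stochastically_dominated => a.
have sqr_le (x : V -> R) : 0 < a -> (a <= vnorm x) = (a ^+ 2 <= vdot x x).
  move=> a0; rewrite /vnorm -[in RHS](sqr_sqrtr (vdot_ge0 x)).
  by rewrite ler_sqr// nnegrE ?sqrtr_ge0// ltW.
have superlevel_sqr T (x : T -> V -> R) : 0 < a ->
    [set o | a <= vnorm (x o)] = [set o | a ^+ 2 <= vdot (x o) (x o)].
  by move=> a0; apply/seteqP; split => o /=; rewrite sqr_le.
have XhatE omega : Xhat omega = fun v => expR (- (gamma2 E w * t)) *
    proj_x1 E w (Y0 omega) v + Num.sqrt (ou_variance (gamma2 E w) eta t) * N omega v.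
  by apply/funext => v; exact: HXhat.
(* For [a <= 0] both events are sure; for positive [a] they can be squared. *)
have [a0|a0] := lerP a 0.
  have -> : [set omega | a <= vnorm (Xhat omega)]%R = setT.
    by apply/seteqP; split => // omega _ /=; apply: (le_trans a0); exact: sqrtr_ge0.
  rewrite [leRHS]probability_setT; apply: probability_le1.
  have -> : [set omega | a <= vnorm (proj_x1 E w (X t omega))] = setT.
    by apply/seteqP; split => // omega _ /=; apply: (le_trans a0); exact: sqrtr_ge0.
  exact: measurableT.
(* At time 0 there is no mesh: the variance vanishes and [Xhat] is the projection of [Y0], so
   equality of the laws of [X 0] and [Y0] gives equal probabilities. *)
move: t_ge0; rewrite le_eqVlt => /orP[/eqP t0|t0].
  pose C : set (V -> R) := [set y | a <= vnorm (proj_x1 E w y)].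
  have vC : vborel C.
    apply: measurable_borelV.
    rewrite /C superlevel_sqr//.
    have mPi : forall v, measurable_fun setT (fun y : @borelV R V => proj_x1 E w y v).
      by apply: measurable_proj => v; exact: measurable_coord.
    exact: (measurable_superlevel (a ^+ 2) (measurable_vdot mPi)).
  have := Y0_law C vC; rewrite /preimage /C /= -t0 => ->.
  rewrite le_eqVlt; apply/orP; left; apply/eqP; congr (P' _).
  have ou0 : ou_variance (gamma2 E w) eta t = 0.
    by rewrite /ou_variance -t0 !mulr0 oppr0 expR0 subrr mulr0 if_same.
  have XhatE0 omega : Xhat omega = proj_x1 E w (Y0 omega).
    by rewrite XhatE ou0 sqrtr0 -t0 mulr0 oppr0 expR0; apply/funext => v; rewrite mul1r mul0r addr0.
  by apply/seteqP; split => omega /=; rewrite XhatE0.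
rewrite !superlevel_sqr//.
under [X in (_ <= P' X)%E]eq_set do rewrite XhatE.
exact: (domination_sqr HE HF HB HX eta_ge0 t0 Y0_meas Y0_law HN a0).
Qed.
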